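(* Let $\alpha\in(1,2)$ and let $X=\{X_t,t\ge 0\}$ be a symmetric $\alpha$-stable process in $\mathbb{R}$. Suppose that $f:\mathbb{R}\to\mathbb{R}$ is a bounded measurable function with $\int_{\mathbb{R}}|xf(x)|\,dx<\infty$. Then, for any $t>0$, $$\frac{1}{n^{2-\frac1\alpha}}\int_0^{nt}\int_0^u f(X_u-X_v)\,dv\,du\ \longrightarrow\ \left(\int_{\mathbb{R}}f(x)\,dx\right)L_t(0)\quad\text{in law as } n\to\infty,$$ where $L_t(0)$ is the self-intersection local time of $X$ at $0$.
   Context: A symmetric $\alpha$-stable process $X=\{X_t,t\ge0\}$ is an $\{\mathcal{F}_t\}$-adapted real-valued process on a complete filtered probability space $(\Omega,\mathcal{F},P,\mathcal{F}_t)$ with càdlàg sample paths, $X_0=0$, and $\mathbb{E}[e^{\iota u(X_t-X_s)}\mid\mathcal{F}_s]=e^{-(t-s)|u|^\alpha}$ for all $t>s\ge0$, $u\in\mathbb{R}$, where $\iota^2=-1$. Self-intersection local time: for $\varepsilon>0$ let $f_\varepsilon(x)=\frac1{\sqrt{2\pi\varepsilon}}e^{-|x|^2/(2\varepsilon)}$ and $\widehat{L}_{t,\varepsilon}(x)=\int_{0<r<s<t}f_\varepsilon(X_s-X_r-x)\,dr\,ds$. The self-intersection local time $L_t(x)$ (formally $\int_0^t\int_0^s\delta(X_s-X_r-x)\,dr\,ds$ with $\delta$ the Dirac delta) is the limit in $L^2$ of $\widehat{L}_{t,\varepsilon}(x)$ as $\varepsilon\to0$. *)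

(* Defs.v *)
From HB Require Import structures.
From mathcomp Require Import all_boot all_order all_algebra.
From mathcomp Require Import all_classical all_reals all_analysis.
From mathcomp Require Import complex.

Set Implicit Arguments.
Unset Strict Implicit.
Unset Printing Implicit Defensive.

Import Order.TTheory GRing.Theory Num.Theory.
Import numFieldNormedType.Exports.

Local Open Scope classical_set_scope.
Local Open Scope ring_scope.

Section conditional_expectation.
Context (R : realType) (d : measure_display) (Omega : measurableType d).
Variable P : probability Omega R.

Definition measurable_wrt (G : set (set Omega)) (Z : Omega -> R) : Prop :=
  forall B : set R, measurable B -> G (Z @^-1` B).

(* [Z] is a version of E[Y | G]. *)
Definition is_condexp (G : set (set Omega)) (Y Z : Omega -> R) : Prop :=
  [/\ P.-integrable setT (EFin \o Y),
      P.-integrable setT (EFin \o Z),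
      measurable_wrt G Z &
      forall A, G A -> \int[P]_(w in A) Z w = \int[P]_(w in A) Y w].

Definition is_complex_condexp (G : set (set Omega)) (Y Z : Omega -> R[i]) :
    Prop :=
  is_condexp G (fun w => complex.Re (Y w)) (fun w => complex.Re (Z w)) /\
  is_condexp G (fun w => complex.Im (Y w)) (fun w => complex.Im (Z w)).

End conditional_expectation.

Definition expi (R : realType) (x : R) : R[i] := Complex (cos x) (sin x).

Section stable_process.
Context (R : realType) (d : measure_display) (Omega : measurableType d).
Variable P : probability Omega R.

(* Time is [0, +oo[: values at negative indices are unconstrained here and in
   all the definitions below. *)
Definition is_filtration (F : R -> set (set Omega)) : Prop :=
  [/\ forall t, 0 <= t -> sigma_algebra setT (F t),
      forall t, 0 <= t -> F t `<=` measurable &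
      forall s t, 0 <= s -> s <= t -> F s `<=` F t].

Definition is_complete_filtration (F : R -> set (set Omega)) : Prop :=
  [/\ is_filtration F,
      measure_is_complete P &
      forall N : set Omega, P.-negligible N -> F 0 N].

Definition cadlag (x : R -> R) : Prop :=
  (forall t, 0 <= t -> x s @[s --> t^'+] --> x t) /\
  (forall t, 0 < t -> cvg (x s @[s --> t^'-])).

Definition is_symmetric_stable_process (F : R -> set (set Omega)) (alpha : R)
    (X : R -> Omega -> R) : Prop :=
  [/\ forall t, 0 <= t -> measurable_wrt (F t) (X t),
      forall w, cadlag (X ^~ w),
      forall w, X 0 w = 0 &
      forall s t u, 0 <= s -> s < t ->
        is_complex_condexp P (F s)
          (fun w => expi (u * (X t w - X s w)))
          (fun=> (expR (- ((t - s) * `|u| `^ alpha)))%:C%C)].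

End stable_process.

Section self_intersection_local_time.
Context (R : realType) (d : measure_display) (Omega : measurableType d).
Variables (P : probability Omega R) (X : R -> Omega -> R).

Definition heat_kernel (eps x : R) : R :=
  (Num.sqrt (2 * pi * eps))^-1 * expR (- (`|x| ^+ 2 / (2 * eps))).

Definition approx_silt (eps t x : R) (w : Omega) : R :=
  \int[(lebesgue_measure \x lebesgue_measure)%E]_(
      p in [set p : R * R | 0 < p.1 /\ p.1 < p.2 /\ p.2 < t])
    heat_kernel eps (X p.2 w - X p.1 w - x).

Definition is_silt (t x : R) (L : Omega -> R) : Prop :=
  L \in Lfun P 2%:E /\
  Lnorm P 2%:E (fun w => (approx_silt eps t x w - L w)%:E)
    @[eps --> 0^'+] --> 0%E.

(* The L^2 limit is unique up to P-null sets; [xget] picks a representative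
   (its default value [cst 0] would only be returned if there were no limit). *)
Definition silt (t x : R) : Omega -> R := xget (cst 0) [set L | is_silt t x L].

End self_intersection_local_time.

Definition cvg_in_law (R : realType) (d : measure_display)
    (Omega : measurableType d) (P : probability Omega R)
    (Y : nat -> Omega -> R) (Z : Omega -> R) : Prop :=
  [/\ forall n, measurable_fun setT (Y n),
      measurable_fun setT Z &
      forall h : R -> R, continuous h -> bounded_fun h ->
        'E_P[h \o Y n]%E @[n --> \oo] --> 'E_P[h \o Z]%E].

(* Main.v *)
(** Write [C(xi) + i S(xi)] for the Fourier transform of the occupation measure of
    [(u, v) |-> X_v - X_u] on [0 < u < v < t].  Sorting four times and using
    independent increments bounds [E |C + i S|^2 (xi)] by [12 t^2 / |xi|^(2 alpha)];
    as [alpha > 1], [C] and [S] are a.s. integrable, so the occupation measure has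
    a continuous density, given by Fourier inversion, and its value at [0] is a
    version of the L^2 limit defining the self-intersection local time.  Scaling
    time by [n] turns the left-hand side into
    [n^(1/alpha) * int f(X_(n v) - X_(n u))] over the same triangle.  The processes
    [X_(n .)] and [n^(1/alpha) X] have the same finite-dimensional distributions, so
    after replacing one by the other the rescaled occupation integral converges
    almost surely.  That the two functionals have the same law is seen by mollifying
    [f]: the mollified functionals are bounded integrals of cosines of linear
    combinations of the process, hence have equal moments and equal laws. *)

(* The self-intersection local time is only given as an L^2 limit, whereas the limit theorem needs
   it, path by path, as the value at 0 of a continuous density. The weight [w = (1 + |xi|)^(-alpha)]
   links the two. Second moments are of order [w^2], so [|C| <= C^2 / w + w] turns a bound in
   expectation into almost sure integrability of [C], and Cauchy-Schwarz with weight [w] turns the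
   same bound into L^2 convergence of the approximations. Integrability of [w] is what both
   arguments rest on.

   Self-similarity relates finite-dimensional distributions, not paths, and [f] is merely
   measurable, so the functional is not a limit of Riemann sums. Mollified functionals are
   superpositions of cosines, and powers of those linearise into cosines again. This is why the
   process enters only through expectations of cosines of linear combinations. The free phase [b] in
   these cosines also covers sines, so complex numbers disappear once the conditional characteristic
   function is split into real and imaginary parts. *)
Require Import Defs.
From HB Require Import structures.
From mathcomp Require Import all_boot all_order all_algebra.
From mathcomp Require Import all_classical all_reals all_analysis.
From mathcomp Require Import measurable_realfun lebesgue_integral_under.
From mathcomp Require Import complex ring lra.

Set Implicit Arguments.
Unset Strict Implicit.
Unset Printing Implicit Defensive.

Import Order.TTheory GRing.Theory Num.Theory.
Import numFieldNormedType.Exports.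

Local Open Scope classical_set_scope.
Local Open Scope ring_scope.

(** * Real-valued integrals and measurability *)

Notation Rintegrable mu f := (integrable mu setT (EFin \o f)).

Section real_integrals.
Context d (T : measurableType d) (R : realType).
Variable mu : {measure set T -> \bar R}.
Implicit Types f g b : T -> R.

Lemma Rintegrable_measurable f : Rintegrable mu f -> measurable_fun setT f.
Proof. by move=> /integrableP[/measurable_EFinP]. Qed.

Lemma Rintegrable_le f b : measurable_fun setT f -> Rintegrable mu b ->
  (forall x, `|f x| <= b x) -> Rintegrable mu f.
Proof.
move=> mf ib fb; apply: (le_integrable _ _ _ ib) => //.
  exact/measurable_EFinP.
by move=> x _; rewrite lee_fin (le_trans (fb x))// ler_norm.
Qed.

Lemma RintegralM c f : Rintegrable mu f ->
  \int[mu]_x (c * f x) = c * \int[mu]_x f x.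
Proof. by move=> fi; rewrite RintegralZl. Qed.

Lemma RintegralDT f g : Rintegrable mu f -> Rintegrable mu g ->
  \int[mu]_x (f x + g x) = \int[mu]_x f x + \int[mu]_x g x.
Proof. by move=> fi gi; rewrite RintegralD. Qed.

Lemma RintegralBT f g : Rintegrable mu f -> Rintegrable mu g ->
  \int[mu]_x (f x - g x) = \int[mu]_x f x - \int[mu]_x g x.
Proof. by move=> fi gi; rewrite RintegralB. Qed.

Lemma Rintegrable_norm f : Rintegrable mu f -> Rintegrable mu (fun x => `|f x|).
Proof.
by move=> fi; apply: (Rintegrable_le _ (b := fun x => `|f x|)) => //;
  [apply: measurableT_comp => //; exact: Rintegrable_measurable
  |exact: (integrable_norm fi)|move=> x; rewrite normr_id].
Qed.

Lemma RintegrableM c f : Rintegrable mu f -> Rintegrable mu (fun x => c * f x).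
Proof.
move=> fi; have := @integrableZl _ _ _ mu setT measurableT c (EFin \o f) fi.
by apply: eq_integrable => // x _.
Qed.

Lemma RintegrableD f g : Rintegrable mu f -> Rintegrable mu g ->
  Rintegrable mu (fun x => f x + g x).
Proof.
move=> fi gi; have := @integrableD _ _ _ mu setT measurableT _ _ fi gi.
by apply: eq_integrable => // x _.
Qed.

Lemma RintegrableB f g : Rintegrable mu f -> Rintegrable mu g ->
  Rintegrable mu (fun x => f x - g x).
Proof.
move=> fi gi; have := @integrableB _ _ _ mu setT measurableT _ _ fi gi.
by apply: eq_integrable => // x _.
Qed.

Lemma EFin_Rintegral f : Rintegrable mu f ->
  (\int[mu]_x f x)%:E = (\int[mu]_x (f x)%:E)%E.
Proof. by move=> fi; rewrite /Rintegral fineK//; exact: integrable_fin_num. Qed.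

Lemma Rintegral_dominated (f_ : nat -> T -> R) f g :
  (forall n, measurable_fun setT (f_ n)) -> measurable_fun setT f ->
  {ae mu, forall x, f_ ^~ x @ \oo --> f x} -> Rintegrable mu g ->
  (forall n x, `|f_ n x| <= g x) ->
  Rintegrable mu f /\ \int[mu]_x f_ n x @[n --> \oo] --> \int[mu]_x f x.
Proof.
move=> mf_ mf ff gi fg.
have [|||||fi _ cv] := @dominated_convergence _ T R mu setT measurableT
  (fun n => EFin \o f_ n) (EFin \o f) (EFin \o g).
- by move=> n; exact/measurable_EFinP.
- exact/measurable_EFinP.
- by apply: filterS ff => x fx _; exact: (cvg_EFin (nearW _ _)).
- exact: gi.
- by apply: aeW => x n _; rewrite lee_fin.
split => //; apply: fine_cvg.
by rewrite fineK; [exact: cv|exact: integrable_fin_num].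
Qed.

Lemma le_RintegralT f g : Rintegrable mu f -> Rintegrable mu g ->
  (forall x, f x <= g x) -> \int[mu]_x f x <= \int[mu]_x g x.
Proof. by move=> fi gi fg; apply: le_Rintegral => // x _; exact: fg. Qed.

End real_integrals.

Lemma eq_cvg_seq (R : realType) (u v : nat -> R) (l : R) : (forall n, u n = v n) ->
  v n @[n --> \oo] --> l -> u n @[n --> \oo] --> l.
Proof. by move=> uv; have -> : u = v by exact/funext. Qed.

Section measurable_funs.
Context d (T : measurableType d) (R : realType).
Implicit Types f g : T -> R.

Lemma mfunM f g : measurable_fun setT f -> measurable_fun setT g ->
  measurable_fun setT (fun x => f x * g x).
Proof. exact: measurable_funM. Qed.

Lemma mfunD f g : measurable_fun setT f -> measurable_fun setT g ->
  measurable_fun setT (fun x => f x + g x).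
Proof. exact: measurable_funD. Qed.

Lemma mfunN f : measurable_fun setT f -> measurable_fun setT (fun x => - f x).
Proof. by move=> mf; exact: measurableT_comp. Qed.

Lemma mfunX f n : measurable_fun setT f -> measurable_fun setT (fun x => f x ^+ n).
Proof. exact: measurable_funX. Qed.

Lemma mfun_norm f : measurable_fun setT f -> measurable_fun setT (fun x => `|f x|).
Proof. by move=> mf; exact: measurableT_comp. Qed.

Lemma mfun_continuous f (h : R -> R) : continuous h -> measurable_fun setT f ->
  measurable_fun setT (fun x => h (f x)).
Proof.
by move=> ch mf; apply: measurableT_comp => //; exact: continuous_measurable_fun.
Qed.

Lemma mfun_cos f : measurable_fun setT f -> measurable_fun setT (fun x => cos (f x)).
Proof. by apply: mfun_continuous; exact: continuous_cos. Qed.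

Lemma mfun_sin f : measurable_fun setT f -> measurable_fun setT (fun x => sin (f x)).
Proof. by apply: mfun_continuous; exact: continuous_sin. Qed.

Lemma mfun_expR f : measurable_fun setT f -> measurable_fun setT (fun x => expR (f x)).
Proof. by move=> mf; exact: measurableT_comp. Qed.

End measurable_funs.

(* [lebesgue_measure] lives on [measurableTypeR R], whose measurable structure
   has the same sets as, but a different display than, the canonical one on [R]. *)
Lemma mfunRL (R : realType) d (T : measurableType d) (f : T -> measurableTypeR R) :
  measurable_fun setT f -> @measurable_fun _ _ T R setT f.
Proof. by []. Qed.

Lemma mfun_ofRL (R : realType) d (T : measurableType d) (f : R -> T) :
  measurable_fun setT f -> @measurable_fun _ _ (measurableTypeR R) T setT f.
Proof. by []. Qed.

Section measurable_projections.
Context d1 d2 d3 (T1 : measurableType d1) (T2 : measurableType d2)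
  (T3 : measurableType d3).

Lemma mfun_fst (f : T1 -> T3) : measurable_fun setT f ->
  measurable_fun setT (fun z : T1 * T2 => f z.1).
Proof. by move=> mf; apply: measurableT_comp. Qed.

Lemma mfun_snd (f : T2 -> T3) : measurable_fun setT f ->
  measurable_fun setT (fun z : T1 * T2 => f z.2).
Proof. by move=> mf; apply: measurableT_comp. Qed.

End measurable_projections.

Ltac mfun := repeat first [assumption | exact: measurable_cst | exact: measurable_id
  | exact: measurable_fst | exact: measurable_snd | exact: (mfunRL measurable_id)
  | exact: (mfunRL measurable_fst) | exact: (mfunRL measurable_snd)
  | apply: mfunM | apply: mfunD | apply: mfunN | apply: mfunX | apply: mfun_norm
  | apply: mfun_cos | apply: mfun_sin | apply: mfun_expR ].

Lemma Rintegrable_leR (R : realType) (f b : R -> R) :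
  measurable_fun setT f -> Rintegrable (@lebesgue_measure R) b ->
  (forall x, `|f x| <= b x) -> Rintegrable (@lebesgue_measure R) f.
Proof. by move=> mf ib fb; apply: Rintegrable_le ib fb. Qed.

Lemma Rintegrable_measurableR (R : realType) (f : R -> R) :
  Rintegrable (@lebesgue_measure R) f -> measurable_fun setT f.
Proof. exact: Rintegrable_measurable. Qed.

Section finite_measure.
Context d (T : measurableType d) (R : realType).
Variable mu : {finite_measure set T -> \bar R}.

Lemma Rintegrable_cst (M : R) : Rintegrable mu (fun=> M).
Proof. exact: finite_measure_integrable_cst. Qed.

Lemma Rintegrable_bounded (f : T -> R) (M : R) : measurable_fun setT f ->
  (forall x, `|f x| <= M) -> Rintegrable mu f.
Proof. by move=> mf fM; apply: (Rintegrable_le mf (Rintegrable_cst M)). Qed.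

End finite_measure.

(** * Fubini's theorem for real-valued integrals *)

Section fubini.
Context d1 d2 (T1 : measurableType d1) (T2 : measurableType d2) (R : realType).
Variable m1 : {sigma_finite_measure set T1 -> \bar R}.
Variable m2 : {sigma_finite_measure set T2 -> \bar R}.
Implicit Types f : T1 * T2 -> R.

Lemma measurable_pair1r d3 (T3 : measurableType d3) (f : T1 * T2 -> T3) x :
  measurable_fun setT f -> measurable_fun setT (fun y => f (x, y)).
Proof. by move=> mf; apply: measurableT_comp => //; exact: measurable_pair1. Qed.

Lemma measurable_pair2r d3 (T3 : measurableType d3) (f : T1 * T2 -> T3) y :
  measurable_fun setT f -> measurable_fun setT (fun x => f (x, y)).
Proof. by move=> mf; apply: measurableT_comp => //; exact: measurable_pair2. Qed.

(** Tonelli's measurability statement applies to the positive and to the negative part, and [fine]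
    of their difference is measurable whatever its value. *)
Lemma measurable_RintegralF f : measurable_fun setT f ->
  measurable_fun setT (fun x => \int[m2]_y f (x, y)).
Proof.
move=> mf; apply: measurableT_comp; first exact: fine_measurable.
have mEf : measurable_fun setT (EFin \o f) by exact/measurable_EFinP.
rewrite (_ : (fun _ => _) = ((fun x => \int[m2]_y (EFin \o f)^\+ (x, y)) \-
   (fun x => \int[m2]_y (EFin \o f)^\- (x, y)))%E); last first.
  apply/funext => x; rewrite [LHS]integralE.
  by congr (_ - _)%E; apply: eq_integral => y _; rewrite unlock.
apply: emeasurable_funB.
  by apply: measurable_fun_fubini_tonelli_F => //; exact: measurable_funepos.
by apply: measurable_fun_fubini_tonelli_F => //; exact: measurable_funeneg.
Qed.

(** Source of joint integrability for the Fubini steps below: the inner integrals of [|f|] are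
    compared with an integrable majorant [b], so no inner integral has to be computed. *)
Lemma Rintegrable_prodP f (b : T1 -> R) : measurable_fun setT f ->
  (forall x, Rintegrable m2 (fun y => f (x, y))) ->
  (forall x, \int[m2]_y `|f (x, y)| <= b x) -> Rintegrable m1 b ->
  Rintegrable (m1 \x m2)%E f.
Proof.
move=> mf f2 fb bi; apply/integrable12ltyP; first exact/measurable_EFinP.
have := integrable_lty measurableT bi; apply: le_lt_trans.
apply: ge0_le_integral => //.
- by move=> x _; apply: integral_ge0.
- apply: (measurable_fun_fubini_tonelli_F (fun z => `|(f z)%:E|%E)) => //.
  by apply: measurableT_comp => //; exact/measurable_EFinP.
- by apply/measurable_EFinP; exact: Rintegrable_measurable bi.
move=> x _ /=; rewrite -(EFin_Rintegral (Rintegrable_norm (f2 x))).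
by rewrite lee_fin.
Qed.

Lemma Rintegral_Fubini f : Rintegrable (m1 \x m2)%E f ->
  (forall x, Rintegrable m2 (fun y => f (x, y))) ->
  (forall y, Rintegrable m1 (fun x => f (x, y))) ->
  \int[m1]_x \int[m2]_y f (x, y) = \int[m2]_y \int[m1]_x f (x, y).
Proof.
move=> fi f2 f1; rewrite /Rintegral; congr fine.
transitivity (\int[m1]_x \int[m2]_y (f (x, y))%:E)%E.
  by apply: eq_integral => x _; rewrite -(EFin_Rintegral (f2 x)).
rewrite (Fubini fi); apply: eq_integral => y _.
by rewrite -[RHS]/((\int[m1]_x f (x, y))%:E) (EFin_Rintegral (f1 y)).
Qed.

Lemma Rintegral_prod f : Rintegrable (m1 \x m2)%E f ->
  (forall x, Rintegrable m2 (fun y => f (x, y))) ->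
  \int[(m1 \x m2)%E]_z f z = \int[m1]_x \int[m2]_y f (x, y).
Proof.
move=> fi f2; rewrite {1}/Rintegral -(integral12_prod_meas1 fi) /Rintegral.
by congr fine; apply: eq_integral => x _;
  rewrite -[RHS]/((\int[m2]_y f (x, y))%:E) (EFin_Rintegral (f2 x)).
Qed.

Lemma Rintegrable_fubiniF f : Rintegrable (m1 \x m2)%E f ->
  (forall x, Rintegrable m2 (fun y => f (x, y))) ->
  Rintegrable m1 (fun x => \int[m2]_y f (x, y)).
Proof.
move=> fi f2; have := integrable_fubini_F fi; apply: eq_integrable => // x _.
by rewrite /= EFin_Rintegral.
Qed.

End fubini.

(** * Gaussian integrals *)

Section affine_substitution.
Context (R : realType).
Notation lambda := (@lebesgue_measure R).
Implicit Types a b : R.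

Lemma measurable_affine a b :
  measurable_fun setT (fun x : measurableTypeR R => a * x + b : measurableTypeR R).
Proof.
by apply: measurable_funD => //; apply: measurable_funM => //;
  exact: measurable_id.
Qed.

(** By uniqueness of the Lebesgue measure it is enough to compare both sides on half-open intervals,
    whose preimages are intervals with length divided by [a]. *)
Lemma lebesgue_measure_affine a b (A : set R) : 0 < a -> measurable A ->
  lambda A = (a%:E * pushforward lambda
    (fun x : measurableTypeR R => (a * x + b)%R : measurableTypeR R) A)%E.
Proof.
move=> a0 mA; have a0' := ltW a0.
pose nu := [the {measure set _ -> \bar R} of
  pushforward lambda (fun x : measurableTypeR R => (a * x + b)%R : measurableTypeR R)].
have := @lebesgue_measure_unique R (mscale (NngNum a0') (nu (measurable_affine a b))).
move=> -> //= _ [[c e]] _ <- /=.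
rewrite /mscale /= /pushforward (_ : _ @^-1` _ = `](c - b) / a, (e - b) / a]%classic).
  rewrite !lebesgue_measure_itv/= !lte_fin ltr_pM2r ?invr_gt0// ltrD2r.
  case: ifPn => ce; last by rewrite mule0.
  rewrite -!EFinB -EFinM; congr EFin; rewrite -mulrBl mulrC divfK ?gt_eqF//.
  by ring.
apply/seteqP; split => x /=; rewrite !in_itv/= => /andP[cx xe]; apply/andP; split.
- by rewrite ltr_pdivrMr// ltrBlDr mulrC.
- by rewrite ler_pdivlMr// lerBrDr mulrC.
- by move: cx; rewrite ltr_pdivrMr// ltrBlDr mulrC.
- by move: xe; rewrite ler_pdivlMr// lerBrDr mulrC.
Qed.

Lemma ge0_integral_affine a b (f : R -> \bar R) : 0 < a ->
  measurable_fun setT f -> (forall x, 0 <= f x)%E ->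
  (\int[lambda]_x f (a * x + b)%R = a^-1%:E * \int[lambda]_x f x)%E.
Proof.
move=> a0 mf f0; have a0' := ltW a0.
have -> : (\int[lambda]_x f x = a%:E * \int[lambda]_x f (a * x + b)%R)%E; last first.
  by rewrite muleA -EFinM mulVf ?gt_eqF// mul1e.
pose nu := [the {measure set _ -> \bar R} of
  pushforward lambda (fun x : measurableTypeR R => (a * x + b)%R : measurableTypeR R)].
transitivity (\int[mscale (NngNum a0') (nu (measurable_affine a b))]_x f x)%E.
  apply: eq_measure_integral => A mA _.
  by rewrite /mscale /=; exact: lebesgue_measure_affine.
rewrite ge0_integral_mscale//=; congr *%E.
by rewrite (ge0_integral_pushforward (measurable_affine a b)).
Qed.

Lemma ge0_integral_opp (f : R -> \bar R) :
  measurable_fun setT f -> (forall x, 0 <= f x)%E ->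
  (\int[lambda]_x f (- x)%R = \int[lambda]_x f x)%E.
Proof.
move=> mf f0.
pose phi (x : measurableTypeR R) : measurableTypeR R := - x.
have mphi : measurable_fun setT phi by exact: oppr_measurable.
rewrite -[RHS](@eq_measure_integral _ _ _ _ _ (pushforward lambda phi)).
  by rewrite ge0_integral_pushforward.
by move=> A mA _; exact: lebesgue_measureN.
Qed.

(** Passes from nonnegative extended-valued integrands to integrable real ones by splitting into
    positive and negative parts. It serves both the affine maps and the reflection. *)
Let Rintegral_subst (phi : R -> R) c :
  measurable_fun setT phi -> 0 < c ->
  (forall f : R -> \bar R, measurable_fun setT f -> (forall x, 0 <= f x)%E ->
    (\int[lambda]_x f (phi x) = c%:E * \int[lambda]_x f x)%E) ->
  forall f, Rintegrable lambda f ->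
  Rintegrable lambda (fun x => f (phi x)) /\
  \int[lambda]_x f (phi x) = c * \int[lambda]_x f x.
Proof.
move=> mphi c0 H.
have H0 f : Rintegrable lambda f ->
    Rintegrable lambda (fun x => f (phi x)).
  move=> fi; have mf := Rintegrable_measurable fi.
  apply/integrableP; split; first exact/measurable_EFinP/measurableT_comp.
  rewrite (H (fun x => `|(f x)%:E|%E))//; last first.
    by apply: measurableT_comp => //; exact/measurable_EFinP.
  by apply: lte_mul_pinfty => //; [rewrite lee_fin ltW
    |case/integrableP : fi].
have Hp f : Rintegrable lambda f -> (forall x, 0 <= f x) ->
    \int[lambda]_x f (phi x) = c * \int[lambda]_x f x.
  move=> fi f0; have mf := Rintegrable_measurable fi.
  apply: EFin_inj; rewrite EFinM !EFin_Rintegral//; last exact: H0.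
  apply: (H (EFin \o f)); first exact/measurable_EFinP.
  by move=> x; rewrite lee_fin.
move=> f fi; split; first exact: H0.
have mf := Rintegrable_measurable fi.
pose p x := Num.max (f x) 0; pose q x := Num.max (- f x) 0.
have ip : Rintegrable lambda p.
  apply: Rintegrable_le (Rintegrable_norm fi) _; first exact: measurable_maxr.
  by move=> x; rewrite /p; case: (leP (f x) 0) => h; rewrite ?normr0.
have iq : Rintegrable lambda q.
  apply: Rintegrable_le (Rintegrable_norm fi) _.
    by apply: measurable_maxr => //; exact: measurableT_comp.
  by move=> x; rewrite /q; case: (leP (- f x) 0) => h; rewrite ?normr0// normrN.
have E x : f x = p x - q x.
  by rewrite /p /q; case: (leP (f x) 0); case: (leP (- f x) 0); lra.
rewrite (_ : f = fun x => p x - q x); last exact/funext.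
rewrite !RintegralBT//; try exact: H0.
rewrite !Hp//; first by rewrite mulrBr.
all: by move=> x; rewrite /p /q le_max lexx orbT.
Qed.

Lemma Rintegral_affine a b (f : R -> R) : 0 < a -> Rintegrable lambda f ->
  Rintegrable lambda (fun x => f (a * x + b)) /\
  \int[lambda]_x f (a * x + b) = a^-1 * \int[lambda]_x f x.
Proof.
move=> a0 fi; apply: (@Rintegral_subst (fun x => a * x + b)) => //.
- exact: measurable_affine.
- by rewrite invr_gt0.
- by move=> g mg g0; exact: ge0_integral_affine.
Qed.

Lemma Rintegral_opp (f : R -> R) : Rintegrable lambda f ->
  Rintegrable lambda (fun x => f (- x)) /\
  \int[lambda]_x f (- x) = \int[lambda]_x f x.
Proof.
move=> fi; rewrite -[X in _ = X]mul1r.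
apply: (@Rintegral_subst (fun x => - x)) => //; first exact: oppr_measurable.
by move=> g mg g0; rewrite mul1e; exact: ge0_integral_opp.
Qed.

End affine_substitution.

Section heat_kernel_basics.
Context (R : realType).
Notation lambda := (@lebesgue_measure R).
Implicit Types e x y : R.

Lemma heat_kernelE e x :
  heat_kernel e x = (Num.sqrt (2 * pi * e))^-1 * expR (- (x ^+ 2 / (2 * e))).
Proof. by rewrite /heat_kernel real_normK// num_real. Qed.

Lemma heat_kernel_normal e : 0 < e -> heat_kernel e = normal_pdf 0 (Num.sqrt e).
Proof.
move=> e0; apply/funext => x.
rewrite normal_pdfE ?gt_eqF ?sqrtr_gt0// /normal_peak /normal_fun.
rewrite heat_kernelE sqr_sqrtr ?ltW// subr0 mulNr -(mulr_natl e 2).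
by rewrite (_ : e * pi *+ 2 = 2 * pi * e)//; ring.
Qed.

Lemma heat_kernel_ge0 e x : 0 <= heat_kernel e x.
Proof. by rewrite mulr_ge0 ?expR_ge0// invr_ge0. Qed.

Lemma heat_kernel_le e x : 0 < e ->
  heat_kernel e x <= (Num.sqrt (2 * pi * e))^-1.
Proof.
move=> e0; rewrite heat_kernelE ler_piMr ?invr_ge0//.
by rewrite -expR0 ler_expR lerNl oppr0 divr_ge0 ?sqr_ge0// mulr_ge0// ltW.
Qed.

Lemma heat_kernelN e x : heat_kernel e (- x) = heat_kernel e x.
Proof. by rewrite !heat_kernelE sqrrN. Qed.

Lemma measurable_heat_kernel e : measurable_fun setT (@heat_kernel R e).
Proof.
apply: measurable_funM => //; apply: measurableT_comp => //.
apply: measurableT_comp => //; apply: measurable_funM => //.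
by apply: measurable_funX => //; exact: measurableT_comp.
Qed.

Lemma Rintegrable_heat_kernel e : 0 < e -> Rintegrable lambda (heat_kernel e).
Proof.
by move=> e0; rewrite heat_kernel_normal//; exact: integrable_normal_pdf.
Qed.

Lemma Rintegral_heat_kernel e : 0 < e -> \int[lambda]_x heat_kernel e x = 1.
Proof.
by move=> e0; rewrite heat_kernel_normal// /Rintegral integral_normal_pdf.
Qed.

Lemma heat_kernel_scale e x : 0 < e ->
  heat_kernel e (Num.sqrt e * x) = (Num.sqrt e)^-1 * heat_kernel 1 x.
Proof.
move=> e0; rewrite !heat_kernelE mulrA; congr (_ * expR (- _)).
  rewrite (sqrtrM e) ?mulr_ge0 ?pi_ge0// mulr1 invfM mulrC.
  by [].
rewrite exprMn sqr_sqrtr ?ltW// mulr1; field.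
by rewrite gt_eqF.
Qed.

Lemma expR_sqrE e x : 0 < e -> expR (- (e * x ^+ 2 / 2)) =
  Num.sqrt (2 * pi * e^-1) * heat_kernel e^-1 x.
Proof.
move=> e0; rewrite heat_kernelE mulVKf; last first.
  by rewrite gt_eqF// sqrtr_gt0 !mulr_gt0 ?pi_gt0 ?invr_gt0.
by congr (expR (- _)); field; rewrite gt_eqF.
Qed.

Lemma Rintegrable_expR_sqr e : 0 < e ->
  Rintegrable lambda (fun x => expR (- (e * x ^+ 2 / 2))).
Proof.
move=> e0; under eq_fun do rewrite expR_sqrE//.
by apply: RintegrableM; apply: Rintegrable_heat_kernel; rewrite invr_gt0.
Qed.

End heat_kernel_basics.

Section gaussian_fourier.
Context (R : realType).
Notation lambda := (@lebesgue_measure R).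
Implicit Types y z x e xi : R.

Let gam z : R := expR (- (z ^+ 2 / 2)).

Let gamE z : gam z = expR (- (1 * z ^+ 2 / 2)). Proof. by rewrite mul1r. Qed.

Let igam : Rintegrable lambda gam.
Proof. rewrite (_ : gam = fun z => expR (- (1 * z ^+ 2 / 2))); last exact/funext.
exact: Rintegrable_expR_sqr. Qed.

Let gam0 z : 0 <= gam z. Proof. exact: expR_ge0. Qed.

Let dom z : R := expR (- (2^-1 * z ^+ 2 / 2)).

Let idom : Rintegrable lambda dom.
Proof. by apply: Rintegrable_expR_sqr; rewrite invr_gt0. Qed.

(** Since [gam] is the square of [dom], half of the Gaussian decay can absorb the factor [|z|]:
    [|z| <= 1 + z^2 / 4 <= expR (z^2 / 4)]. This yields the majorant for differentiating under the
    integral sign. *)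
Let gam_dom z : `|z| * gam z <= dom z.
Proof.
have -> : gam z = dom z * dom z.
  by rewrite -expRD; congr expR; field.
rewrite mulrA ler_piMl ?expR_ge0// /dom expRN ler_pdivrMr ?expR_gt0// mul1r.
apply: le_trans (expR_ge1Dx _).
have := sqr_ge0 (`|z| - 2); rewrite -[z ^+ 2]real_normK ?num_real//; nra.
Qed.

Let cosb z y : `|cos (z * y)| <= 1.
Proof. by rewrite ler_norml cos_geN1 cos_le1. Qed.

Let sinb z y : `|sin (z * y)| <= 1.
Proof. by rewrite ler_norml sin_geN1 sin_le1. Qed.

Let icos y : Rintegrable lambda (fun z => gam z * cos (z * y)).
Proof.
apply: Rintegrable_leR igam _; first by mfun.
by move=> z; rewrite normrM ger0_norm// ler_piMr.
Qed.

Let isin y : Rintegrable lambda (fun z => z * gam z * sin (z * y)).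
Proof.
apply: Rintegrable_leR idom _; first by mfun.
move=> z; rewrite !normrM (ger0_norm (gam0 z)); apply: le_trans (gam_dom z).
by rewrite ler_piMr// mulr_ge0.
Qed.

(** Evaluated through the differential equation [J' = - y J], obtained by differentiating under the
    integral sign and integrating by parts; then [J y * expR (y^2 / 2)] is constant. *)
Let J y := \int[lambda]_z (gam z * cos (z * y)).

Let d1f y z : partial1of2 (fun y z => gam z * cos (z * y)) y z =
  - (z * gam z * sin (z * y)).
Proof.
rewrite /partial1of2 derive1E.
suff H : is_derive y 1 (fun x : R => gam z * cos (z * x)) (- (z * gam z * sin (z * y))).
  exact: derive_val.
by apply: is_derive_eq; rewrite /GRing.scale/=; ring.
Qed.

Let dJ y : is_derive y 1 J (- \int[lambda]_z (z * gam z * sin (z * y))).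
Proof.
have Iy : `]y - 1, y + 1[%classic y.
  by rewrite /= in_itv/= ltrBlDr ltrDl ltr01.
have int1 x : `]y - 1, y + 1[%classic x ->
    lambda.-integrable setT (EFin \o (fun z => gam z * cos (z * x))).
  by move=> _; exact: icos.
have der x z : `]y - 1, y + 1[%classic x -> [set: R] z ->
    derivable (fun x => gam z * cos (z * x)) x 1.
  by move=> _ _; apply: ex_derive.
have ub x z : `]y - 1, y + 1[%classic x -> [set: R] z ->
    `|partial1of2 (fun y z => gam z * cos (z * y)) x z| <= dom z.
  move=> _ _; rewrite d1f normrN !normrM (ger0_norm (gam0 z)).
  apply: le_trans (gam_dom z).
  by rewrite ler_piMr// mulr_ge0.
have d0 z : 0 <= dom z by exact: expR_ge0.
apply: DeriveDef.
  exact: (derivable_under_integral measurableT Iy int1 der d0 idom ub).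
rewrite -derive1E (differentiation_under_integral measurableT Iy int1 der d0 idom ub).
under eq_Rintegral do rewrite d1f -mulN1r.
by rewrite RintegralM// mulN1r.
Qed.

(** The difference [h] of the two integrands is the derivative of [G z = gam z * sin (z * y)], which
    vanishes at infinity. The fundamental theorem on growing intervals and dominated convergence
    give integral 0. *)
Let gauss_by_parts y : \int[lambda]_z (z * gam z * sin (z * y)) = y * J y.
Proof.
pose h z := y * (gam z * cos (z * y)) - z * gam z * sin (z * y).
have ih : Rintegrable lambda h.
  by apply: RintegrableB => //; exact: RintegrableM.
suff : \int[lambda]_z h z = 0.
  rewrite RintegralBT//; last exact: RintegrableM.
  by rewrite RintegralM// => /subr0_eq <-.
pose G z := gam z * sin (z * y).
have dG z : is_derive z 1 G (h z).
  apply: is_derive_eq; rewrite /h /gam /GRing.scale/=.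
  by field.
have cG : continuous G.
  by move=> z; apply: differentiable_continuous; apply/derivable1_diffP; exact: ex_derive.
have ch : continuous h.
  have cg z : {for z, continuous gam}.
    by apply: differentiable_continuous; apply/derivable1_diffP; exact: ex_derive.
  move=> z; apply: cvgB; last first.
    apply: cvgM; first by apply: cvgM => //; exact: cg.
    by apply: continuous_comp; [apply: cvgM => //; exact: cvg_cst|exact: continuous_sin].
  apply: cvgM; first exact: cvg_cst.
  apply: cvgM; first exact: cg.
  by apply: continuous_comp; [apply: cvgM => //; exact: cvg_cst|exact: continuous_cos].
have FTC (n : nat) : \int[lambda]_(z in `[- n.+1%:R, n.+1%:R]) h z =
    G n.+1%:R - G (- n.+1%:R).
  rewrite /Rintegral (@continuous_FTC2 _ h G) ?EFinB//.
  - by rewrite gtrN.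
  - exact: continuous_subspaceT.
  - split => [x _||]; [exact: ex_derive|exact: cvg_at_right_filter (cG _)
      |exact: cvg_at_left_filter (cG _)].
  - by move=> x _; rewrite derive1E; exact: derive_val.
have [|||||_ lim1] := @Rintegral_dominated _ _ _ lambda
  (fun n => h \_ `[- n.+1%:R, n.+1%:R]) h (fun z => `|h z|).
- move=> n; apply/(measurable_restrictT _ _).1 => //.
  apply: measurable_funTS; exact: Rintegrable_measurableR ih.
- exact: Rintegrable_measurable ih.
- apply: aeW => z; apply: cvg_near_cst.
  exists (Num.trunc `|z|).+1 => // n /= zn.
  rewrite patchE ifT// inE /= in_itv/= -ler_norml.
  have /andP[_ /ltW /le_trans] := Num.Theory.truncn_itv (normr_ge0 z); apply.
  by rewrite ler_nat (leq_trans zn).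
- exact: Rintegrable_norm.
- by move=> n z; rewrite patchE; case: ifP => _; rewrite ?normr0.
have Gle (n : nat) : `|G n.+1%:R - G (- n.+1%:R)| <= 4 * n.+1%:R^-1.
  have E a : `|G a| <= gam a by rewrite normrM ger0_norm// ler_piMr.
  (* From [expR (m^2 / 2) >= 1 + m^2 / 2 >= m / 2]; any rate of decay would do. *)
  have ge : gam n.+1%:R <= 2 * n.+1%:R^-1.
    rewrite /gam expRN -[leRHS]invrK lef_pV2 ?posrE ?invr_gt0 ?mulr_gt0 ?invr_gt0 ?expR_gt0//.
    rewrite invfM invrK; apply: le_trans (expR_ge1Dx _).
    move: (n.+1%:R : R) => m; have := sqr_ge0 (m - 2^-1); nra.
  rewrite (le_trans (ler_normB _ _))//.
  have := E n.+1%:R; have := E (- n.+1%:R); rewrite [gam (- _)]/gam sqrrN -/(gam _).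
  move=> E1 E2; rewrite (_ : 4 = 2 + 2 :> R); last by ring.
  by rewrite mulrDl lerD// (le_trans _ ge).
have lim2 : (G n.+1%:R - G (- n.+1%:R)) @[n --> \oo] --> 0.
  apply/norm_cvg0P; apply: (@squeeze_cvgr _ _ _ _ (cst 0) (fun n => 4 * n.+1%:R^-1)).
  - by apply: nearW => n; rewrite normr_ge0 Gle.
  - exact: cvg_cst.
  - rewrite -[X in _ --> X](mulr0 4); apply: cvgM; first exact: cvg_cst.
    exact: cvg_harmonic.
apply: (@cvg_unique _ _ (fmap (fun n => G n.+1%:R - G (- n.+1%:R)) \oo)) => //.
apply: cvg_trans lim1; apply: near_eq_cvg; apply: nearW => n.
by rewrite -Rintegral_mkcond FTC.
Qed.

Lemma gauss_fourier y :
  \int[lambda]_z (expR (- (z ^+ 2 / 2)) * cos (z * y)) =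
  Num.sqrt (2 * pi) * expR (- (y ^+ 2 / 2)).
Proof.
have dK x : is_derive x 1 (fun x : R => J x * expR (x ^+ 2 / 2)) 0.
  have de : is_derive x 1 (fun x : R => expR (x ^+ 2 / 2)) (x * expR (x ^+ 2 / 2)).
    have dq : is_derive x 1 (fun x : R => x ^+ 2 / 2) x.
      by apply: is_derive_eq; rewrite /GRing.scale/= /GRing.scale/=; field.
    by apply: is_derive_eq; rewrite /GRing.scale/= mulrC.
  have dJx := dJ x.
  by apply: is_derive_eq; rewrite gauss_by_parts /GRing.scale/=; ring.
have J0 : J 0 = Num.sqrt (2 * pi).
  rewrite /J; under eq_Rintegral do rewrite mulr0 cos0 mulr1 gamE expR_sqrE//.
  rewrite invr1 RintegralM ?Rintegral_heat_kernel ?mulr1//.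
  exact: Rintegrable_heat_kernel.
have := is_derive_0_is_cst y 0 dK.
rewrite expr0n/= mul0r expR0 mulr1 J0 => E.
rewrite -[LHS]/(J y) -E -mulrA -expRD subrr expR0 mulr1.
by [].
Qed.

(** Writes the mollified delta function as a superposition of cosines, which is how the Fourier
    transform of the occupation measure comes in. The case [e = 1] is rescaled by [Num.sqrt e] in
    the frequency. *)
Lemma heat_kernel_fourier e x : 0 < e ->
  \int[lambda]_xi (expR (- (e * xi ^+ 2 / 2)) * cos (xi * x)) =
  2 * pi * heat_kernel e x.
Proof.
move=> e0; have se0 : 0 < Num.sqrt e by rewrite sqrtr_gt0.
have := @Rintegral_affine R (Num.sqrt e) 0
  (fun z => gam z * cos (z * (x / Num.sqrt e))) se0 (icos _).
rewrite gauss_fourier => -[_ H].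
transitivity (\int[lambda]_xi (gam (Num.sqrt e * xi + 0) *
    cos ((Num.sqrt e * xi + 0) * (x / Num.sqrt e)))).
  apply: eq_Rintegral => xi _; rewrite addr0; congr (expR (- _) * cos _).
    by rewrite exprMn sqr_sqrtr// ltW.
  by field; rewrite gt_eqF.
rewrite H heat_kernelE expr_div_n sqr_sqrtr; last exact: ltW.
rewrite (sqrtrM e) ?mulr_ge0 ?pi_ge0//.
have -> : x ^+ 2 / e / 2 = x ^+ 2 / (2 * e) by field; rewrite gt_eqF.
have pi0 : 0 < 2 * pi :> R by rewrite mulr_gt0 ?pi_gt0.
rewrite -{2}(@sqr_sqrtr _ (2 * pi)); last exact: ltW.
have sp0 : Num.sqrt (2 * pi) != 0 :> R by rewrite gt_eqF// sqrtr_gt0.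
by field; rewrite sp0 gt_eqF.
Qed.

End gaussian_fourier.

(** * Layer cake and densities *)

Section layer_cake.
Context (R : realType).
Notation lambda := (@lebesgue_measure R).

(** The layer at height [r] under the value [w]. As a boolean test in both variables, its joint
    measurability reduces to that of comparisons. *)
Definition below (w r : R) : R := if (0 <= r) && (r < w) then 1 else 0.

Lemma below_ge0 w r : 0 <= below w r.
Proof. by rewrite /below; case: ifP. Qed.

Lemma below_le1 w r : below w r <= 1.
Proof. by rewrite /below; case: ifP. Qed.

Lemma measurable_below d (T : measurableType d) (f g : T -> R) :
  measurable_fun setT f -> measurable_fun setT g ->
  measurable_fun setT (fun x => below (f x) (g x)).
Proof.
move=> mf mg; apply: measurable_fun_ifT => //.
by apply: measurable_and; [exact: measurable_fun_ler|exact: measurable_fun_ltr].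
Qed.

Lemma belowE w : below w = \1_(`[0, w[%classic).
Proof.
apply/funext => r; rewrite /below indicE mem_setE in_itv/=.
by case: ifP.
Qed.

Lemma Rintegrable_below w : Rintegrable lambda (below w).
Proof.
by rewrite belowE; exact: integrable_indic_itv.
Qed.

Lemma Rintegral_below w : 0 <= w -> \int[lambda]_r below w r = w.
Proof.
move=> w0; rewrite belowE /Rintegral (integral_indic lambda)// setIT.
rewrite -[X in fine X]/(lambda `[0, w[%classic) lebesgue_measure_itv/=.
rewrite lte_fin; case: ltP => [_|w0']; first by rewrite oppr0 adde0.
by apply/eqP; rewrite eq_le w0 w0'.
Qed.

(** Writes [W] as a superposition of indicators of its superlevel sets, so that identities known on
    measurable sets extend to bounded functions. Used for densities and again for conditional
    expectations. *)
Lemma layer_cake d (T : measurableType d) (mu : {sigma_finite_measure set T -> \bar R})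
    (g W : T -> R) (M : R) : Rintegrable mu g -> measurable_fun setT W ->
  (forall x, 0 <= W x <= M) ->
  \int[mu]_x (g x * W x) = \int[lambda]_r \int[mu]_x (g x * below (W x) r).
Proof.
move=> ig mW W0M.
have mg := Rintegrable_measurable ig.
have mgb : measurable_fun setT
    (fun z : T * measurableTypeR R => g z.1 * below (W z.1) z.2).
  apply: mfunM; first exact: mfun_fst.
  by apply: measurable_below; [exact: mfun_fst|mfun].
have i2 x : Rintegrable lambda (fun r => g x * below (W x) r).
  by apply: RintegrableM; exact: Rintegrable_below.
have i1 r : Rintegrable mu (fun x => g x * below (W x) r).
  apply: Rintegrable_le (Rintegrable_norm ig) _.
    by apply: mfunM => //; exact: measurable_below.
  by move=> x; rewrite normrM ler_piMr// ger0_norm ?below_ge0 ?below_le1.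
transitivity (\int[mu]_x \int[lambda]_r (g x * below (W x) r)).
  apply: eq_Rintegral => x _; rewrite RintegralM; last exact: Rintegrable_below.
  by rewrite Rintegral_below//; case/andP: (W0M x).
apply: (Rintegral_Fubini (m1 := mu) (m2 := lambda)
  (f := fun z => g z.1 * below (W z.1) z.2)) => //.
apply: (@Rintegrable_prodP _ _ _ _ _ _ _ _ (fun x => M * `|g x|)) => //.
  move=> x /=; under eq_Rintegral do rewrite normrM (ger0_norm (below_ge0 _ _)).
  rewrite RintegralM; last exact: Rintegrable_below.
  by have /andP[W0 WM] := W0M x; rewrite Rintegral_below// mulrC ler_wpM2r.
by apply: RintegrableM; exact: Rintegrable_norm.
Qed.

End layer_cake.

Section density_measure.
Context d (T : measurableType d) (R : realType).
Variables (mu : {measure set T -> \bar R}) (l : T -> R).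
Hypotheses (ml : measurable_fun setT l) (l0 : forall x, 0 <= l x).

(** The two proofs are arguments so that the measure structure below can be attached to the term
    itself. *)
Definition density_measure of measurable_fun setT l & (forall x, 0 <= l x) :=
  fun A : set T => (\int[mu]_(x in A) (l x)%:E)%E.

Local Notation nu := (density_measure ml l0).

Let nu0 : nu set0 = 0%E. Proof. exact: integral_set0. Qed.

Let nu_ge0 A : (0 <= nu A)%E.
Proof. by apply: integral_ge0 => x _; rewrite lee_fin. Qed.

Let nu_sigma : semi_sigma_additive nu.
Proof.
move=> /= F mF tF mUF; rewrite /density_measure; apply: cvg_toP.
  apply: ereal_nondecreasing_is_cvgn => m n mn.
  apply: lee_sum_nneg_natr => // k _ _; apply: integral_ge0 => /= x _.
  by rewrite lee_fin.
rewrite ge0_integral_bigcup//.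
  by apply/measurable_EFinP; exact: measurable_funTS.
by move=> x _; rewrite lee_fin.
Qed.

HB.instance Definition _ := isMeasure.Build _ _ _ nu nu0 nu_ge0 nu_sigma.

End density_measure.

Section measure_density.
Context (R : realType).
Notation lambda := (@lebesgue_measure R).
Variables (nu : {finite_measure set (measurableTypeR R) -> \bar R}) (l : R -> R) (M : R).
Hypotheses (ml : measurable_fun setT l) (l0 : forall x, 0 <= l x)
  (lM : forall x, l x <= M).

(** Continuous trapezoids converging pointwise to the indicator of []a, b]]: the ascent starts at
    [a], the descent only at [b], which excludes [a] and includes [b]. All of them live on
    [[a, b + 1]], which provides a common majorant. *)
Let cutoff (a b : R) (k : nat) (x : R) : R :=
  Num.min 1 (Num.max 0 (k.+1%:R * (x - a))) *
  Num.min 1 (Num.max 0 (1 - k.+1%:R * (x - b))).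

Hypothesis nul : forall f : R -> R, continuous f -> (forall x, 0 <= f x <= 1) ->
  Rintegrable lambda f -> \int[nu]_x f x = \int[lambda]_x (f x * l x).

Let clamp_ge0 (x : R) : 0 <= Num.min 1 (Num.max 0 x).
Proof. by rewrite le_min ler01/= le_max lexx. Qed.

Let clamp_le1 (x : R) : Num.min 1 (Num.max 0 x) <= 1.
Proof. by rewrite ge_min lexx. Qed.

Let cutoff01 a b k x : 0 <= cutoff a b k x <= 1.
Proof.
rewrite /cutoff mulr_ge0//=; apply: (@le_trans _ _ (1 * 1)); last by rewrite mulr1.
exact: ler_pM.
Qed.

Let cutoff_continuous a b k : continuous (cutoff a b k).
Proof.
have cl : continuous (fun x : R => Num.min 1 (Num.max 0 x)).
  move=> x; apply: (@continuous_min R R^o (cst 1 : R^o -> R^o) (fun x : R => Num.max 0 x)).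
    exact: cvg_cst.
  by apply: (@continuous_max R R^o (cst 0 : R^o -> R^o) id) => //; exact: cvg_cst.
have aff c e x : {for x, continuous (fun x : R => c * (x - e))}.
  by apply: cvgM; [exact: cvg_cst|apply: cvgB => //; exact: cvg_cst].
move=> x; apply: cvgM.
  by apply: (@continuous_comp _ _ _ (fun x : R => k.+1%:R * (x - a))
    (fun x : R => Num.min 1 (Num.max 0 x))); [exact: aff|exact: cl].
apply: (@continuous_comp _ _ _ (fun x : R => 1 - k.+1%:R * (x - b))
    (fun x : R => Num.min 1 (Num.max 0 x))); last exact: cl.
by apply: cvgB; [exact: cvg_cst|exact: aff].
Qed.

Let cutoff_le a b k x : cutoff a b k x <= \1_(`[a, b + 1]%classic) x.
Proof.
rewrite indicE mem_setE in_itv/=.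
have := clamp_le1 (k.+1%:R * (x - a)); have := clamp_le1 (1 - k.+1%:R * (x - b)).
have /andP[c0 c1] := cutoff01 a b k x.
case: (leP a x) => ax /=.
  case: (leP x (b + 1)) => xb //= _ _.
  rewrite /cutoff (_ : Num.max 0 (1 - _) = 0) ?(min_idPr ler01) ?mulr0//.
  apply/max_idPl; rewrite subr_le0.
  rewrite -[leLHS]mulr1; apply: ler_pM => //; first by rewrite ler1n.
  by rewrite lerBrDl ltW.
move=> _ _; rewrite /cutoff (_ : Num.max 0 (_ * (x - a)) = 0).
  by rewrite (min_idPr ler01) mul0r.
by apply/max_idPl; rewrite pmulr_rle0// subr_le0 ltW.
Qed.

Let cutoff_cvg a b x : a < b ->
  cutoff a b k x @[k --> \oo] --> (\1_(`]a, b]%classic) x : R).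
Proof.
move=> ab; rewrite indicE mem_setE in_itv/=.
have big (c : R) : 0 < c -> \forall k \near \oo, 1 <= k.+1%:R * c.
  move=> c0; exists (Num.trunc c^-1) => // k /= kc.
  rewrite -ler_pdivrMr// mul1r.
  have ci0 : 0 <= c^-1 by rewrite invr_ge0 ltW.
  have /andP[_ /ltW /le_trans] := Num.Theory.truncn_itv ci0; apply.
  by rewrite ler_nat ltnS.
have [ax|xa] := ltP a x; last first.
  apply: cvg_near_cst; apply: nearW => k; rewrite /cutoff.
  rewrite (_ : Num.max 0 (_ * (x - a)) = 0) ?(min_idPr ler01) ?mul0r//.
  by apply/max_idPl; rewrite pmulr_rle0// subr_le0.
have [xb|bx] /= := leP x b; last first.
  apply: cvg_near_cst.
  have := big (x - b); rewrite subr_gt0 => /(_ bx); apply: filterS => k kb.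
  rewrite /cutoff (_ : Num.max 0 (1 - _) = 0) ?(min_idPr ler01) ?mulr0//.
  by apply/max_idPl; rewrite subr_le0.
apply: cvg_near_cst.
have := big (x - a); rewrite subr_gt0 => /(_ ax); apply: filterS => k ka.
rewrite /cutoff (max_idPr _); last by rewrite (le_trans ler01).
rewrite (min_idPl ka) mul1r.
have h : 1 <= 1 - k.+1%:R * (x - b).
  by rewrite lerBrDl gerDr pmulr_rle0// subr_le0.
by rewrite (max_idPr _) ?(min_idPl h)//; rewrite (le_trans ler01).
Qed.

Let nu_itv a b : a < b ->
  nu `]a, b]%classic = (\int[lambda]_(x in `]a, b]) (l x)%:E)%E.
Proof.
move=> ab.
have mc k : measurable_fun setT (cutoff a b k).
  apply: continuous_measurable_fun; exact: cutoff_continuous.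
have i1 : Rintegrable lambda (\1_(`[a, b + 1]%classic) : R -> R).
  exact: integrable_indic_itv.
have ic k : Rintegrable lambda (cutoff a b k).
  apply: Rintegrable_leR i1 _ => // x.
  by rewrite ger0_norm//; case/andP: (cutoff01 a b k x).
have [|||||_ c1] := @Rintegral_dominated _ _ _ nu (cutoff a b)
  (\1_(`]a, b]%classic)) (fun=> 1).
- by move=> k; exact: mc.
- exact: measurable_indic.
- by apply: aeW => x; exact: cutoff_cvg.
- exact: Rintegrable_cst.
- by move=> k x; rewrite ger0_norm; case/andP: (cutoff01 a b k x).
have [|||||i2 c2] := @Rintegral_dominated _ _ _ lambda (fun k x => cutoff a b k x * l x)
  (fun x => \1_(`]a, b]%classic) x * l x) (fun x => M * \1_(`[a, b + 1]%classic) x).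
- by move=> k; apply: mfunM => //; exact: mc.
- by apply: mfunM => //; exact: measurable_indic.
- by apply: aeW => x; apply: cvgM; [exact: cutoff_cvg|exact: cvg_cst].
- exact: RintegrableM.
- move=> k x; have /andP[c0 _] := cutoff01 a b k x.
  by rewrite normrM (ger0_norm c0) (ger0_norm (l0 x)) mulrC ler_pM.
have E : \int[nu]_x \1_(`]a, b]%classic) x =
    \int[lambda]_x (\1_(`]a, b]%classic) x * l x).
  apply: (@cvg_unique _ _ (fmap (fun k => \int[nu]_x cutoff a b k x) \oo)) => //.
  rewrite (_ : (fun k => _) = (fun k => \int[lambda]_x (cutoff a b k x * l x)))//.
  by apply/funext => k; apply: nul => //; exact: cutoff_continuous.
have : (\int[nu]_x \1_(`]a, b]%classic) x)%:E =
    (\int[lambda]_x (\1_(`]a, b]%classic) x * l x))%:E by rewrite E.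
rewrite EFin_Rintegral; last first.
  by apply: integrable_indic; exact: measurable_itv.
rewrite integral_indic// setIT => ->; rewrite EFin_Rintegral// [RHS]integral_mkcond.
by apply: eq_integral => x _; rewrite epatch_indic muleC.
Qed.

(** The hypothesis on continuous test functions gives equality on half-open intervals, which
    generate the Borel sets and are stable under intersection. Equality of the measures follows, and
    the layer cake formula passes from sets to functions. *)
Lemma Rintegral_density (f : R -> R) : measurable_fun setT f ->
  (forall x, 0 <= f x <= 1) -> Rintegrable lambda f ->
  \int[nu]_x f x = \int[lambda]_x (f x * l x).
Proof.
move=> mf f01 fi.
have nuE (A : set R) : measurable A -> nu A = density_measure lambda ml l0 A.
  move=> mA.
  apply: (@measure_unique _ R (measurableTypeR R) (@ocitv R)
    (fun k : nat => `]- k%:R, k%:R]%classic)) => //.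
  - exact: ocitvI.
  - by move=> i; exact: is_ocitv.
  - by rewrite bigcup_itvT.
  - move=> _ /ocitvP[->|[[a b] /= ab ->]]; first by rewrite !measure0.
    exact: nu_itv.
  - by move=> k; rewrite ltey_eq fin_num_measure.
have ifl : Rintegrable lambda (fun x => f x * l x).
  apply: Rintegrable_leR (RintegrableM M fi) _; first by mfun.
  move=> x; have /andP[f0 _] := f01 x.
  by rewrite normrM !ger0_norm// mulrC ler_wpM2r.
have il : Rintegrable lambda l.
  apply/integrableP; split; first by apply/measurable_EFinP; exact: mfun_ofRL.
  under eq_integral do rewrite /= ger0_norm//.
  by rewrite -[X in (X < _)%E]/(density_measure lambda ml l0 setT) -nuE// ltey_eq
     fin_num_measure.
have asboolb (c : R -> bool) (x : R) : (x \in [set x | c x]) = c x.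
  by apply/idP/idP; rewrite inE.
have indE r x : below (f x) r = \1_[set x | (0 <= r) && (r < f x)] x.
  by rewrite indicE /below asboolb; case: ifP.
have mA r : measurable [set x | (0 <= r) && (r < f x)].
  rewrite -[X in measurable X]setTI; have := measurable_below mf (@measurable_cst _ _ R R setT r).
  move=> /(_ measurableT [set 1] (measurable_set1 1)); congr (measurable (_ `&` _)).
  apply/seteqP; split => x; rewrite /below /=; case: ifP => //.
  by move=> _ /eqP; rewrite eq_sym oner_eq0.
transitivity (\int[nu]_x (1 * f x)); first by under [RHS]eq_Rintegral do rewrite mul1r.
rewrite (@layer_cake _ _ _ nu (fun=> 1) f 1)//; last exact: Rintegrable_cst.
transitivity (\int[lambda]_x (l x * f x)); last by under eq_Rintegral do rewrite mulrC.
rewrite (@layer_cake _ _ _ lambda l f 1)//.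
apply: eq_Rintegral => r _.
under eq_Rintegral do rewrite mul1r indE.
rewrite {1}/Rintegral integral_indic//; last exact: mA.
transitivity (fine (density_measure lambda ml l0 [set x | (0 <= r) && (r < f x)])).
  by rewrite setIT; congr fine; exact: nuE (mA r).
rewrite /Rintegral /density_measure integral_mkcond; congr fine.
by apply: eq_integral => x _; rewrite epatch_indic /= indE EFinM.
Qed.

End measure_density.

(** * Fourier inversion of occupation measures *)

Section mollification.
Context (R : realType).
Notation lambda := (@lebesgue_measure R).

Lemma Rintegrable_boundedM (f g : R -> R) (B : R) : measurable_fun setT f ->
  (forall x, `|f x| <= B) -> Rintegrable lambda g ->
  Rintegrable lambda (fun x => f x * g x).
Proof.
move=> mf fB ig; have mg := Rintegrable_measurableR ig.
apply: Rintegrable_leR (RintegrableM B (Rintegrable_norm ig)) _; first by mfun.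
by move=> x; rewrite normrM ler_wpM2r.
Qed.

Lemma Rintegrable_heat_kernelB e x : 0 < e ->
  Rintegrable lambda (fun y => heat_kernel e (x - y)).
Proof.
move=> e0; have [+ _] := Rintegral_affine (- x) ltr01 (Rintegrable_heat_kernel e0).
apply: eq_integrable => // y _ /=.
by rewrite mul1r -heat_kernelN opprB.
Qed.

(** The substitution [y = x - sqrt e * z] moves [e] from the kernel into the argument of [f]; the
    remaining kernel is fixed and dominates as [e] tends to 0. *)
Lemma mollify_subst (f : R -> R) B e x : measurable_fun setT f ->
  (forall x, `|f x| <= B) -> 0 < e ->
  \int[lambda]_y (f y * heat_kernel e (x - y)) =
  \int[lambda]_z (f (x - Num.sqrt e * z) * heat_kernel 1 z).
Proof.
move=> mf fB e0; have s0 : 0 < Num.sqrt e by rewrite sqrtr_gt0.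
have iF : Rintegrable lambda (fun y => f y * heat_kernel e (x - y)).
  by apply: Rintegrable_boundedM fB _ => //; exact: Rintegrable_heat_kernelB.
have [iG EG] := Rintegral_opp iF.
have [_ H] := Rintegral_affine (- x) s0 iG.
rewrite -EG -[LHS](@mulVKf _ (Num.sqrt e)) ?gt_eqF// -H -RintegralM.
  apply: eq_Rintegral => z _; rewrite opprD opprK [- _ + x]addrC.
  rewrite opprB [x + _]addrC subrK heat_kernel_scale// mulrCA mulVKf//.
  by rewrite gt_eqF.
by have [] := Rintegral_affine (- x) s0 iG.
Qed.

Lemma mollify_bound (f : R -> R) B e x : measurable_fun setT f ->
  (forall x, `|f x| <= B) -> 0 < e ->
  `|\int[lambda]_y (f y * heat_kernel e (x - y))| <= B.
Proof.
move=> mf fB e0.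
have iF : Rintegrable lambda (fun y => f y * heat_kernel e (x - y)).
  by apply: Rintegrable_boundedM fB _ => //; exact: Rintegrable_heat_kernelB.
apply: (le_trans (le_normr_Rintegral measurableT iF)).
apply: (@le_trans _ _ (\int[lambda]_y (B * heat_kernel e (x - y)))).
  apply: le_RintegralT.
  - exact: Rintegrable_norm.
  - by apply: RintegrableM; exact: Rintegrable_heat_kernelB.
  - by move=> y; rewrite normrM (ger0_norm (heat_kernel_ge0 _ _)) ler_wpM2r ?heat_kernel_ge0.
rewrite (@mollify_subst (fun=> B) B)//; last first.
  by move=> y; rewrite ger0_norm// (le_trans (normr_ge0 _) (fB 0)).
by rewrite RintegralM ?Rintegral_heat_kernel ?mulr1//; exact: Rintegrable_heat_kernel.
Qed.

Lemma mollify_cvg (f : R -> R) B x (del : nat -> R) : measurable_fun setT f ->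
  (forall x, `|f x| <= B) -> {for x, continuous f} ->
  (forall n, 0 < del n) -> del n @[n --> \oo] --> 0 ->
  \int[lambda]_y (f y * heat_kernel (del n) (x - y)) @[n --> \oo] --> f x.
Proof.
move=> mf fB cf d0 d_0.
apply: (eq_cvg_seq (v := fun n =>
    \int[lambda]_z (f (x - Num.sqrt (del n) * z) * heat_kernel 1 z))).
  by move=> n; exact: mollify_subst fB _.
have -> : f x = \int[lambda]_z (f x * heat_kernel 1 z).
  by rewrite RintegralM ?Rintegral_heat_kernel ?mulr1//; exact: Rintegrable_heat_kernel.
have mh := @measurable_heat_kernel R 1.
have [|||||_ //] := @Rintegral_dominated _ _ _ lambda
  (fun n z => f (x - Num.sqrt (del n) * z) * heat_kernel 1 z)
  (fun z => f x * heat_kernel 1 z) (fun z => B * heat_kernel 1 z).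
- move=> n; apply: mfun_ofRL; apply: mfunM => //.
  by apply: measurableT_comp => //; mfun.
- by apply: mfun_ofRL; mfun.
- apply: aeW => z; apply: cvgM; last exact: cvg_cst.
  apply: continuous_cvg => //; rewrite -[X in _ --> X]subr0; apply: cvgB.
    exact: cvg_cst.
  rewrite -(mul0r z); apply: cvgM; last exact: cvg_cst.
  by rewrite -sqrtr0; apply: continuous_cvg => //; exact: sqrt_continuous.
- by apply: RintegrableM; exact: Rintegrable_heat_kernel.
- by move=> n z; rewrite normrM (ger0_norm (heat_kernel_ge0 _ _)) ler_wpM2r ?heat_kernel_ge0.
Qed.

End mollification.

Section fourier_inversion.
Context d (T : measurableType d) (R : realType).
Notation lambda := (@lebesgue_measure R).
Variables (mu : {finite_measure set T -> \bar R}) (v : T -> R).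
Hypothesis mv : measurable_fun setT v.
Implicit Types (f : R -> R) (xi x y e : R).

Definition ft_cos xi := \int[mu]_p cos (xi * v p).
Definition ft_sin xi := \int[mu]_p sin (xi * v p).
(** Real form of Fourier inversion for the image of [mu] under [v]. The Gaussian factor in
    [ft_smooth] corresponds to convolving that image with the heat kernel of variance [e]. *)
Definition ft_density x := (2 * pi)^-1 *
  \int[lambda]_xi (ft_cos xi * cos (xi * x) + ft_sin xi * sin (xi * x)).
Definition ft_smooth e x := (2 * pi)^-1 *
  \int[lambda]_xi (expR (- (e * xi ^+ 2 / 2)) *
    (ft_cos xi * cos (xi * x) + ft_sin xi * sin (xi * x))).

Let pi2 : 0 < 2 * pi :> R. Proof. by rewrite mulr_gt0 ?pi_gt0. Qed.

Let pi2V : 0 <= (2 * pi)^-1 :> R. Proof. by rewrite invr_ge0 ltW. Qed.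

Let mass := fine (mu setT).

Let icos a b : Rintegrable mu (fun p => cos (a * v p + b)).
Proof.
apply: (@Rintegrable_bounded _ _ _ _ _ (1)); first by mfun.
by move=> p; rewrite ler_norml cos_geN1 cos_le1.
Qed.

Let isin a b : Rintegrable mu (fun p => sin (a * v p + b)).
Proof.
apply: (@Rintegrable_bounded _ _ _ _ _ (1)); first by mfun.
by move=> p; rewrite ler_norml sin_geN1 sin_le1.
Qed.

Let mass_bound f : measurable_fun setT f -> (forall x, `|f x| <= 1) ->
  `|\int[mu]_p f (v p)| <= mass.
Proof.
move=> mf f1.
have ifv : Rintegrable mu (fun p => f (v p)).
  by apply: (@Rintegrable_bounded _ _ _ _ _ (1)) => //; exact: measurableT_comp.
apply: (le_trans (le_normr_Rintegral measurableT ifv)).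
rewrite -[leRHS]mul1r -(Rintegral_cst mu measurableT 1).
by apply: le_RintegralT => //; [exact: Rintegrable_norm|exact: Rintegrable_cst].
Qed.

Lemma ft_cos_bound xi : `|ft_cos xi| <= mass.
Proof.
apply: (mass_bound (f := fun x => cos (xi * x))); first by mfun.
by move=> x; rewrite ler_norml cos_geN1 cos_le1.
Qed.

Lemma ft_sin_bound xi : `|ft_sin xi| <= mass.
Proof.
apply: (mass_bound (f := fun x => sin (xi * x))); first by mfun.
by move=> x; rewrite ler_norml sin_geN1 sin_le1.
Qed.

Lemma measurable_ft_cos : measurable_fun setT ft_cos.
Proof.
apply: (@measurable_RintegralF _ _ _ _ _ mu (fun z : R * T => cos (z.1 * v z.2))).
by mfun; exact: mfun_snd.
Qed.

Lemma measurable_ft_sin : measurable_fun setT ft_sin.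
Proof.
apply: (@measurable_RintegralF _ _ _ _ _ mu (fun z : R * T => sin (z.1 * v z.2))).
by mfun; exact: mfun_snd.
Qed.

(** Fubini, with absolute convergence due to the Gaussian factor alone. Integrability of the Fourier
    transform is assumed only further down, so this identity will hold for every outcome and not
    just almost surely. *)
Lemma heat_kernel_occupation e x : 0 < e ->
  \int[mu]_p heat_kernel e (x - v p) = ft_smooth e x.
Proof.
move=> e0.
have ig := Rintegrable_expR_sqr e0.
have mE : measurable_fun setT (fun xi : R => expR (- (e * xi ^+ 2 / 2))) by mfun.
pose F (z : T * measurableTypeR R) : R :=
  expR (- (e * z.2 ^+ 2 / 2)) * cos (z.2 * (x - v z.1)).
have mF : measurable_fun setT F.
  by rewrite /F; mfun; exact: mfun_fst.
have i2 p : Rintegrable lambda (fun xi => F (p, xi)).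
  rewrite /F /=; apply: Rintegrable_leR ig _; first by mfun.
  by move=> xi; rewrite normrM ger0_norm ?expR_ge0// ler_piMr ?expR_ge0//
    ler_norml cos_geN1 cos_le1.
have cosE xi p : cos (xi * (x - v p)) =
    cos (xi * x) * cos (xi * v p) + sin (xi * x) * sin (xi * v p).
  by rewrite mulrBr cosB.
have icos0 xi : Rintegrable mu (fun p => cos (xi * v p)).
  by have := icos xi 0; apply: eq_integrable => // p _; rewrite /= addr0.
have isin0 xi : Rintegrable mu (fun p => sin (xi * v p)).
  by have := isin xi 0; apply: eq_integrable => // p _; rewrite /= addr0.
have i1 xi : Rintegrable mu (fun p => F (p, xi)).
  rewrite /F /=; apply: RintegrableM.
  have := RintegrableD (RintegrableM (cos (xi * x)) (icos0 xi))
    (RintegrableM (sin (xi * x)) (isin0 xi)).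
  by apply: eq_integrable => // p _ /=; rewrite cosE.
have iF : Rintegrable (mu \x lambda)%E F.
  apply: (@Rintegrable_prodP _ _ _ _ _ _ _ _
     (fun=> \int[lambda]_xi expR (- (e * xi ^+ 2 / 2)))) => //.
    move=> p; apply: le_RintegralT => //; first exact: Rintegrable_norm.
    move=> xi; rewrite /F/= normrM ger0_norm ?expR_ge0// ler_piMr ?expR_ge0//.
    by rewrite ler_norml cos_geN1 cos_le1.
  exact: Rintegrable_cst.
transitivity (\int[mu]_p ((2 * pi)^-1 * \int[lambda]_xi F (p, xi))).
  apply: eq_Rintegral => p _; rewrite /F /= heat_kernel_fourier// mulKf//.
  by rewrite gt_eqF.
rewrite RintegralM; last exact: (Rintegrable_fubiniF iF i2).
rewrite /ft_smooth (Rintegral_Fubini iF i2 i1); congr (_ * _).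
apply: eq_Rintegral => xi _; rewrite /F /=.
under eq_Rintegral do rewrite cosE.
rewrite RintegralM; last first.
  by apply: RintegrableD; exact: RintegrableM.
rewrite RintegralDT; [|exact: RintegrableM..].
by rewrite !RintegralM// -/(ft_cos xi) -/(ft_sin xi) mulrC [cos _ * _]mulrC
  [sin _ * _]mulrC mulrC.
Qed.

Hypotheses (ic : Rintegrable lambda ft_cos) (is_ : Rintegrable lambda ft_sin).

Let dom xi := `|ft_cos xi| + `|ft_sin xi|.

Let idom : Rintegrable lambda dom.
Proof. by apply: RintegrableD; exact: Rintegrable_norm. Qed.

Let integrand x xi := ft_cos xi * cos (xi * x) + ft_sin xi * sin (xi * x).

Let m_integrand x : measurable_fun setT (integrand x).
Proof.
have := measurable_ft_cos; have := measurable_ft_sin => ms mc.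
by rewrite /integrand; mfun.
Qed.

Let integrand_le x xi : `|integrand x xi| <= dom xi.
Proof.
rewrite (le_trans (ler_normD _ _))// !normrM lerD// ler_piMr//.
  by rewrite ler_norml cos_geN1 cos_le1.
by rewrite ler_norml sin_geN1 sin_le1.
Qed.

Let i_integrand x : Rintegrable lambda (integrand x).
Proof. exact: Rintegrable_leR idom _. Qed.

Definition ft_bound := (2 * pi)^-1 * \int[lambda]_xi (`|ft_cos xi| + `|ft_sin xi|).

Lemma ft_density_bound x : `|ft_density x| <= ft_bound.
Proof.
rewrite /ft_density /ft_smooth /ft_bound normrM ger0_norm// ler_wpM2l//.
apply: (le_trans (le_normr_Rintegral measurableT (i_integrand x))).
by apply: le_RintegralT => //; exact: Rintegrable_norm.
Qed.

Let smooth_le e xi : 0 < e -> `|expR (- (e * xi ^+ 2 / 2))| <= 1.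
Proof.
move=> e0; rewrite ger0_norm ?expR_ge0// -expR0 ler_expR lerNl oppr0.
by rewrite divr_ge0// mulr_ge0 ?sqr_ge0// ltW.
Qed.

Lemma ft_smooth_bound e x : 0 < e -> `|ft_smooth e x| <= ft_bound.
Proof.
move=> e0; rewrite /ft_density /ft_smooth /ft_bound normrM ger0_norm// ler_wpM2l//.
have ii : Rintegrable lambda (fun xi => expR (- (e * xi ^+ 2 / 2)) * integrand x xi).
  by apply: (Rintegrable_boundedM (B := 1)) => //; [mfun|move=> xi; exact: smooth_le].
apply: (le_trans (le_normr_Rintegral measurableT ii)).
apply: le_RintegralT => //; first exact: Rintegrable_norm.
move=> xi; rewrite normrM; apply: le_trans (integrand_le x xi).
by rewrite ler_piMl// smooth_le.
Qed.

Lemma measurable_ft_smooth e : measurable_fun setT (ft_smooth e).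
Proof.
apply: mfunM => //.
have mc := measurable_ft_cos; have ms := measurable_ft_sin.
apply: (@measurable_RintegralF _ _ _ _ _ lambda (fun z : R * measurableTypeR R =>
  expR (- (e * z.2 ^+ 2 / 2)) * (ft_cos z.2 * cos (z.2 * z.1) + ft_sin z.2 * sin (z.2 * z.1)))).
by mfun; [exact: (mfun_snd (mfun_ofRL mc))|exact: (mfun_snd (mfun_ofRL ms))].
Qed.

Lemma ft_smooth_cvg x (del : nat -> R) : (forall n, 0 < del n) ->
  del n @[n --> \oo] --> 0 -> ft_smooth (del n) x @[n --> \oo] --> ft_density x.
Proof.
move=> d0 d_0; apply: cvgM; first exact: cvg_cst.
have [|||||_ //] := @Rintegral_dominated _ _ _ lambda
  (fun n xi => expR (- (del n * xi ^+ 2 / 2)) * integrand x xi) (integrand x) dom.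
- by move=> n; apply: mfun_ofRL; apply: mfunM; [mfun|exact: m_integrand].
- exact: mfun_ofRL.
- apply: aeW => xi.
  rewrite -[X in _ --> X](_ : expR (- (0 * xi ^+ 2 / 2)) * integrand x xi = _); last first.
    by rewrite !mul0r oppr0 expR0 mul1r.
  apply: cvgM; last exact: cvg_cst.
  apply: continuous_cvg; first exact: continuous_expR.
  apply: cvgN; apply: cvgM; last exact: cvg_cst.
  by apply: cvgM => //; exact: cvg_cst.
- exact: idom.
- move=> n xi; rewrite normrM; apply: le_trans (integrand_le x xi).
  by rewrite ler_piMl// smooth_le.
Qed.

Lemma ft_density_continuous : continuous ft_density.
Proof.
move=> x; apply/(@cvg_nbhsP _ R^o) => u ux; apply: cvgM; first exact: cvg_cst.
have [|||||_ //] := @Rintegral_dominated _ _ _ lambda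
  (fun n => integrand (u n)) (integrand x) dom.
- by move=> n; exact: mfun_ofRL.
- exact: mfun_ofRL.
- apply: aeW => xi; apply: cvgD; apply: cvgM; try exact: cvg_cst.
    apply: continuous_cvg; first exact: continuous_cos.
    by apply: cvgM => //; exact: cvg_cst.
  apply: continuous_cvg; first exact: continuous_sin.
  by apply: cvgM => //; exact: cvg_cst.
- exact: idom.
- by move=> n xi; exact: integrand_le.
Qed.

(** The inversion formula does not show the sign; it is inherited from the approximations
    [ft_smooth], which are integrals of heat kernels. *)
Lemma ft_density_ge0 x : 0 <= ft_density x.
Proof.
have del0 n : 0 < n.+1%:R^-1 :> R by rewrite invr_gt0.
have h := @ft_smooth_cvg x _ del0 cvg_harmonic.
apply: (cvgr_to_ge h).
apply: nearW => n; rewrite -heat_kernel_occupation//.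
by apply: Rintegral_ge0 => p _; exact: heat_kernel_ge0.
Qed.

Lemma mollify_occupation f e : Rintegrable lambda f -> 0 < e ->
  \int[mu]_p \int[lambda]_y (f y * heat_kernel e (v p - y)) =
  \int[lambda]_y (f y * ft_smooth e y).
Proof.
move=> fi e0; have mf := Rintegrable_measurableR fi.
have mh := @measurable_heat_kernel R e.
set B := (Num.sqrt (2 * pi * e))^-1.
have hB x : `|heat_kernel e x| <= B by rewrite ger0_norm ?heat_kernel_ge0// heat_kernel_le.
pose F (z : T * measurableTypeR R) : R := f z.2 * heat_kernel e (v z.1 - z.2).
have mF : measurable_fun setT F.
  apply: mfunM; first exact: (mfun_snd (mfun_ofRL mf)).
  by apply: (measurableT_comp mh); mfun; exact: mfun_fst.
have Fle p y : `|F (p, y)| <= B * `|f y|.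
  by rewrite normrM mulrC ler_wpM2r.
have i2 p : Rintegrable lambda (fun y => F (p, y)).
  apply: Rintegrable_leR (RintegrableM B (Rintegrable_norm fi)) _ => //.
  exact: (measurable_pair1r p mF).
have i1 y : Rintegrable mu (fun p => F (p, y)).
  apply: (@Rintegrable_bounded _ _ _ _ _ (B * `|f y|)) => //.
  exact: (measurable_pair2r y mF).
have iF : Rintegrable (mu \x lambda)%E F.
  apply: (@Rintegrable_prodP _ _ _ _ _ _ _ _
     (fun=> \int[lambda]_y (B * `|f y|))) => //; last exact: Rintegrable_cst.
  move=> p; apply: le_RintegralT => //; first exact: Rintegrable_norm.
  by apply: RintegrableM; exact: Rintegrable_norm.
rewrite (Rintegral_Fubini iF i2 i1); apply: eq_Rintegral => y _; rewrite /F /=.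
rewrite -heat_kernel_occupation// -RintegralM.
  by apply: eq_Rintegral => p _; rewrite -heat_kernelN opprB.
apply: (@Rintegrable_bounded _ _ _ _ _ (B)) => //.
by apply: (measurableT_comp mh); mfun.
Qed.

Lemma mollify_occupation_cvg f (del : nat -> R) : Rintegrable lambda f ->
  (forall n, 0 < del n) -> del n @[n --> \oo] --> 0 ->
  \int[mu]_p \int[lambda]_y (f y * heat_kernel (del n) (v p - y)) @[n --> \oo] -->
  \int[lambda]_y (f y * ft_density y).
Proof.
move=> fi d0 d_0; have mf := Rintegrable_measurableR fi.
apply: (eq_cvg_seq (v := fun n => \int[lambda]_y (f y * ft_smooth (del n) y))).
  by move=> n; exact: mollify_occupation.
have md : measurable_fun setT ft_density.
  by apply: continuous_measurable_fun; exact: ft_density_continuous.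
have [|||||_ //] := @Rintegral_dominated _ _ _ lambda
  (fun n y => f y * ft_smooth (del n) y) (fun y => f y * ft_density y)
  (fun y => ft_bound * `|f y|).
- by move=> n; apply: mfun_ofRL; apply: mfunM => //; exact: measurable_ft_smooth.
- by apply: mfun_ofRL; mfun.
- by apply: aeW => y; apply: cvgM; [exact: cvg_cst|exact: ft_smooth_cvg].
- by apply: RintegrableM; exact: Rintegrable_norm.
- by move=> n y; rewrite normrM mulrC ler_wpM2r// ft_smooth_bound.
Qed.

(** Mollification identifies the density on continuous test functions; [Rintegral_density], applied
    to the image of [mu] under [v], then reaches measurable ones. *)
Lemma occupation_density f B : Rintegrable lambda f -> (forall x, `|f x| <= B) ->
  \int[mu]_p f (v p) = \int[lambda]_x (f x * ft_density x).
Proof.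
move=> fi fB; have mf := Rintegrable_measurableR fi.
have md : measurable_fun setT ft_density.
  by apply: continuous_measurable_fun; exact: ft_density_continuous.
have mvRL : @measurable_fun _ _ T (measurableTypeR R) setT v by [].
have pushE (g : R -> R) : measurable_fun setT g -> (forall x, 0 <= g x <= 1) ->
    \int[pushforward mu (v : T -> measurableTypeR R)]_x g x = \int[mu]_p g (v p).
  move=> mg g01; rewrite /Rintegral; congr fine.
  rewrite (ge0_integral_pushforward mvRL)//.
    by apply/measurable_EFinP; exact: mfun_ofRL.
  by move=> x _; rewrite lee_fin; case/andP: (g01 x).
pose pm0 := [the {measure set (measurableTypeR R) -> \bar R} of
  pushforward mu (v : T -> measurableTypeR R)].
pose pm := pm0 mvRL.
have pushfin : fin_num_fun pm.
  move=> A mA; apply: fin_num_measure; rewrite -[X in measurable X]setTI.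
  exact (mvRL measurableT A mA).
pose nu : {finite_measure set (measurableTypeR R) -> \bar R} :=
  HB.pack (Measure.sort pm) (Measure_isFinite.Build _ _ _ pm pushfin).
have key (g : R -> R) : measurable_fun setT g -> (forall x, 0 <= g x <= 1) ->
    Rintegrable lambda g -> \int[mu]_p g (v p) = \int[lambda]_x (g x * ft_density x).
  move=> mg g01 gi; rewrite -(pushE mvRL)//.
  apply: (@Rintegral_density _ nu ft_density ft_bound) => //.
  - exact: ft_density_ge0.
  - by move=> x; rewrite (le_trans (ler_norm _))// ft_density_bound.
  move=> h ch h01 hi.
  have mh : measurable_fun setT h by exact: continuous_measurable_fun.
  rewrite -[LHS]/(\int[pushforward mu (v : T -> measurableTypeR R)]_x h x).
  rewrite (pushE mvRL)//.
  have del0 n : 0 < n.+1%:R^-1 :> R by rewrite invr_gt0.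
  (* The same sequence has two limits: this one from the Fourier side, the other from pointwise
     convergence of the mollifications of the continuous [h]. *)
  have := mollify_occupation_cvg hi del0 cvg_harmonic.
  apply: cvg_unique => //.
  have hB x : `|h x| <= 1 by rewrite ger0_norm; case/andP: (h01 x).
  have [|||||_ //] := @Rintegral_dominated _ _ _ mu
    (fun n p => \int[lambda]_y (h y * heat_kernel n.+1%:R^-1 (v p - y)))
    (fun p => h (v p)) (fun=> 1).
  + move=> n; apply: (@measurable_RintegralF _ _ _ _ _ lambda (fun z : T * measurableTypeR R =>
      h z.2 * heat_kernel n.+1%:R^-1 (v z.1 - z.2))).
    apply: mfunM; first exact: (mfun_snd (mfun_ofRL mh)).
    apply: (measurableT_comp (@measurable_heat_kernel R _)).
    by mfun; exact: mfun_fst.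
  + exact: measurableT_comp.
  + by apply: aeW => p; exact: mollify_cvg hB (ch _) del0 cvg_harmonic.
  + exact: Rintegrable_cst.
  + by move=> n p; exact: mollify_bound.
(* Dividing by [C] brings both parts of [f] into [[0, 1]], the range required by [key]; the added 1
   makes [C] positive. *)
pose C := `|B| + 1; have C0 : 0 < C by rewrite ltr_wpDl.
have fC x : `|f x| / C <= 1.
  rewrite ler_pdivrMr// mul1r (le_trans (fB x))// (le_trans (ler_norm _))//.
  by rewrite lerDl.
pose g1 x := Num.max (f x) 0 / C; pose g2 x := Num.max (- f x) 0 / C.
have g1P x : 0 <= g1 x <= 1.
  apply/andP; split; first by rewrite divr_ge0 ?(ltW C0)// le_max lexx orbT.
  apply: le_trans (fC x); rewrite /g1; by rewrite ler_pM2r ?invr_gt0// ge_max ler_norm normr_ge0.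
have g2P x : 0 <= g2 x <= 1.
  apply/andP; split; first by rewrite divr_ge0 ?(ltW C0)// le_max lexx orbT.
  apply: le_trans (fC x); rewrite /g2; by rewrite ler_pM2r ?invr_gt0// ge_max -normrN ler_norm normr_ge0.
have mg1 : measurable_fun setT g1 by apply: mfunM => //; exact: measurable_maxr.
have mg2 : measurable_fun setT g2.
  by apply: mfunM => //; apply: measurable_maxr => //; mfun.
have ig1 : Rintegrable lambda g1.
  apply: Rintegrable_leR (RintegrableM C^-1 (Rintegrable_norm fi)) _ => // x.
  have /andP[g0 _] := g1P x; rewrite ger0_norm// mulrC /g1 ler_pM2r ?invr_gt0//.
  by rewrite ge_max ler_norm normr_ge0.
have ig2 : Rintegrable lambda g2.
  apply: Rintegrable_leR (RintegrableM C^-1 (Rintegrable_norm fi)) _ => // x.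
  have /andP[g0 _] := g2P x; rewrite ger0_norm// mulrC /g2 ler_pM2r ?invr_gt0//.
  by rewrite ge_max -normrN ler_norm normr_ge0.
have fE x : f x = C * (g1 x - g2 x).
  rewrite /g1 /g2 -mulrBl mulrC divfK ?gt_eqF//.
  by case: (leP (f x) 0); case: (leP (- f x) 0); lra.
have igd (g : R -> R) : Rintegrable lambda g -> Rintegrable lambda (fun x => g x * ft_density x).
  move=> gi; have := Rintegrable_boundedM md ft_density_bound gi.
  by apply: eq_integrable => // x _; rewrite /= mulrC.
have igv (g : R -> R) : measurable_fun setT g -> (forall x, 0 <= g x <= 1) ->
    Rintegrable mu (fun p => g (v p)).
  move=> mg g01; apply: (@Rintegrable_bounded _ _ _ _ _ (1)); first exact: measurableT_comp.
  by move=> p; rewrite ger0_norm; case/andP: (g01 (v p)).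
under eq_Rintegral do rewrite fE.
under [RHS]eq_Rintegral do rewrite fE -mulrA mulrBl.
rewrite !RintegralM ?RintegralBT ?key//; try exact: igv; try exact: igd.
- by apply: RintegrableB; exact: igv.
- by apply: RintegrableB; exact: igd.
Qed.

(** By the density formula the left-hand side is the integral of [f] against the density read at
    [x / lam n]. The density is bounded and continuous at 0, so it can be replaced by its value
    there. *)
Lemma occupation_rescaled_cvg f B (lam : nat -> R) : Rintegrable lambda f ->
  (forall x, `|f x| <= B) -> (forall n, 0 < lam n) -> (lam n)^-1 @[n --> \oo] --> 0 ->
  lam n * \int[mu]_p f (lam n * v p) @[n --> \oo] -->
  (\int[lambda]_x f x) * ft_density 0.
Proof.
move=> fi fB l0 l_0; have mf := Rintegrable_measurableR fi.
have md : measurable_fun setT ft_density.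
  by apply: continuous_measurable_fun; exact: ft_density_continuous.
have E n : lam n * \int[mu]_p f (lam n * v p) =
    \int[lambda]_x (f x * ft_density ((lam n)^-1 * x)).
  have [il _] := Rintegral_affine 0 (l0 n) fi.
  have il' : Rintegrable lambda (fun x => f (lam n * x)).
    by have := il; apply: eq_integrable => // x _; rewrite /= addr0.
  rewrite (occupation_density il' (B := B))//.
  have ig : Rintegrable lambda (fun x => f x * ft_density ((lam n)^-1 * x)).
    have mdl : measurable_fun setT (fun x => ft_density ((lam n)^-1 * x)).
      by apply: measurableT_comp => //; mfun.
    have := Rintegrable_boundedM mdl (fun x => ft_density_bound _) fi.
    by apply: eq_integrable => // x _; rewrite /= mulrC.
  have [_ H] := Rintegral_affine 0 (l0 n) ig.
  rewrite -[RHS]mul1r -(mulfV (lt0r_neq0 (l0 n))) -mulrA -H; congr (_ * _).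
  by apply: eq_Rintegral => x _; rewrite addr0 mulKf// gt_eqF.
apply: (eq_cvg_seq E).
rewrite mulrC -RintegralM//.
have [|||||_ //] := @Rintegral_dominated _ _ _ lambda
  (fun n x => f x * ft_density ((lam n)^-1 * x)) (fun x => ft_density 0 * f x)
  (fun x => ft_bound * `|f x|).
- move=> n; apply: mfun_ofRL; apply: mfunM => //.
  by apply: measurableT_comp => //; mfun.
- by apply: mfun_ofRL; mfun.
- apply: aeW => x; rewrite mulrC; apply: cvgM; first exact: cvg_cst.
  apply: continuous_cvg; first exact: ft_density_continuous.
  by rewrite -(mul0r x); apply: cvgM => //; exact: cvg_cst.
- by apply: RintegrableM; exact: Rintegrable_norm.
- by move=> n x; rewrite normrM mulrC ler_wpM2r// ft_density_bound.
Qed.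

End fourier_inversion.

(** * Processes with a characteristic exponent *)

Section sub_sigma_algebra_measurability.
Context (R : realType) d (Omega : measurableType d).
Variable G : set (set Omega).
Hypothesis sG : sigma_algebra setT G.
Implicit Types Y Z : Omega -> R.

(** A copy of [Omega] whose measurable sets are those of [G], which turns [measurable_wrt G] into
    ordinary measurability. *)
Let GO : measurableType _ := g_sigma_algebraType G.

Lemma measurable_wrtP Z :
  measurable_wrt G Z <-> @measurable_fun _ _ GO R setT (Z : GO -> R).
Proof.
have E : @measurable _ GO = G by exact: (sigma_algebra_id sG).
split=> [GZ _ B mB|mZ B mB]; first by rewrite setTI E; exact: GZ.
by rewrite -E -[X in measurable X]setTI; exact: mZ.
Qed.

Lemma measurable_wrt_sup r Z : measurable_wrt G Z -> G [set w | r < Z w].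
Proof.
move=> GZ; have := GZ `]r, +oo[%classic (measurable_itv _); congr G.
by apply/seteqP; split => w /=; rewrite in_itv/= andbT.
Qed.

Lemma measurable_wrtD Y Z : measurable_wrt G Y -> measurable_wrt G Z ->
  measurable_wrt G (fun w => Y w + Z w).
Proof.
move=> /measurable_wrtP mY /measurable_wrtP mZ; apply/measurable_wrtP.
exact: measurable_funD.
Qed.

Lemma measurable_wrtM c Z : measurable_wrt G Z -> measurable_wrt G (fun w => c * Z w).
Proof.
by move=> /measurable_wrtP mZ; apply/measurable_wrtP; exact: measurable_funM.
Qed.

Lemma measurable_wrt_cst c : measurable_wrt G (fun=> c : R).
Proof. by apply/measurable_wrtP. Qed.

Lemma measurable_wrt_continuous (h : R -> R) Z : continuous h ->
  measurable_wrt G Z -> measurable_wrt G (fun w => h (Z w)).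
Proof.
move=> ch /measurable_wrtP mZ; apply/measurable_wrtP.
by apply: (@mfun_continuous _ GO R Z h).
Qed.

(** Shifting [Z] by [M] makes it nonnegative; the layer cake formula then writes it as a
    superposition of indicators of sets of [G], over each of which [g] integrates to 0. *)
Lemma integral_orthogonal (P : probability Omega R) g Z M : G `<=` measurable ->
  Rintegrable P g -> (forall A, G A -> \int[P]_(w in A) g w = 0) ->
  measurable_wrt G Z -> (forall w, `|Z w| <= M) -> \int[P]_w (g w * Z w) = 0.
Proof.
move=> Gm ig g0 mZ ZM; have mg := Rintegrable_measurable ig.
have GT : G setT by case: sG => G0 + _ => /(_ _ G0); rewrite setD0.
pose W w := Z w + M.
have mW : measurable_wrt G W by apply: measurable_wrtD => //; exact: measurable_wrt_cst.
have mW' : measurable_fun setT W.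
  by move=> _ B mB; rewrite setTI; apply: Gm; exact: mW.
have mZ' : measurable_fun setT Z.
  by move=> _ B mB; rewrite setTI; apply: Gm; exact: mZ.
have W0M w : 0 <= W w <= 2 * M.
  have := ZM w; rewrite ler_norml => /andP[h1 h2]; rewrite /W; apply/andP; split; lra.
have iZ : Rintegrable P (fun w => g w * Z w).
  apply: Rintegrable_le (RintegrableM M (Rintegrable_norm ig)) _; first by mfun.
  by move=> w; rewrite normrM mulrC ler_wpM2r.
have E : \int[P]_w (g w * W w) = 0.
  rewrite (layer_cake ig mW' W0M).
  transitivity (\int[@lebesgue_measure R]_r (0 : R)); last first.
    by rewrite Rintegral_cst// mul0r.
  apply: eq_Rintegral => r _.
  rewrite -(g0 [set w | (0 <= r) && (r < W w)]); last first.
    have [r0|r0] := leP 0 r; first exact: measurable_wrt_sup.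
    rewrite (_ : [set _ | _] = set0); first by case: sG.
    by apply/seteqP; split.
  rewrite [RHS]Rintegral_mkcond; apply: eq_Rintegral => w _.
  rewrite patchE /below; case: ifPn => h; first by rewrite mulr1 mem_set.
  by rewrite mulr0 memNset//; exact/negP.
have : \int[P]_w (g w * Z w) = \int[P]_w (g w * W w) - \int[P]_w (M * g w).
  rewrite -RintegralBT; last exact: RintegrableM.
    by apply: eq_Rintegral => w _; rewrite /W; ring.
  apply: Rintegrable_le (RintegrableM (2 * M) (Rintegrable_norm ig)) _; first by mfun.
  move=> w; have /andP[h1 h2] := W0M w.
  by rewrite normrM mulrC ler_wpM2r// ger0_norm.
by rewrite E RintegralM// (g0 _ GT) mulr0 subr0.
Qed.

End sub_sigma_algebra_measurability.

Section linear_combinations.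
Context (R : realType) d (Omega : measurableType d).
Implicit Types (P : probability Omega R) (Z : R -> Omega -> R) (l : seq (R * R)).

(* [(c, u) \in l] stands for the term [c * Z u]. *)
Definition lincomb Z l w := \sum_(p <- l) p.1 * Z p.2 w.

Lemma lincomb_cons Z p l w : lincomb Z (p :: l) w = p.1 * Z p.2 w + lincomb Z l w.
Proof. by rewrite /lincomb big_cons. Qed.

Lemma lincomb_nil Z w : lincomb Z [::] w = 0.
Proof. by rewrite /lincomb big_nil. Qed.

Lemma lincomb_perm Z l l' w : perm_eq l l' -> lincomb Z l w = lincomb Z l' w.
Proof. exact: perm_big. Qed.

(* The finite dimensional distributions of a process with stationary independent
   increments of characteristic exponent [psi], read on real trigonometric
   functions. *)
Definition exponent_process P (psi : R -> R) Z :=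
  [/\ measurable_fun setT (fun z : Omega * R => Z z.2 z.1),
      forall w, Z 0 w = 0 &
      forall l b c s t, 0 <= s -> s <= t -> all (fun p => 0 <= p.2 <= s) l ->
        \int[P]_w cos (c * (Z t w - Z s w) + lincomb Z l w + b) =
        expR (- ((t - s) * psi c)) * \int[P]_w cos (lincomb Z l w + b)].

Lemma exponent_process_measurable P psi Z u : exponent_process P psi Z ->
  measurable_fun setT (Z u).
Proof. by case=> mZ _ _; exact: (measurable_pair2r u mZ). Qed.

Lemma exponent_process_timescale P psi Z a : 0 < a -> exponent_process P psi Z ->
  exponent_process P (fun c => a * psi c) (fun u => Z (a * u)).
Proof.
move=> a0 [mZ Z0 tower]; split.
- apply: (measurableT_comp mZ (_ : measurable_fun setT (fun z : Omega * R => (z.1, a * z.2)))).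
  by apply: measurable_fun_pair => //=; mfun.
- by move=> w; rewrite mulr0.
move=> l b c s t s0 st ls.
pose l' := [seq (p.1, a * p.2) | p <- l].
have lE w : lincomb (fun u => Z (a * u)) l w = lincomb Z l' w.
  by rewrite /lincomb big_map.
under eq_Rintegral do rewrite lE.
under [in RHS]eq_Rintegral do rewrite lE.
rewrite tower ?mulr_ge0 ?(ltW a0) ?ler_pM2l//; last first.
  by rewrite all_map; apply: sub_all ls => p /andP[p0 ps] /=; rewrite mulr_ge0 ?(ltW a0)//= ler_pM2l.
by congr (expR (- _) * _); ring.
Qed.

Lemma exponent_process_scale P psi Z a : exponent_process P psi Z ->
  exponent_process P (fun c => psi (a * c)) (fun u w => a * Z u w).
Proof.
move=> [mZ Z0 tower]; split.
- by mfun.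
- by move=> w; rewrite Z0 mulr0.
move=> l b c s t s0 st ls.
pose l' := [seq (a * p.1, p.2) | p <- l].
have lE w : lincomb (fun u w => a * Z u w) l w = lincomb Z l' w.
  by rewrite /lincomb big_map; apply: eq_bigr => p _ /=; ring.
under eq_Rintegral do rewrite lE -mulrBr mulrA [c * a]mulrC.
under [in RHS]eq_Rintegral do rewrite lE.
by rewrite tower// all_map.
Qed.

(** Peels off the latest time: [c * Z t = c * (Z t - Z s) + c * Z s], where the increment
    contributes the same factor for both processes and [c * Z s] merges with the next term of the
    list. *)
Lemma exponent_process_fdd_sorted P psi Z Z' l b : exponent_process P psi Z ->
  exponent_process P psi Z' -> sorted (fun p q => q.2 <= p.2) l ->
  all (fun p => 0 <= p.2) l ->
  \int[P]_w cos (lincomb Z l w + b) = \int[P]_w cos (lincomb Z' l w + b).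
Proof.
move=> [_ Z0 T] [_ Z0' T'].
have [n] := ubnP (size l); elim: n l => // n IH [|[c t] l] /=.
  by move=> _ _ _; apply: eq_Rintegral => w _; rewrite !lincomb_nil.
have step (Y : R -> Omega -> R) s :
    (forall w, cos (lincomb Y ((c, t) :: l) w + b) =
      cos (c * (Y t w - Y s w) + (c * Y s w + lincomb Y l w) + b)).
  by move=> w; rewrite lincomb_cons /=; congr cos; ring.
case: l IH step => [|[c' s] l] IH step sn.
  (* With a single time left, the increment is taken from time 0, where both processes vanish. *)
  move=> _ /= /andP[t0 _].
  have glue (Y : R -> Omega -> R) w : Y 0 w = 0 ->
      c * Y 0 w + lincomb Y [::] w = lincomb Y [::] w.
    by move=> ->; rewrite mulr0 add0r.
  under eq_Rintegral do rewrite (step Z 0) glue//.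
  under [RHS]eq_Rintegral do rewrite (step Z' 0) glue//.
  rewrite T// T'//; congr (_ * _).
  by apply: eq_Rintegral => w _; rewrite !lincomb_nil.
move=> /= /andP[st srt] /and3P[t0 s0 l0].
have glue (Y : R -> Omega -> R) w : c * Y s w + lincomb Y ((c', s) :: l) w =
    lincomb Y ((c + c', s) :: l) w.
  by rewrite !lincomb_cons /= mulrDl addrA.
have ls : all (fun p : R * R => 0 <= p.2 <= s) ((c + c', s) :: l).
  rewrite /= s0 lexx /=; apply/allP => p pl; rewrite (allP l0)//=.
  have /allP := order_path_min (fun _ _ _ h1 h2 => le_trans h2 h1) srt.
  by apply.
under eq_Rintegral do rewrite (step Z s) glue.
under [RHS]eq_Rintegral do rewrite (step Z' s) glue.
rewrite T// T'//; congr (_ * _); apply: IH => //=; last by rewrite s0.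
by case: (l) srt.
Qed.

Lemma exponent_process_fdd P psi Z Z' l b : exponent_process P psi Z ->
  exponent_process P psi Z' -> all (fun p => 0 <= p.2) l ->
  \int[P]_w cos (lincomb Z l w + b) = \int[P]_w cos (lincomb Z' l w + b).
Proof.
move=> eZ eZ' l0; pose r := fun p q : R * R => q.2 <= p.2.
have pl : perm_eq l (sort r l) by rewrite perm_sym perm_sort.
under eq_Rintegral do rewrite (lincomb_perm _ _ pl).
under [RHS]eq_Rintegral do rewrite (lincomb_perm _ _ pl).
apply: (exponent_process_fdd_sorted b eZ eZ').
  by apply: sort_sorted => p q; exact: le_total.
by rewrite -(perm_all _ pl).
Qed.

End linear_combinations.

(** * Joint measurability and characteristic exponent of a stable process *)

Section stable_is_exponent_process.
Context (R : realType) d (Omega : measurableType d) (P : probability Omega R).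
Variables (F : R -> set (set Omega)) (alpha : R) (X : R -> Omega -> R).
Hypotheses (F_complete : is_complete_filtration P F)
  (X_stable : is_symmetric_stable_process P F alpha X).

Let X0 w : X 0 w = 0. Proof. by case: X_stable. Qed.

Let sF t : 0 <= t -> sigma_algebra setT (F t).
Proof. by case: F_complete => -[sF _ _] _ _; exact: sF. Qed.

Let Fm t : 0 <= t -> F t `<=` measurable.
Proof. by case: F_complete => -[_ Fm _] _ _; exact: Fm. Qed.

Let F_mono s t : 0 <= s -> s <= t -> F s `<=` F t.
Proof. by case: F_complete => -[_ _ mono] _ _; exact: mono. Qed.

Let X_adapted s t : 0 <= s -> s <= t -> measurable_wrt (F t) (X s).
Proof.
move=> s0 st B mB; apply: (F_mono s0 st).
by case: X_stable => a _ _ _; exact: a.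
Qed.

Let mX t : 0 <= t -> measurable_fun setT (X t).
Proof.
move=> t0 _ B mB; rewrite setTI; apply: (Fm t0).
exact: (X_adapted t0 (lexx t)).
Qed.

(** For [u >= 0], [step m u / m.+1] is the first point strictly to the right of [u] in the grid of
    mesh [1 / m.+1]; strictness is what a right limit requires. Right continuity then makes the
    process a pointwise limit of processes that are constant in time on each cell. *)
Let step (m : nat) (u : R) : nat :=
  if u < 0 then 0%N else (Num.trunc (m.+1%:R * u)).+1.

Let measurable_step m k : measurable [set u | step m u = k].
Proof.
case: k => [|k].
  rewrite (_ : [set _ | _] = `]-oo, 0[%classic) ?measurable_itv//.
  by apply/seteqP; split => u /=; rewrite in_itv/= /step; case: ifP.
rewrite (_ : [set _ | _] = `[k%:R / m.+1%:R, k.+1%:R / m.+1%:R[%classic) ?measurable_itv//.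
apply/seteqP; split => u /=; rewrite in_itv/= /step ler_pdivrMr// ltr_pdivlMr//.
  case: ifPn => //; rewrite -leNgt => u0 [<-]; rewrite ![u * _]mulrC.
  by apply: Num.Theory.truncn_itv; rewrite mulr_ge0.
rewrite ![u * _]mulrC => ku.
have u0 : 0 <= u.
  by have /andP[ku0 _] := ku; rewrite -(pmulr_rge0 _ (ltr0Sn R m)) (le_trans _ ku0).
by rewrite ltNge u0 /= (Num.Theory.truncn_def ku).
Qed.

(** The definition of a stable process leaves negative times free. Freezing them at time 0 makes
    joint measurability true on the whole line. *)
Let Z u w := X (Num.max 0 u) w.

Let measurable_Z : measurable_fun setT (fun z : Omega * R => Z z.2 z.1).
Proof.
apply: (@measurable_fun_cvg _ _ _ _
   (fun m z => X ((step m z.2)%:R / m.+1%:R) z.1)).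
  move=> m _ B mB; rewrite setTI.
  rewrite (_ : _ @^-1` _ = \bigcup_k
     ((X (k%:R / m.+1%:R) @^-1` B) `*` [set u | step m u = k])); last first.
    apply/seteqP; split => [[w u] /= Bwu|[w u] /= [k _ [/= BX ->]]//].
    by exists (step m u).
  apply: bigcupT_measurable => k; apply: measurableX => //.
  by rewrite -[X in measurable X]setTI; apply: mX => //; rewrite divr_ge0.
move=> [w u] _ /=; rewrite /Z; have [u0|u0] := ltP u 0.
  rewrite ?(max_idPl (ltW u0)); under eq_fun do rewrite /step u0 mul0r.
  exact: cvg_cst.
rewrite ?(max_idPr u0).
have /cvg_at_rightP : X s w @[s --> u^'+] --> X u w.
  by case: X_stable => _ /(_ w)[c _] _ _; exact: c.
have stepE m : step m u = (Num.trunc (m.+1%:R * u)).+1 by rewrite /step ltNge u0.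
apply; have itv m := Num.Theory.truncn_itv (mulr_ge0 (ler0n R m.+1) u0).
split=> [m|].
  rewrite stepE ltr_pdivlMr// mulrC.
  by case/andP: (itv m).
apply: (@squeeze_cvgr _ _ _ _ (fun=> u) (fun m => u + m.+1%:R^-1)).
- apply: nearW => m; rewrite stepE ler_pdivlMr// ler_pdivrMr//.
  have /andP[h1 h2] := itv m; rewrite mulrC ltW//= mulrDl mulVf// mulrC.
  by rewrite -natr1 lerD2r mulrC.
- exact: cvg_cst.
- by rewrite -[X in _ --> X]addr0; apply: cvgD; [exact: cvg_cst|exact: cvg_harmonic].
Qed.

Let ZE u w : 0 <= u -> Z u w = X u w.
Proof. by move=> u0; rewrite /Z (max_idPr u0). Qed.

Lemma stable_exponent_process :
  exponent_process P (fun c => `|c| `^ alpha) (fun u => X (Num.max 0 u)).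
Proof.
split; [exact: measurable_Z|by move=> w; rewrite maxxx|].
move=> l b c s t s0 st ls; rewrite -/Z.
have t0 := le_trans s0 st.
(* The conditional characteristic function is prescribed for [s < t] only; at equal times the
   increment and the exponent both vanish. *)
move: st; rewrite le_eqVlt => /predU1P[<-|st].
  rewrite subrr mul0r oppr0 expR0 mul1r; apply: eq_Rintegral => w _.
  by rewrite subrr mulr0 add0r.
have [[iY iZ _ ReE] [iY' _ _ ImE]] : is_complex_condexp P (F s)
    (fun w => expi (c * (X t w - X s w)))
    (fun=> (expR (- ((t - s) * `|c| `^ alpha)))%:C%C).
  by case: X_stable => _ _ _; exact.
pose e := expR (- ((t - s) * `|c| `^ alpha)).
have iY1 : Rintegrable P (fun w => cos (c * (X t w - X s w))) by exact: iY.
have iY2 : Rintegrable P (fun w => sin (c * (X t w - X s w))) by exact: iY'.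
pose V w := lincomb Z l w + b.
have GV : measurable_wrt (F s) V.
  apply: (measurable_wrtD (sF s0)); last exact: (measurable_wrt_cst (sF s0)).
  elim: l ls {V} => [|p l IH] /= ls.
    rewrite (_ : lincomb Z [::] = fun=> 0); last by apply/funext => w; rewrite lincomb_nil.
    exact: (measurable_wrt_cst (sF s0)).
  have /andP[/andP[p0 ps] ls'] := ls.
  rewrite (_ : lincomb Z _ = fun w => p.1 * Z p.2 w + lincomb Z l w); last first.
    by apply/funext => w; rewrite lincomb_cons.
  apply: (measurable_wrtD (sF s0)); last exact: IH.
  apply: (measurable_wrtM (sF s0)); rewrite (_ : Z p.2 = X p.2).
    exact: X_adapted.
  by apply/funext => w; rewrite ZE.
have mV : measurable_fun setT V.
  by move=> _ B mB; rewrite setTI; apply: (Fm s0); exact: GV.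
have H1 : \int[P]_w ((cos (c * (X t w - X s w)) - e) * cos (V w)) = 0.
  apply: (integral_orthogonal (sF s0) (M := 1) (Fm s0)).
  - by apply: RintegrableB => //; exact: Rintegrable_cst.
  - move=> A FA; rewrite RintegralB; first by rewrite -ReE// subrr.
    + exact: Fm FA.
    + by apply: integrableS iY1 => //; exact: Fm FA.
    + by apply: integrableS (Rintegrable_cst P e) => //; exact: Fm FA.
  - by apply: (measurable_wrt_continuous (sF s0)) => //; exact: continuous_cos.
  - by move=> w; rewrite ler_norml cos_geN1 cos_le1.
have H2 : \int[P]_w (sin (c * (X t w - X s w)) * sin (V w)) = 0.
  apply: (integral_orthogonal (sF s0) (M := 1) (Fm s0)) => //.
  - move=> A FA; rewrite -ImE//=; rewrite Rintegral_cst ?mul0r//; exact: Fm FA.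
  - by apply: (measurable_wrt_continuous (sF s0)) => //; exact: continuous_sin.
  - by move=> w; rewrite ler_norml sin_geN1 sin_le1.
have mXs := mX s0; have mXt := mX t0.
have bc (g : Omega -> R) : measurable_fun setT g -> (forall w, `|g w| <= 2) ->
    Rintegrable P g.
  by move=> mg g2; exact: (@Rintegrable_bounded _ _ _ _ _ 2).
have c1 x : `|cos x| <= 1 :> R by rewrite ler_norml cos_geN1 cos_le1.
have s1 x : `|sin x| <= 1 :> R by rewrite ler_norml sin_geN1 sin_le1.
have e1 : `|e| <= 1.
  rewrite ger0_norm ?expR_ge0// -expR0 ler_expR lerNl oppr0 mulr_ge0 ?powR_ge0//.
  by rewrite subr_ge0 ltW.
(* Addition formula for the cosine, with [e * cos (V w)] subtracted and added back. The first term
   integrates to 0 by the real part of the conditional characteristic function, the second by its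
   imaginary part, which is 0. *)
transitivity (\int[P]_w ((cos (c * (X t w - X s w)) - e) * cos (V w)
   - sin (c * (X t w - X s w)) * sin (V w) + e * cos (V w))).
  by apply: eq_Rintegral => w _; rewrite (max_idPr t0) (max_idPr s0) -addrA -/(V w) cosD; ring.
have i1 : Rintegrable P (fun w => (cos (c * (X t w - X s w)) - e) * cos (V w)).
  apply: bc => [|w]; first by mfun.
  rewrite normrM -[leRHS]mulr1 ler_pM// (le_trans (ler_normB _ _))//.
  by rewrite (_ : 2 = 1 + 1)// lerD.
have i2 : Rintegrable P (fun w => sin (c * (X t w - X s w)) * sin (V w)).
  apply: bc => [|w]; first by mfun.
  by rewrite normrM -[leRHS]mulr1 ler_pM// (le_trans (s1 _))// ler1n.
have i3 : Rintegrable P (fun w => cos (V w)).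
  by apply: bc => [|w]; [mfun|rewrite (le_trans (c1 _))// ler1n].
rewrite RintegralDT; [|exact: RintegrableB|exact: RintegrableM].
by rewrite RintegralBT// H1 H2 subrr add0r RintegralM.
Qed.

End stable_is_exponent_process.

(** * Second moment of the Fourier transform of the occupation measure *)

Section four_times.
Context (R : realType) d (Omega : measurableType d) (P : probability Omega R).
Variables (psi : R -> R) (Z : R -> Omega -> R).
Hypotheses (eZ : exponent_process P psi Z) (psi0 : forall c, 0 <= psi c)
  (psiN : forall c, psi (- c) = psi c).
Variable xi : R.

Definition exp_dist (kappa x y : R) := expR (- (kappa * `|x - y|)).

(** One term for each way of pairing four times. For sorted times a single term bounds the
    expectation; the sum over all pairings is symmetric in the times, which permits the reduction to
    the sorted case. *)
Definition pairings (kappa x1 x2 x3 x4 : R) :=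
  exp_dist kappa x1 x2 * exp_dist kappa x3 x4 +
  exp_dist kappa x1 x3 * exp_dist kappa x2 x4 +
  exp_dist kappa x1 x4 * exp_dist kappa x2 x3.

Lemma exp_distC kappa x y : exp_dist kappa x y = exp_dist kappa y x.
Proof. by rewrite /exp_dist distrC. Qed.

Lemma exp_dist_ge0 kappa x y : 0 <= exp_dist kappa x y.
Proof. exact: expR_ge0. Qed.

Lemma exp_dist_le1 kappa x y : 0 <= kappa -> exp_dist kappa x y <= 1.
Proof. by move=> k0; rewrite -expR0 ler_expR lerNl oppr0 mulr_ge0. Qed.

Local Notation k := (exp_dist (psi xi)).

(** Arbitrary signs with sum 0 are allowed so that the bound is preserved when two neighbouring
    terms are exchanged. *)
Let Q (p1 p2 p3 p4 : R * R) : Prop :=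
  (forall p, p \in [:: p1; p2; p3; p4] -> (p.1 = xi \/ p.1 = - xi) /\ 0 <= p.2) ->
  p1.1 + p2.1 + p3.1 + p4.1 = 0 ->
  `|\int[P]_w cos (lincomb Z [:: p1; p2; p3; p4] w + 0)| <=
  pairings (psi xi) p1.2 p2.2 p3.2 p4.2.

Let Q12 p1 p2 p3 p4 : Q p1 p2 p3 p4 -> Q p2 p1 p3 p4.
Proof.
move=> q h s.
have pm : perm_eq [:: p2; p1; p3; p4] [:: p1; p2; p3; p4].
  by rewrite -cat1s -(cat1s p1) catA -[X in perm_eq _ X](cat1s p1)
    -(cat1s p2 [:: p3; p4]) catA perm_cat2r perm_catC.
under eq_Rintegral do rewrite (lincomb_perm _ _ pm).
apply: le_trans (q _ _) _.
- by move=> p; rewrite -(perm_mem pm); exact: h.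
- by rewrite -s; ring.
- by rewrite /pairings (exp_distC _ p2.2 p1.2); lra.
Qed.

Let Q23 p1 p2 p3 p4 : Q p1 p2 p3 p4 -> Q p1 p3 p2 p4.
Proof.
move=> q h s.
have pm : perm_eq [:: p1; p3; p2; p4] [:: p1; p2; p3; p4].
  by rewrite perm_cons -cat1s -(cat1s p2) catA -[X in perm_eq _ X](cat1s p2)
    -(cat1s p3 [:: p4]) catA perm_cat2r perm_catC.
under eq_Rintegral do rewrite (lincomb_perm _ _ pm).
apply: le_trans (q _ _) _.
- by move=> p; rewrite -(perm_mem pm); exact: h.
- by rewrite -s; ring.
- by rewrite /pairings (exp_distC _ p3.2 p2.2); lra.
Qed.

Let Q34 p1 p2 p3 p4 : Q p1 p2 p3 p4 -> Q p1 p2 p4 p3.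
Proof.
move=> q h s.
have pm : perm_eq [:: p1; p2; p4; p3] [:: p1; p2; p3; p4].
  by rewrite !perm_cons -cat1s -[X in perm_eq _ X]cat1s perm_catC.
under eq_Rintegral do rewrite (lincomb_perm _ _ pm).
apply: le_trans (q _ _) _.
- by move=> p; rewrite -(perm_mem pm); exact: h.
- by rewrite -s; ring.
- by rewrite /pairings (exp_distC _ p4.2 p3.2); lra.
Qed.

(* In decreasing order of time the first and the third gap carry the exponent
   [psi xi]; the second one carries a nonnegative exponent and is dropped. *)
Let Q_sorted p1 p2 p3 p4 : p2.2 <= p1.2 -> p3.2 <= p2.2 -> p4.2 <= p3.2 ->
  Q p1 p2 p3 p4.
Proof.
case: p1 p2 p3 p4 => [c1 x1] [c2 x2] [c3 x3] [c4 x4] /= x21 x32 x43 h /= s.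
have [[h1 _] [h4 x40]] : ((c1 = xi \/ c1 = - xi) /\ 0 <= x1) /\
    ((c4 = xi \/ c4 = - xi) /\ 0 <= x4).
  by split; [apply: (h (c1, x1))|apply: (h (c4, x4))]; rewrite !inE eqxx ?orbT.
have x30 := le_trans x40 x43; have x20 := le_trans x30 x32.
have p1E : psi c1 = psi xi by case: h1 => ->; rewrite ?psiN.
have p4E : psi (c1 + c2 + c3) = psi xi.
  rewrite (_ : c1 + c2 + c3 = - c4); last by lra.
  by case: h4 => ->; rewrite ?opprK ?psiN.
have [_ _ T] := eZ.
have E1 : \int[P]_w cos (lincomb Z [:: (c1, x1); (c2, x2); (c3, x3); (c4, x4)] w + 0) =
    expR (- ((x1 - x2) * psi xi)) * (expR (- ((x2 - x3) * psi (c1 + c2))) *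
      expR (- ((x3 - x4) * psi xi))).
  transitivity (\int[P]_w cos (c1 * (Z x1 w - Z x2 w) +
      lincomb Z [:: (c1 + c2, x2); (c3, x3); (c4, x4)] w + 0)).
    by apply: eq_Rintegral => w _; rewrite !lincomb_cons /=; congr cos; ring.
  rewrite T//= ?p1E; last by rewrite lexx x20 x30 x32 x40 (le_trans x43).
  congr (_ * _).
  transitivity (\int[P]_w cos ((c1 + c2) * (Z x2 w - Z x3 w) +
      lincomb Z [:: (c1 + c2 + c3, x3); (c4, x4)] w + 0)).
    by apply: eq_Rintegral => w _; rewrite !lincomb_cons /=; congr cos; ring.
  rewrite T//=; last by rewrite lexx x30 x40 x43.
  congr (_ * _).
  transitivity (\int[P]_w cos ((c1 + c2 + c3) * (Z x3 w - Z x4 w) +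
      lincomb Z [:: (c1 + c2 + c3 + c4, x4)] w + 0)).
    by apply: eq_Rintegral => w _; rewrite !lincomb_cons /=; congr cos; ring.
  rewrite T//= ?p4E; last by rewrite lexx x40.
  rewrite s -[RHS]mulr1; congr (_ * _).
  under eq_Rintegral do rewrite lincomb_cons lincomb_nil mul0r !addr0 cos0.
  rewrite Rintegral_cst// mul1r -[X in fine X]/(P setT) probability_setT//.
rewrite E1 ger0_norm ?mulr_ge0 ?expR_ge0//.
apply: (@le_trans _ _ (k x1 x2 * k x3 x4)).
  rewrite /exp_dist !ger0_norm ?subr_ge0// !(mulrC (psi xi)).
  rewrite ler_wpM2l ?expR_ge0// ler_piMl ?expR_ge0//.
  by rewrite -expR0 ler_expR lerNl oppr0 mulr_ge0// subr_ge0.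
by rewrite /pairings -addrA lerDl addr_ge0// mulr_ge0// exp_dist_ge0.
Qed.

(** Insertion sort by exchanges of neighbours: [S1] inserts the first time into a sorted triple,
    [S2] the second one into a sorted pair. *)
Let Q_all p1 p2 p3 p4 : Q p1 p2 p3 p4.
Proof.
have S1 a b c e : e.2 <= c.2 -> c.2 <= b.2 -> Q a b c e.
  move=> ec cb; have [ba|ab] := leP b.2 a.2; first exact: Q_sorted.
  have {}ab := ltW ab; apply: Q12.
  have [ca|ac] := leP c.2 a.2; first exact: Q_sorted.
  have {}ac := ltW ac; apply: Q23.
  have [ea|ae] := leP e.2 a.2; first exact: Q_sorted.
  by have {}ae := ltW ae; apply: Q34; exact: Q_sorted.
have S2 a b c e : e.2 <= c.2 -> Q a b c e.
  move=> ec; have [cb|bc] := leP c.2 b.2; first exact: S1.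
  have {}bc := ltW bc; apply: Q23.
  have [eb|be] := leP e.2 b.2; first exact: S1.
  by have {}be := ltW be; apply: Q34; exact: S1.
have [p43|p34] := leP p4.2 p3.2; first exact: S2.
by have {}p34 := ltW p34; apply: Q34; exact: S2.
Qed.

Lemma four_times_bound x1 x2 x3 x4 : 0 <= x1 -> 0 <= x2 -> 0 <= x3 -> 0 <= x4 ->
  `|\int[P]_w cos (xi * ((Z x2 w - Z x1 w) - (Z x4 w - Z x3 w)))| <=
  pairings (psi xi) x1 x2 x3 x4.
Proof.
move=> x10 x20 x30 x40.
have := @Q_all (- xi, x1) (xi, x2) (xi, x3) (- xi, x4).
rewrite /Q /= => H.
have -> : \int[P]_w cos (xi * ((Z x2 w - Z x1 w) - (Z x4 w - Z x3 w))) =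
    \int[P]_w cos (lincomb Z [:: (- xi, x1); (xi, x2); (xi, x3); (- xi, x4)] w + 0).
  by apply: eq_Rintegral => w _; rewrite !lincomb_cons lincomb_nil /=; congr cos; ring.
apply: H; last by ring.
by move=> p; rewrite !inE => /or4P[] /eqP -> /=; split => //; [right|left|left|right].
Qed.

End four_times.

Section restricted_measure.
Context d (T : measurableType d) (R : realType).
Variables (mu : {measure set T -> \bar R}) (D : set T) (mD : measurable D)
  (Doo : (mu D < +oo)%E).

Lemma Rintegral_mfrestr (f : T -> R) : Rintegrable (mfrestr mD Doo) f ->
  \int[mfrestr mD Doo]_x f x = \int[mu]_(x in D) f x.
Proof.
move=> fi; have mDC : measurable (~` D) by exact: measurableC.
rewrite -(setvU D) Rintegral_setU//; last by rewrite disj_set2E setICl.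
  rewrite [X in X + _]/Rintegral null_set_integral//.
  - rewrite add0r /Rintegral; congr fine; apply: eq_measure_integral => A mA AD.
    by rewrite /mfrestr /mrestr; congr (mu _); apply/setIidPl.
  - by apply/measurable_EFinP; apply: measurable_funTS; exact: Rintegrable_measurable fi.
  - by rewrite -[LHS]/(mu (~` D `&` D)) setICl measure0.
by rewrite setvU.
Qed.

End restricted_measure.

Section exp_dist_integral.
Context (R : realType).
Notation lambda := (@lebesgue_measure R).
Implicit Types kappa x y : R.

Lemma measurable_exp_dist kappa d (T : measurableType d) (f g : T -> R) :
  measurable_fun setT f -> measurable_fun setT g ->
  measurable_fun setT (fun z => exp_dist kappa (f z) (g z)).
Proof. by move=> mf mg; rewrite /exp_dist; mfun. Qed.

(** After a translation and by symmetry, twice the integral over the half line, itself [kappa^-1]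
    times the total mass of the exponential density. *)
Lemma exp_dist_integral kappa x : 0 < kappa ->
  Rintegrable lambda (exp_dist kappa x) /\ \int[lambda]_y exp_dist kappa x y = 2 / kappa.
Proof.
move=> k0; pose g y : R := expR (- (kappa * `|y|)).
have g0 y : 0 <= g y by exact: expR_ge0.
have mg : measurable_fun setT g by rewrite /g; mfun.
have cg : continuous g.
  move=> y; apply: continuous_cvg; first exact: continuous_expR.
  by apply: cvgN; apply: cvgM; [exact: cvg_cst|exact: norm_continuous].
have Eg : (\int[lambda]_y (g y)%:E = (2 / kappa)%:E)%E.
  rewrite ge0_symfun_integralT//; last by move=> y; rewrite /g /= normrN.
  rewrite EFinM; congr *%E.
  have -> : [set y : R | 0 <= y] = `[0, +oo[%classic.
    by apply/seteqP; split => y /=; rewrite in_itv/= andbT.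
  have H := integral_exponential_pdf k0.
  have e0 y : (0 <= (exponential_pdf kappa y)%:E)%E.
    by rewrite lee_fin exponential_pdf_ge0// ltW.
  transitivity (\int[lambda]_(y in `[0%R, +oo[%classic) ((kappa^-1)%:E * (exponential_pdf kappa y)%:E))%E.
    apply: eq_integral => y; rewrite inE/= in_itv/= andbT => y0.
    rewrite exponential_pdfE// -EFinM mulKf ?gt_eqF//.
    by rewrite /g ger0_norm// mulNr.
  rewrite ge0_integralZl//.
  - rewrite integral_mkcond.
    rewrite (_ : _ \_ _ = fun y => (exponential_pdf kappa y)%:E); last first.
      apply/funext => y; rewrite patchE; case: ifPn => //.
      rewrite notin_setE/= in_itv/= andbT => /negP h.
      by rewrite -[LHS]/(0%:E) /exponential_pdf patchE ifF//; apply/negbTE; rewrite notin_setE/= in_itv/= andbT; apply/negP.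
    by rewrite H mule1.
  - apply/measurable_EFinP; apply: measurable_funTS.
    exact: measurable_exponential_pdf.
  - by rewrite lee_fin invr_ge0 ltW.
have ig : Rintegrable lambda g.
  apply/integrableP; split; first by apply/measurable_EFinP; exact: mfun_ofRL.
  by under eq_integral do rewrite /= ger0_norm//; rewrite Eg ltry.
have [ih Eh] := Rintegral_affine (- x) ltr01 ig.
have E y : exp_dist kappa x y = g (1 * y - x) by rewrite /exp_dist /g mul1r distrC.
rewrite (_ : exp_dist kappa x = fun y => g (1 * y - x)); last exact/funext.
by split => //; rewrite Eh invr1 mul1r /Rintegral Eg.
Qed.

End exp_dist_integral.

Section triangle_measure.
Context (R : realType).
Notation lambda := (@lebesgue_measure R).
Notation RL := (measurableTypeR R).

(** The domain of integration in [approx_silt]; the first coordinate is the earlier time. *)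
Definition triangle (t : R) : set (RL * RL) :=
  [set p | 0 < p.1 /\ p.1 < p.2 /\ p.2 < t].

Lemma measurable_triangle t : measurable (triangle t).
Proof.
rewrite (_ : triangle t = [set p | [&& 0 < p.1 :> R, p.1 < p.2 :> R & p.2 < t :> R]]).
  rewrite -[X in measurable X]setTI.
  have m1 : @measurable_fun _ _ (RL * RL)%type R setT fst by exact: (mfunRL measurable_fst).
  have m2 : @measurable_fun _ _ (RL * RL)%type R setT snd by exact: (mfunRL measurable_snd).
  have mf : measurable_fun setT
      (fun p : RL * RL => [&& 0 < p.1 :> R, p.1 < p.2 :> R & p.2 < t :> R]).
    apply: measurable_and; first exact: measurable_fun_ltr.
    by apply: measurable_and; exact: measurable_fun_ltr.
  have m := mf measurableT [set true] I.
  by move: m; congr (measurable (_ `&` _)); apply/seteqP; split.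
by apply/seteqP; split => p /=; [move=> [-> [-> ->]]|move=> /and3P[]].
Qed.

Let square (t : R) : set (RL * RL) := `[0, t]%classic `*` `[0, t]%classic.

Let triangle_square t : triangle t `<=` square t.
Proof.
move=> [x y] [/= x0 [xy yt]]; split; rewrite /= in_itv/=.
  by rewrite ltW//= ltW// (lt_trans xy).
by rewrite !ltW// (lt_trans x0).
Qed.

Lemma triangle_lty t : ((lambda \x lambda)%E (triangle t) < +oo)%E.
Proof.
apply: (@le_lt_trans _ _ ((lambda \x lambda)%E (square t))).
  apply: le_measure; rewrite ?inE//; first exact: measurable_triangle.
  by apply: measurableX; exact: measurable_itv.
rewrite /square product_measure1E; try exact: measurable_itv.
have h : (lambda `[0%R, t]%classic < +oo)%E; last first.
  by apply: lte_mul_pinfty => //; rewrite ge0_fin_numE.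
by rewrite lebesgue_measure_itv/= lte_fin; case: ifP => _; rewrite ?ltry// -EFinB ltry.
Qed.

Lemma triangle_mass t : 0 <= t -> fine ((lambda \x lambda)%E (triangle t)) <= t ^+ 2.
Proof.
move=> t0.
have sq : ((lambda \x lambda)%E (square t) = (t ^+ 2)%:E)%E.
  rewrite /square product_measure1E; try exact: measurable_itv.
  have h : (lambda `[0%R, t]%classic = t%:E)%E; last first.
    by rewrite expr2 EFinM; congr (_ * _)%E; exact: h.
  rewrite lebesgue_measure_itv/= lte_fin; case: ltP => [_|t0']; first by rewrite sube0.
  by congr EFin; apply/eqP; rewrite eq_le t0 t0'.
rewrite -lee_fin fineK; last by rewrite ge0_fin_numE//; exact: triangle_lty.
rewrite -sq; apply: le_measure; rewrite ?inE//; first exact: measurable_triangle.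
by apply: measurableX; exact: measurable_itv.
Qed.

(** A finite measure on the whole plane rather than integrals over a domain, so that the Fourier and
    Fubini results apply directly. *)
Definition triangle_measure t : {finite_measure set (RL * RL)%type -> \bar R} :=
  mfrestr (measurable_triangle t) (triangle_lty t).

Lemma triangle_measure_setT t : 0 <= t -> fine (triangle_measure t setT) <= t ^+ 2.
Proof.
by move=> t0; rewrite /triangle_measure /= /mfrestr /mrestr setTI; exact: triangle_mass.
Qed.

Let ind t (x : R) : R := \1_(`[0, t]%classic) x.

(** For a nonnegative integrand the triangle may be enlarged to the strip [0 <= x <= t], on which
    the inner integral runs over the whole line and is explicit in the applications. *)
Lemma triangle_measure_le t (g : RL * RL -> R) (b : R -> R) :
  measurable_fun setT g -> (forall p, 0 <= g p) ->
  (forall x, Rintegrable lambda (fun y => g (x, y))) ->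
  (forall x, 0 <= x <= t -> \int[lambda]_y g (x, y) <= b x) ->
  (forall x, 0 <= b x) -> Rintegrable lambda b ->
  Rintegrable (triangle_measure t) g ->
  \int[triangle_measure t]_p g p <= \int[lambda]_x b x.
Proof.
move=> mg g0 ig gb b0 ib igt; rewrite Rintegral_mfrestr//.
pose h (p : RL * RL) := ind t p.1 * g p.
have mi : measurable_fun setT (ind t : R -> R) by exact: measurable_indic.
have mh : measurable_fun setT h.
  by apply: mfunM => //; apply: mfun_fst; exact: mfun_ofRL.
have i0 x : 0 <= ind t x by rewrite /ind indicE.
have ih x : Rintegrable lambda (fun y => h (x, y)) by exact: (RintegrableM (ind t x) (ig x)).
have hb x : \int[lambda]_y h (x, y) <= b x.
  rewrite /h /= RintegralM// /ind indicE mem_setE in_itv/=.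
  by case: (boolP (0 <= x <= t)) => [/gb|_]; rewrite ?mul1r ?mul0r.
have h0 p : 0 <= h p by rewrite mulr_ge0.
have ihp : Rintegrable (lambda \x lambda)%E h.
  apply: (@Rintegrable_prodP _ _ _ _ _ lambda lambda h b) => // x.
  by under eq_Rintegral do rewrite ger0_norm//.
apply: (@le_trans _ _ (\int[(lambda \x lambda)%E]_p h p)).
  rewrite Rintegral_mkcond; apply: le_RintegralT => //.
  - apply: Rintegrable_le ihp _; first by apply/(measurable_restrictT _ _).1;
      [exact: measurable_triangle|exact: measurable_funTS].
    move=> p; rewrite patchE; case: ifPn => [|_]; last by rewrite normr0.
    rewrite inE => /triangle_square[] /=; rewrite in_itv/= => p1 _.
    by rewrite ger0_norm// /h /ind indicE mem_setE in_itv/= p1 mul1r.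
  - move=> p; rewrite patchE; case: ifPn => [|_]; last exact: h0.
    rewrite inE => /triangle_square[] /=; rewrite in_itv/= => p1 _.
    by rewrite /h /ind indicE mem_setE in_itv/= p1 mul1r.
rewrite Rintegral_prod//; apply: le_RintegralT => //.
exact: (Rintegrable_fubiniF ihp ih).
Qed.

End triangle_measure.

Section pairings_integral.
Context (R : realType).
Notation lambda := (@lebesgue_measure R).
Notation RL := (measurableTypeR R).
Variables (t kappa : R).
Hypotheses (t0 : 0 <= t) (k0 : 0 < kappa).
Local Notation tri := (triangle_measure t).
Local Notation k := (exp_dist kappa).
Let J : R := 2 / kappa.

Let J0 : 0 <= J. Proof. by rewrite divr_ge0// ltW. Qed.
Let ik x : Rintegrable lambda (k x). Proof. by have [] := exp_dist_integral x k0. Qed.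
Let kJ x : \int[lambda]_y k x y = J. Proof. by have [] := exp_dist_integral x k0. Qed.
Let k1 x y : k x y <= 1. Proof. by rewrite exp_dist_le1// ltW. Qed.
Let kk1 x y z u : k x y * k z u <= 1.
Proof. by rewrite -[leRHS]mulr1 ler_pM// exp_dist_ge0. Qed.
Let kk0 x y z u : 0 <= k x y * k z u. Proof. by rewrite mulr_ge0// exp_dist_ge0. Qed.

Let mk1 x : measurable_fun setT (fun p : RL * RL => k x p.1).
Proof. by apply: measurable_exp_dist => //; mfun. Qed.
Let mk2 x : measurable_fun setT (fun p : RL * RL => k x p.2).
Proof. by apply: measurable_exp_dist => //; mfun. Qed.
Let mk12 : measurable_fun setT (fun p : RL * RL => k p.1 p.2).
Proof. by apply: measurable_exp_dist => //; mfun. Qed.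

Let ibd (g : RL * RL -> R) : measurable_fun setT g -> (forall p, 0 <= g p <= 1) ->
  Rintegrable tri g.
Proof.
move=> mg g01; apply: (@Rintegrable_bounded _ _ _ _ _ 1) => // p.
by have /andP[h1 h2] := g01 p; rewrite ger0_norm.
Qed.

Let gap_le : \int[tri]_p k p.1 p.2 <= t * J.
Proof.
have E : \int[lambda]_x (J * \1_(`[0, t]%classic) x) = t * J.
  rewrite RintegralM; last exact: integrable_indic_itv.
  rewrite mulrC; congr (_ * _); rewrite /Rintegral (integral_indic lambda)// setIT.
  rewrite -[X in fine X]/(lambda `[0, t]%classic) lebesgue_measure_itv/= lte_fin.
  case: ltP => [_|t0'] /=; first by rewrite subr0.
  by apply/eqP; rewrite eq_le t0 t0'.
rewrite -E; apply: triangle_measure_le => //.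
- by move=> p; exact: exp_dist_ge0.
- by move=> x /= xt; rewrite kJ indicE mem_setE in_itv/= xt mulr1.
- by move=> x; rewrite mulr_ge0.
- by apply: RintegrableM; exact: integrable_indic_itv.
- by apply: ibd => // p; rewrite exp_dist_ge0 k1.
Qed.

Let cross_le x y : \int[tri]_p (k x p.1 * k y p.2) <= J ^+ 2.
Proof.
have E : \int[lambda]_u (J * k x u) = J ^+ 2 by rewrite RintegralM// kJ.
rewrite -E; apply: triangle_measure_le => //.
- exact: mfunM.
- by move=> u /=; apply: RintegrableM.
- by move=> u _ /=; rewrite RintegralM// kJ mulrC.
- by move=> u; rewrite mulr_ge0// exp_dist_ge0.
- exact: RintegrableM.
- by apply: ibd => [|p]; [exact: mfunM|rewrite kk0 kk1].
Qed.

Lemma measurable_pairings d (T : measurableType d) (f1 f2 f3 f4 : T -> R) :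
  measurable_fun setT f1 -> measurable_fun setT f2 -> measurable_fun setT f3 ->
  measurable_fun setT f4 ->
  measurable_fun setT (fun z => pairings kappa (f1 z) (f2 z) (f3 z) (f4 z)).
Proof.
move=> m1 m2 m3 m4; rewrite /pairings.
by repeat (first [apply: mfunD|apply: mfunM|apply: measurable_exp_dist]).
Qed.

Lemma pairings_ge0 x1 x2 x3 x4 : 0 <= pairings kappa x1 x2 x3 x4.
Proof. by rewrite /pairings !addr_ge0. Qed.

Lemma pairings_le3 x1 x2 x3 x4 : pairings kappa x1 x2 x3 x4 <= 3.
Proof. by rewrite /pairings (_ : 3 = 1 + 1 + 1 :> R) ?lerD//; ring. Qed.

(** Pairing the two times within each increment contributes at most [(t * J)^2]. Each of the two
    crossed pairings contributes at most [J^2] times the mass of the triangle, itself at most [t^2].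
    With [J = 2 / kappa], the total [3 * t^2 * J^2] explains the 12. *)
Lemma pairings_integral_le :
  \int[tri]_p \int[tri]_q pairings kappa p.1 p.2 q.1 q.2 <= 12 * t ^+ 2 / kappa ^+ 2.
Proof.
have inner (p : RL * RL) : \int[tri]_q pairings kappa p.1 p.2 q.1 q.2 <=
    k p.1 p.2 * (t * J) + 2 * J ^+ 2.
  have i1 : Rintegrable tri (fun q => k p.1 p.2 * k q.1 q.2).
    by apply: RintegrableM; apply: ibd => // q; rewrite exp_dist_ge0 k1.
  have i2 : Rintegrable tri (fun q => k p.1 q.1 * k p.2 q.2).
    by apply: ibd => [|q]; [exact: mfunM|rewrite kk0 kk1].
  have i3 : Rintegrable tri (fun q => k p.1 q.2 * k p.2 q.1).
    by apply: ibd => [|q]; [exact: mfunM|rewrite kk0 kk1].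
  rewrite /pairings RintegralDT//; last exact: RintegrableD.
  rewrite RintegralDT//; apply: (@le_trans _ _ (k p.1 p.2 * (t * J) + J ^+ 2 + J ^+ 2)).
    apply: lerD; last by under eq_Rintegral do rewrite mulrC; exact: cross_le.
    apply: lerD; last exact: cross_le.
    rewrite RintegralM//; last by apply: ibd => // q; rewrite exp_dist_ge0 k1.
    by rewrite ler_wpM2l ?exp_dist_ge0.
  by rewrite -addrA -mulr2n mulr_natl.
have mP : measurable_fun setT (fun p : RL * RL =>
    \int[tri]_q pairings kappa p.1 p.2 q.1 q.2).
  apply: (@measurable_RintegralF _ _ _ _ _ tri
    (fun z : (RL * RL) * (RL * RL) => pairings kappa z.1.1 z.1.2 z.2.1 z.2.2)).
  apply: measurable_pairings.
  - exact: (mfun_fst (mfunRL measurable_fst)).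
  - exact: (mfun_fst (mfunRL measurable_snd)).
  - exact: (mfun_snd (mfunRL measurable_fst)).
  - exact: (mfun_snd (mfunRL measurable_snd)).
have ik12 : Rintegrable tri (fun p => k p.1 p.2).
  by apply: ibd => // p; rewrite exp_dist_ge0 k1.
apply: (@le_trans _ _ (\int[tri]_p ((t * J) * k p.1 p.2 + 2 * J ^+ 2))).
  apply: le_RintegralT.
  - apply: (@Rintegrable_bounded _ _ _ _ _ (t * J + 2 * J ^+ 2)) => // p.
    rewrite ger0_norm; last by apply: Rintegral_ge0 => q _; exact: pairings_ge0.
    apply: (le_trans (inner p)); by rewrite lerD2r ler_piMl// mulr_ge0.
  - apply: RintegrableD; last exact: Rintegrable_cst.
    exact: (RintegrableM (t * J) ik12).
  - by move=> p; rewrite [t * J * _]mulrC.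
rewrite RintegralDT; [|exact: RintegrableM|exact: Rintegrable_cst].
rewrite RintegralM// Rintegral_cst//.
apply: (@le_trans _ _ (t * J * (t * J) + 2 * J ^+ 2 * t ^+ 2)).
  apply: lerD; first by rewrite ler_wpM2l// mulr_ge0.
  apply: ler_wpM2l; first by rewrite mulr_ge0// sqr_ge0.
  exact: triangle_measure_setT.
rewrite le_eqVlt; apply/orP; left; apply/eqP.
by rewrite /J; field; rewrite gt_eqF.
Qed.

End pairings_integral.

(** * From second moments to integrability in the frequency *)

Section weighted_second_moment.
Context (R : realType) d (Omega : measurableType d) (P : probability Omega R).
Notation lambda := (@lebesgue_measure R).
Notation RL := (measurableTypeR R).
Variables (C : RL * Omega -> R) (w : R -> R) (K M : R).
Hypotheses (mC : measurable_fun setT C) (CM : forall z, `|C z| <= M)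
  (w0 : forall xi, 0 < w xi) (iw : Rintegrable lambda w)
  (CK : forall xi, \int[P]_om (C (xi, om) ^+ 2) <= K * w xi ^+ 2).

Let mw : measurable_fun setT w. Proof. exact: Rintegrable_measurableR iw. Qed.

(** The moment bound makes [G] integrable jointly in frequency and outcome, with expectation at most
    [K * w] at each frequency, and [|C| <= G + w] then controls [C] itself. *)
Let G (z : RL * Omega) : R := (w z.1)^-1 * C z ^+ 2.

Let G0 z : 0 <= G z.
Proof. by rewrite mulr_ge0 ?sqr_ge0// invr_ge0 ltW. Qed.

Let mG : measurable_fun setT G.
Proof.
apply: mfunM; last by mfun.
have mwV : measurable_fun setT (fun xi => (w xi)^-1).
  have := measurableT_comp (@measurable_powR R (-1)) mw.
  by congr measurable_fun; apply/funext => xi; rewrite /= powR_inv1// ltW.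
exact: (mfun_fst (mfun_ofRL mwV)).
Qed.

Let CG xi om : `|C (xi, om)| <= G (xi, om) + w xi.
Proof.
have w0' := w0 xi; have c0 := normr_ge0 (C (xi, om)).
rewrite /G /= -[C _ ^+ 2]real_normK ?num_real//.
move: (`|_|) c0 (w xi) w0' => c c0 u u0.
rewrite -subr_ge0 (_ : _ - _ = u^-1 * (c ^+ 2 + u ^+ 2 - c * u)); last first.
  by field; rewrite gt_eqF.
by rewrite mulr_ge0 ?invr_ge0 ?(ltW u0)//; nra.
Qed.

Let iGP xi : Rintegrable P (fun om => G (xi, om)).
Proof.
apply: (RintegrableM (w xi)^-1); apply: (@Rintegrable_bounded _ _ _ _ _ (M ^+ 2)).
  by apply: mfunX; exact: measurable_pair1r mC.
by move=> om; rewrite normrX; apply: lerXn2r => //; rewrite nnegrE// (le_trans _ (CM (xi, om))).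
Qed.

Let GK xi : \int[P]_om G (xi, om) <= K * w xi.
Proof.
rewrite /G /= RintegralM; last first.
  by have := RintegrableM (w xi) (iGP xi); apply: eq_integrable => // om _;
    rewrite /= /G mulVKf ?gt_eqF.
by rewrite mulrC ler_pdivrMr// -mulrA -expr2.
Qed.

Let iG : Rintegrable (lambda \x P)%E G.
Proof.
apply: (@Rintegrable_prodP _ _ _ _ _ lambda P G (fun xi => K * w xi)) => //.
  move=> xi; by under eq_Rintegral do rewrite ger0_norm//.
exact: RintegrableM.
Qed.

Let ae_G : {ae P, forall om, Rintegrable lambda (fun xi => G (xi, om))}.
Proof. by apply: ae_integrable2 iG. Qed.

Lemma weighted_ae_integrable : {ae P, forall om, Rintegrable lambda (fun xi => C (xi, om))}.
Proof.
apply: filterS ae_G => om iGo.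
apply: Rintegrable_le (RintegrableD iGo iw) _ => [|xi]; last exact: CG.
exact: measurable_pair2r mC.
Qed.

(** Cauchy-Schwarz with weight [g * w] for almost every outcome, followed by Tonelli. The right-hand
    side is quadratic in the bound [A] on the integral of [g * w], so L^2 convergence follows when
    that integral tends to 0. *)
Lemma weighted_L2 (g : R -> R) (A : R) : measurable_fun setT g ->
  (forall xi, 0 <= g xi <= 1) -> 0 < A -> \int[lambda]_xi (g xi * w xi) <= A ->
  (\int[P]_om ((\int[lambda]_xi (g xi * C (xi, om))) ^+ 2)%:E <= (K * A ^+ 2)%:E)%E.
Proof.
move=> mg g01 A0 gA.
have g0 xi : 0 <= g xi by case/andP: (g01 xi).
have g1 xi : `|g xi| <= 1 by rewrite ger0_norm//; case/andP: (g01 xi).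
have igw : Rintegrable lambda (fun xi => g xi * w xi).
  by apply: (Rintegrable_boundedM (B := 1)).
pose H (z : RL * Omega) : \bar R := (A * (g z.1 * G z))%:E.
have mgG : measurable_fun setT (fun z : RL * Omega => g z.1 * G z).
  by apply: mfunM => //; exact: (mfun_fst (mfun_ofRL mg)).
have mH : measurable_fun setT H by apply/measurable_EFinP; exact: mfunM.
have H0 z : (0 <= H z)%E by rewrite lee_fin mulr_ge0 ?(ltW A0)// mulr_ge0.
apply: (@le_trans _ _ (\int[P]_om \int[lambda]_xi H (xi, om)))%E; last first.
  rewrite -(@fubini_tonelli _ _ _ _ _ lambda P)//.
  apply: (@le_trans _ _ (\int[lambda]_xi (A * (g xi * (K * w xi)))%:E))%E.
    apply: ge0_le_integral => //.
    - by move=> xi _; apply: integral_ge0.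
    - exact: measurable_fun_fubini_tonelli_F.
    - by apply/measurable_EFinP; apply: mfun_ofRL; mfun.
    move=> xi _; rewrite /H /=.
    rewrite -(EFin_Rintegral (RintegrableM A (RintegrableM (g xi) (iGP xi)))) lee_fin.
    rewrite !RintegralM//; last exact: RintegrableM.
    by rewrite ler_wpM2l ?(ltW A0)// ler_wpM2l.
  have i1 : Rintegrable lambda (fun xi => (A * K) * (g xi * w xi)) by exact: RintegrableM.
  have -> : (\int[lambda]_xi (A * (g xi * (K * w xi)))%:E =
      \int[lambda]_xi ((A * K) * (g xi * w xi))%:E)%E.
    by apply: eq_integral => xi _; congr EFin; ring.
  rewrite -(EFin_Rintegral i1) lee_fin RintegralM// expr2 mulrA [K * A]mulrC.
  apply: ler_wpM2l => //; apply: mulr_ge0; first exact: ltW.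
  (* Nonnegativity of [K] is read off the moment bound at frequency 0, where [w] is positive. *)
  have := le_trans (Rintegral_ge0 _ _) (GK 0).
  by rewrite pmulr_lge0//; apply => om _.
apply: ae_ge0_le_integral => //.
- by move=> om _; rewrite lee_fin sqr_ge0.
- apply/measurable_EFinP; apply: mfunX.
  apply: (@measurable_RintegralF _ _ _ _ _ lambda (fun z : Omega * RL => g z.2 * C (z.2, z.1))).
  apply: mfunM; first exact: (mfun_snd (mfun_ofRL mg)).
  apply: (measurableT_comp mC (_ : measurable_fun setT (fun z : Omega * RL => (z.2, z.1)))).
  by apply: measurable_fun_pair.
- by move=> om _; apply: integral_ge0.
- exact: measurable_fun_fubini_tonelli_G.
apply: filterS ae_G => om iGo _.
have iC : Rintegrable lambda (fun xi => C (xi, om)).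
  apply: Rintegrable_le (RintegrableD iGo iw) _ => [|xi]; last exact: CG.
  exact: measurable_pair2r mC.
have igG : Rintegrable lambda (fun xi => g xi * G (xi, om)).
  by apply: (Rintegrable_boundedM (B := 1)).
have igC : Rintegrable lambda (fun xi => g xi * C (xi, om)).
  by apply: (Rintegrable_boundedM (B := 1)).
rewrite /H /= -(EFin_Rintegral (RintegrableM A igG)) lee_fin RintegralM//.
set x := \int[lambda]_xi (g xi * C (xi, om)); set Q := \int[lambda]_xi (g xi * G (xi, om)).
set B := \int[lambda]_xi (g xi * w xi) in gA.
(* Expand [0 <= int g w (s - C / w)^2] at [s = x / A]. *)
pose s := x / A.
have : 0 <= \int[lambda]_xi (s ^+ 2 * (g xi * w xi) + ((- 2 * s) * (g xi * C (xi, om)) +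
    g xi * G (xi, om))).
  apply: Rintegral_ge0 => xi _; rewrite /G /=.
  rewrite (_ : _ + _ = g xi * w xi * (s - (w xi)^-1 * C (xi, om)) ^+ 2); last first.
    by field; rewrite gt_eqF.
  by rewrite mulr_ge0 ?sqr_ge0// mulr_ge0// ltW.
rewrite RintegralDT; [|exact: RintegrableM|by apply: RintegrableD => //; exact: RintegrableM].
rewrite RintegralDT; [|exact: RintegrableM|by []].
rewrite !RintegralM// -/x -/Q -/B => h.
have sA : s * A = x by rewrite /s divfK ?gt_eqF.
have : s ^+ 2 * B <= s ^+ 2 * A by rewrite ler_wpM2l ?sqr_ge0.
rewrite -sA in h *; nra.
Qed.

End weighted_second_moment.

Lemma powR_pinfty_cvg0 (R : realType) (a : R) : 0 < a -> x `^ (- a) @[x --> +oo] --> (0 : R).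
Proof.
move=> a0; apply/cvgrPdist_lt => e e0; near=> x.
rewrite sub0r normrN ger0_norm ?powR_ge0// powRN.
have ex : e^-1 `^ a^-1 < x by near: x; exact: nbhs_pinfty_gt.
have x0 : 0 < x := le_lt_trans (powR_ge0 _ _) ex.
rewrite invf_plt ?posrE ?powR_gt0//.
rewrite -[ltLHS]powRr1 ?invr_ge0 ?(ltW e0)// -(mulVf (lt0r_neq0 a0)) powRrM.
by apply: gt0_ltr_powR; rewrite // nnegrE ?powR_ge0// ltW.
Unshelve. all: by end_near.
Qed.

(** * Integrability of the frequency weight *)

Section stable_weight.
Context (R : realType).
Notation lambda := (@lebesgue_measure R).
Variables (alpha : R).
Hypothesis (alpha1 : 1 < alpha).

(** Square root of the decay [|xi|^(-2 alpha)] of the second moments, made regular at 0. It is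
    integrable thanks to [1 < alpha]. *)
Definition stable_weight (xi : R) : R := (1 + `|xi|) `^ (- alpha).

Let pos (xi : R) : 0 < 1 + `|xi|. Proof. by rewrite ltr_pwDl. Qed.

Lemma stable_weight_gt0 xi : 0 < stable_weight xi.
Proof. exact: powR_gt0. Qed.

Let continuous_powR_gt0 (a x : R) : 0 < x -> {for x, continuous (fun y => y `^ a)}.
Proof.
move=> x0; apply: differentiable_continuous; apply/derivable1_diffP.
by apply: derivable_powR; rewrite in_itv/= andbT.
Qed.

Lemma continuous_stable_weight : continuous stable_weight.
Proof.
move=> x; have h := @continuous_powR_gt0 (- alpha) _ (pos x).
apply: (@cvg_comp _ _ _ (fun y : R => 1 + `|y|) (fun y : R => y `^ (- alpha)) _ _ _ _ h).
by apply: cvgD; [exact: cvg_cst|exact: norm_continuous].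
Qed.

Lemma Rintegrable_stable_weight : Rintegrable lambda stable_weight.
Proof.
have w0 x : 0 <= stable_weight x by exact: ltW (stable_weight_gt0 x).
apply/integrableP; split.
  apply/measurable_EFinP; apply: mfun_ofRL.
  by apply: continuous_measurable_fun; exact: continuous_stable_weight.
under eq_integral do rewrite /= ger0_norm//.
rewrite ge0_symfun_integralT//; [|exact: continuous_stable_weight|]; last first.
  by move=> x; rewrite /stable_weight /= normrN.
have -> : [set y : R | 0 <= y] = `[0, +oo[%classic.
  by apply/seteqP; split => y /=; rewrite in_itv/= andbT.
(* The antiderivative of [f] that vanishes at infinity, because [1 - alpha] is negative. *)
pose F (x : R) := (1 - alpha)^-1 * (1 + x) `^ (1 - alpha).
pose f (x : R) := (1 + x) `^ (- alpha).
have dF (x : R) : 0 < 1 + x -> is_derive x 1 F (f x).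
  move=> x0; have d1 : is_derive x 1 (fun y : R => 1 + y) 1.
    have := is_deriveD (is_derive_cst (1 : R) x 1) (is_derive_id x 1).
    by rewrite add0r.
  have d2 := is_derive1_powR (1 - alpha) x0.
  have d3 := is_derive1_comp d2 d1.
  apply: (is_derive_eq (is_deriveZ (1 - alpha)^-1 d3)); rewrite /f mulr1.
  by rewrite /GRing.scale/= mulrA mulVf ?mul1r; [congr powR; ring|rewrite subr_eq0 lt_eqF].
have -> : (\int[lambda]_(x in `[0%R, +oo[%classic) (stable_weight x)%:E =
    \int[lambda]_(x in `[0%R, +oo[%classic) (f x)%:E)%E.
  apply: eq_integral; move=> x; rewrite inE/= in_itv/= andbT => x0; by rewrite /stable_weight ger0_norm.
rewrite (@ge0_continuous_FTC2y R f F 0 0).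
- by rewrite sub0e -EFinN -EFinM ltry.
- by move=> x x0; exact: powR_ge0.
- have cf x : 0 <= x -> {for x, continuous f}.
    move=> x0; have h : {for 1 + x, continuous (fun y => y `^ (- alpha))}.
      by apply: continuous_powR_gt0; lra.
    apply: (@cvg_comp _ _ _ (fun y : R => 1 + y) (fun y : R => y `^ (- alpha)) _ _ _ _ h).
    by apply: cvgD; [exact: cvg_cst|exact: cvg_id].
  apply/continuous_within_itvcyP; split.
    by move=> x; rewrite in_itv/= andbT => x0; apply: cf; exact: ltW.
  by apply: cvg_at_right_filter; exact: cf.
- rewrite -[X in _ --> X](mulr0 (1 - alpha)^-1); apply: cvgM; first exact: cvg_cst.
  have := powR_pinfty_cvg0 (_ : 0 < alpha - 1); rewrite subr_gt0 => /(_ alpha1).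
  rewrite opprB => /(@cvg_comp _ _ _ (fun x : R => 1 + x) _ +oo); apply.
  exact: cvg_addrl.
- by move=> x x0; apply: ex_derive; apply: dF; lra.
- apply: cvg_at_right_filter; apply: differentiable_continuous; apply/derivable1_diffP.
  by apply: ex_derive; apply: dF; lra.
- move=> x; rewrite in_itv/= andbT => x0.
  by rewrite derive1E; apply: derive_val; apply: dF; lra.
Qed.

End stable_weight.

Section restricted_measure_transfer.
Context d (T : measurableType d) (R : realType).
Variables (mu : {measure set T -> \bar R}) (D : set T) (mD : measurable D)
  (Doo : (mu D < +oo)%E).
Let nu := mfrestr mD Doo.
Implicit Types f g : T -> R.

Let Rintegral_support f : Rintegrable nu f -> \int[nu]_x f x = \int[nu]_(x in D) f x.
Proof.
move=> fi; rewrite [LHS]Rintegral_mfrestr// /Rintegral; congr fine.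
apply: eq_measure_integral => A mA AD.
by rewrite /nu /mfrestr /mrestr; congr (mu _); apply/esym/setIidPl.
Qed.

Lemma mfrestr_le_Rintegral f g : Rintegrable nu f -> Rintegrable nu g ->
  (forall x, D x -> f x <= g x) -> \int[nu]_x f x <= \int[nu]_x g x.
Proof.
move=> fi gi fg; rewrite !Rintegral_support//; apply: le_Rintegral => //.
  exact: integrableS fi.
exact: integrableS gi.
Qed.

End restricted_measure_transfer.

Section triangle_measure_transfer.
Context (R : realType).
Notation RL := (measurableTypeR R).
Variable t : R.
Implicit Types f g : RL * RL -> R.

Lemma triangle_le_Rintegral f g : Rintegrable (triangle_measure t) f ->
  Rintegrable (triangle_measure t) g -> (forall p, triangle t p -> f p <= g p) ->
  \int[triangle_measure t]_p f p <= \int[triangle_measure t]_p g p.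
Proof. exact: mfrestr_le_Rintegral. Qed.

Lemma triangle_eq_Rintegral f g : Rintegrable (triangle_measure t) f ->
  Rintegrable (triangle_measure t) g -> (forall p, triangle t p -> f p = g p) ->
  \int[triangle_measure t]_p f p = \int[triangle_measure t]_p g p.
Proof.
by move=> fi gi fg; apply/eqP; rewrite eq_le; apply/andP; split;
  apply: triangle_le_Rintegral => // p /fg ->.
Qed.

End triangle_measure_transfer.

(** * Fourier transform of the increments over the triangle *)

Section increments.
Context (R : realType) d (Omega : measurableType d) (P : probability Omega R).
Notation lambda := (@lebesgue_measure R).
Notation RL := (measurableTypeR R).
Variables (alpha c t : R) (Z : R -> Omega -> R).
Hypotheses (alpha1 : 1 < alpha) (c0 : 0 < c) (t0 : 0 <= t)
  (eZ : exponent_process P (fun xi => c * `|xi| `^ alpha) Z).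
Local Notation tri := (triangle_measure t).

Definition increment w (p : RL * RL) : R := Z p.2 w - Z p.1 w.

Let mZ : measurable_fun setT (fun z : Omega * RL => Z z.2 z.1).
Proof. by case: eZ => mZ _ _; exact: mZ. Qed.

Lemma measurable_increment2 d' (T : measurableType d') (f : T -> Omega) (g : T -> RL * RL) :
  measurable_fun setT f -> measurable_fun setT g ->
  measurable_fun setT (fun x => increment (f x) (g x)).
Proof.
move=> mf mg; apply: mfunD; last apply: mfunN.
  apply: (measurableT_comp mZ (_ : measurable_fun setT (fun x => (f x, (g x).2)))).
  by apply: measurable_fun_pair => //; exact: (measurableT_comp measurable_snd mg).
apply: (measurableT_comp mZ (_ : measurable_fun setT (fun x => (f x, (g x).1)))).
by apply: measurable_fun_pair => //; exact: (measurableT_comp measurable_fst mg).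
Qed.

Lemma measurable_increment w : measurable_fun setT (increment w).
Proof. by apply: measurable_increment2 => //; exact: measurable_cst. Qed.

(** The transform as one function of frequency and outcome, the form to which the weighted second
    moment bounds apply. *)
Definition inc_cos (z : RL * Omega) := ft_cos tri (increment z.2) z.1.
Definition inc_sin (z : RL * Omega) := ft_sin tri (increment z.2) z.1.

Lemma measurable_inc_cos : measurable_fun setT inc_cos.
Proof.
apply: (@measurable_RintegralF _ _ _ _ _ tri
  (fun z : (RL * Omega) * (RL * RL) => cos (z.1.1 * increment z.1.2 z.2))).
apply: mfun_cos; apply: mfunM; first exact: (mfun_fst (mfunRL measurable_fst)).
by apply: measurable_increment2 => //; exact: (mfun_fst measurable_snd).
Qed.

Lemma measurable_inc_sin : measurable_fun setT inc_sin.
Proof.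
apply: (@measurable_RintegralF _ _ _ _ _ tri
  (fun z : (RL * Omega) * (RL * RL) => sin (z.1.1 * increment z.1.2 z.2))).
apply: mfun_sin; apply: mfunM; first exact: (mfun_fst (mfunRL measurable_fst)).
by apply: measurable_increment2 => //; exact: (mfun_fst measurable_snd).
Qed.

Lemma inc_cos_bound z : `|inc_cos z| <= t ^+ 2.
Proof.
apply: le_trans (triangle_measure_setT t0).
exact: (ft_cos_bound _ (measurable_increment _)).
Qed.

Lemma inc_sin_bound z : `|inc_sin z| <= t ^+ 2.
Proof.
apply: le_trans (triangle_measure_setT t0).
exact: (ft_sin_bound _ (measurable_increment _)).
Qed.

Let c1 x : `|cos x| <= 1 :> R. Proof. by rewrite ler_norml cos_geN1 cos_le1. Qed.
Let s1 x : `|sin x| <= 1 :> R. Proof. by rewrite ler_norml sin_geN1 sin_le1. Qed.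

Let ibT (f : RL * RL -> R) (M : R) : measurable_fun setT f -> (forall x, `|f x| <= M) ->
  Rintegrable tri f.
Proof. by move=> mf fM; exact: (@Rintegrable_bounded _ _ _ _ _ M). Qed.

Let ibP (f : Omega -> R) (M : R) : measurable_fun setT f -> (forall x, `|f x| <= M) ->
  Rintegrable P f.
Proof. by move=> mf fM; exact: (@Rintegrable_bounded _ _ _ _ _ M). Qed.

(** The squared modulus as a double integral of cosines of differences: this is how four times come
    in. *)
Lemma inc_square xi w : inc_cos (xi, w) ^+ 2 + inc_sin (xi, w) ^+ 2 =
  \int[tri]_p \int[tri]_q cos (xi * (increment w p - increment w q)).
Proof.
have mi := measurable_increment w.
have ic : Rintegrable tri (fun p => cos (xi * increment w p)).
  by apply: (ibT (M := 1)) => //; mfun.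
have is_ : Rintegrable tri (fun p => sin (xi * increment w p)).
  by apply: (ibT (M := 1)) => //; mfun.
have E p : \int[tri]_q cos (xi * (increment w p - increment w q)) =
    inc_cos (xi, w) * cos (xi * increment w p) + inc_sin (xi, w) * sin (xi * increment w p).
  under eq_Rintegral do rewrite mulrBr cosB.
  rewrite RintegralDT; [|exact: RintegrableM..].
  by rewrite !RintegralM// mulrC; congr (_ + _); rewrite mulrC.
under [RHS]eq_Rintegral do rewrite E.
rewrite RintegralDT; [|exact: RintegrableM..].
by rewrite !RintegralM// !expr2.
Qed.

Let psi0 (xi : R) : 0 <= c * `|xi| `^ alpha.
Proof. by rewrite mulr_ge0 ?powR_ge0// ltW. Qed.

(** Fubini moves the expectation inside both integrals over the triangle, where [four_times_bound]
    applies. The factor [c] stays general because speeding up time by [n] multiplies the exponent by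
    [n]. *)
Lemma inc_second_moment (xi : R) : xi != 0 ->
  \int[P]_w (inc_cos (xi, w) ^+ 2 + inc_sin (xi, w) ^+ 2) <=
  12 * t ^+ 2 / (c * `|xi| `^ alpha) ^+ 2.
Proof.
move=> xi0; set kappa := c * _.
have k0 : 0 < kappa by rewrite mulr_gt0 ?powR_gt0 ?normr_gt0.
under eq_Rintegral do rewrite inc_square.
apply: le_trans (pairings_integral_le t0 k0).
pose F (z : Omega * ((RL * RL) * (RL * RL))) :=
  cos (xi * (increment z.1 z.2.1 - increment z.1 z.2.2)).
have m3 : measurable_fun setT (fun z : (RL * RL) * (Omega * (RL * RL)) =>
    cos (xi * (increment z.2.1 z.1 - increment z.2.1 z.2.2))).
  apply: mfun_cos; apply: mfunM; first exact: measurable_cst.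
  apply: mfunD; last apply: mfunN.
    by apply: measurable_increment2; [exact: (mfun_snd measurable_fst)|].
  apply: measurable_increment2; first exact: (mfun_snd measurable_fst).
  exact: (mfun_snd measurable_snd).
have mPQ p : measurable_fun setT (fun z : Omega * (RL * RL) =>
    cos (xi * (increment z.1 p - increment z.1 z.2))).
  exact: (measurable_pair1r p m3).
have iPQ p : Rintegrable (P \x tri)%E (fun z : Omega * (RL * RL) =>
    cos (xi * (increment z.1 p - increment z.1 z.2))).
  apply: (@Rintegrable_prodP _ _ _ _ _ P tri _ (fun=> fine (tri setT))) => //.
  - by move=> w; apply: (ibT (M := 1)) => //; exact: (measurable_pair1r w (mPQ p)).
  - move=> w; rewrite -[leRHS]mul1r -(Rintegral_cst tri measurableT 1).
    apply: le_RintegralT => //; last exact: Rintegrable_cst.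
    apply: Rintegrable_norm; apply: (ibT (M := 1)) => //.
    exact: (measurable_pair1r w (mPQ p)).
  - exact: Rintegrable_cst.
have mI : measurable_fun setT (fun z : Omega * (RL * RL) =>
    \int[tri]_q cos (xi * (increment z.1 z.2 - increment z.1 q))).
  apply: (@measurable_RintegralF _ _ _ _ _ tri (fun z : (Omega * (RL * RL)) * (RL * RL) =>
    cos (xi * (increment z.1.1 z.1.2 - increment z.1.1 z.2)))).
  apply: (measurableT_comp m3 (_ : measurable_fun setT
    (fun z : (Omega * (RL * RL)) * (RL * RL) => (z.1.2, (z.1.1, z.2))))).
  apply: measurable_fun_pair; first exact: (mfun_fst measurable_snd).
  by apply: measurable_fun_pair; [exact: (mfun_fst measurable_fst)|].
have bI w p : `|\int[tri]_q cos (xi * (increment w p - increment w q))| <= t ^+ 2.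
  apply: le_trans (triangle_measure_setT t0).
  have iw : Rintegrable tri (fun q => cos (xi * (increment w p - increment w q))).
    by apply: (ibT (M := 1)) => //; exact: (measurable_pair1r w (mPQ p)).
  apply: (le_trans (le_normr_Rintegral measurableT iw)).
  rewrite -[leRHS]mul1r -(Rintegral_cst tri measurableT 1).
  by apply: le_RintegralT => //; [exact: Rintegrable_norm|exact: Rintegrable_cst].
rewrite (@Rintegral_Fubini _ _ _ _ _ P tri (fun z : Omega * (RL * RL) =>
    \int[tri]_q cos (xi * (increment z.1 z.2 - increment z.1 q)))); first last.
- by move=> p; apply: (ibP (M := t ^+ 2)) => //; exact: (measurable_pair2r p mI).
- by move=> w; apply: (ibT (M := t ^+ 2)) => //; exact: (measurable_pair1r w mI).
- apply: (@Rintegrable_prodP _ _ _ _ _ P tri _ (fun=> t ^+ 2 * fine (tri setT))) => //.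
  + by move=> w; apply: (ibT (M := t ^+ 2)) => //; exact: (measurable_pair1r w mI).
  + move=> w; rewrite -(Rintegral_cst tri measurableT).
    apply: le_RintegralT => //; last exact: Rintegrable_cst.
    apply: Rintegrable_norm; apply: (ibT (M := t ^+ 2)) => //.
    exact: (measurable_pair1r w mI).
  + exact: Rintegrable_cst.
have mE : measurable_fun setT (fun z : (RL * RL) * (RL * RL) =>
    \int[P]_w cos (xi * (increment w z.1 - increment w z.2))).
  apply: (@measurable_RintegralF _ _ _ _ _ P (fun z : ((RL * RL) * (RL * RL)) * Omega =>
    cos (xi * (increment z.2 z.1.1 - increment z.2 z.1.2)))).
  apply: (measurableT_comp m3 (_ : measurable_fun setT
    (fun z : ((RL * RL) * (RL * RL)) * Omega => (z.1.1, (z.2, z.1.2))))).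
  apply: measurable_fun_pair; first exact: (mfun_fst measurable_fst).
  by apply: measurable_fun_pair; [|exact: (mfun_fst measurable_snd)].
have bE p q : `|\int[P]_w cos (xi * (increment w p - increment w q))| <= 1.
  have iw : Rintegrable P (fun w => cos (xi * (increment w p - increment w q))).
    by apply: (ibP (M := 1)) => //; exact: (measurable_pair2r q (mPQ p)).
  apply: (le_trans (le_normr_Rintegral measurableT iw)).
  rewrite -[leRHS]mul1r -[X in _ <= _ * X]/(fine 1%E) -(probability_setT P).
  rewrite -(Rintegral_cst P measurableT 1).
  by apply: le_RintegralT => //; [exact: Rintegrable_norm|exact: Rintegrable_cst].
have mk : measurable_fun setT (fun z : (RL * RL) * (RL * RL) =>
    pairings kappa z.1.1 z.1.2 z.2.1 z.2.2).
  apply: measurable_pairings.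
  - exact: (mfun_fst (mfunRL measurable_fst)).
  - exact: (mfun_fst (mfunRL measurable_snd)).
  - exact: (mfun_snd (mfunRL measurable_fst)).
  - exact: (mfun_snd (mfunRL measurable_snd)).
have ik p : Rintegrable tri (fun q => pairings kappa p.1 p.2 q.1 q.2).
  apply: (ibT (M := 3)); first exact: (measurable_pair1r p mk).
  by move=> q; rewrite ger0_norm; [apply: pairings_le3|exact: pairings_ge0].
have bk p : `|\int[tri]_q pairings kappa p.1 p.2 q.1 q.2| <= 3 * fine (tri setT).
  apply: (le_trans (le_normr_Rintegral measurableT (ik p))).
  rewrite -(Rintegral_cst tri measurableT).
  apply: le_RintegralT; [exact: Rintegrable_norm|exact: Rintegrable_cst|].
  by move=> q; rewrite ger0_norm; [apply: pairings_le3|exact: pairings_ge0].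
have iI : Rintegrable tri (fun p =>
    \int[P]_w \int[tri]_q cos (xi * (increment w p - increment w q))).
  apply: (ibT (M := t ^+ 2)).
    apply: (@measurable_RintegralF _ _ _ _ _ P (fun z : (RL * RL) * Omega =>
       \int[tri]_q cos (xi * (increment z.2 z.1 - increment z.2 q)))).
    apply: (measurableT_comp mI (_ : measurable_fun setT
      (fun z : (RL * RL) * Omega => (z.2, z.1)))).
    exact: measurable_fun_pair.
  move=> p.
  have iw : Rintegrable P (fun w => \int[tri]_q cos (xi * (increment w p - increment w q))).
    by apply: (ibP (M := t ^+ 2)) => //; exact: (measurable_pair2r p mI).
  apply: (le_trans (le_normr_Rintegral measurableT iw)).
  rewrite -[leRHS]mulr1 -[X in _ <= _ * X]/(fine 1%E) -(probability_setT P).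
  rewrite -(Rintegral_cst P measurableT).
  by apply: le_RintegralT => //; [exact: Rintegrable_norm|exact: Rintegrable_cst].
(* The comparison is made on the triangle only, since [four_times_bound] needs nonnegative times. *)
apply: triangle_le_Rintegral => //.
  apply: (ibT (M := 3 * fine (tri setT))) => //.
  exact: (@measurable_RintegralF _ _ _ _ _ tri _ mk).
move=> p [p1 [p12 p2]].
rewrite (Rintegral_Fubini (iPQ p)); first last.
- by move=> q; apply: (ibP (M := 1)) => //; exact: (measurable_pair2r q (mPQ p)).
- by move=> w; apply: (ibT (M := 1)) => //; exact: (measurable_pair1r w (mPQ p)).
have iE : Rintegrable tri (fun q => \int[P]_w cos (xi * (increment w p - increment w q))).
  by apply: (ibT (M := 1)) => //; exact: (measurable_pair1r p mE).
apply: triangle_le_Rintegral => //.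
move=> q [q1 [q12 q2]]; apply: (le_trans (ler_norm _)).
have p20 := lt_trans p1 p12; have q20 := lt_trans q1 q12.
apply: (four_times_bound eZ psi0 _ xi (ltW p1) (ltW p20) (ltW q1) (ltW q20)).
by move=> y; rewrite normrN.
Qed.

(** For [|xi| <= 1] the two squares are at most [t^4] each; for larger [|xi|] the second moment
    bound is used. The power of 2 comes from [1 + |xi| <= 2] in the first case and
    [1 + |xi| <= 2 * |xi|] in the second. *)
Let K : R := 2 `^ (2 * alpha) * (2 * t ^+ 4 + 12 * t ^+ 2 / c ^+ 2).

Lemma inc_weight_bound (xi : R) :
  \int[P]_w (inc_cos (xi, w) ^+ 2 + inc_sin (xi, w) ^+ 2) <= K * stable_weight alpha xi ^+ 2.
Proof.
have t4 : 0 <= 2 * t ^+ 4 by rewrite mulr_ge0 ?exprn_ge0.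
have tc : 0 <= 12 * t ^+ 2 / c ^+ 2 by exact: (divr_ge0 (mulr_ge0 (ler0n R 12) (sqr_ge0 t)) (sqr_ge0 c)).
have ic : Rintegrable P (fun w => inc_cos (xi, w) ^+ 2 + inc_sin (xi, w) ^+ 2).
  apply: (ibP (M := 2 * t ^+ 4)).
    apply: mfunD; apply: mfunX; first exact: (measurable_pair1r xi measurable_inc_cos).
    exact: (measurable_pair1r xi measurable_inc_sin).
  move=> w; have h1 := inc_cos_bound (xi, w); have h2 := inc_sin_bound (xi, w).
  rewrite ger0_norm ?addr_ge0 ?sqr_ge0// (_ : 2 * t ^+ 4 = t ^+ 2 ^+ 2 + t ^+ 2 ^+ 2); last by ring.
  by apply: lerD; rewrite -[leLHS]real_normK ?num_real//; apply: lerXn2r; rewrite // nnegrE ?sqr_ge0.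
have trivial : \int[P]_w (inc_cos (xi, w) ^+ 2 + inc_sin (xi, w) ^+ 2) <= 2 * t ^+ 4.
  rewrite -[leRHS]mulr1 -[X in _ <= _ * X]/(fine 1%E) -(probability_setT P).
  rewrite -(Rintegral_cst P measurableT).
  apply: le_RintegralT => //; first exact: Rintegrable_cst.
  move=> w; have h1 := inc_cos_bound (xi, w); have h2 := inc_sin_bound (xi, w).
  rewrite (_ : 2 * t ^+ 4 = t ^+ 2 ^+ 2 + t ^+ 2 ^+ 2); last by ring.
  by apply: lerD; rewrite -[leLHS]real_normK ?num_real//; apply: lerXn2r; rewrite // nnegrE ?sqr_ge0.
have sq (a : R) : 0 <= a -> (a `^ (- alpha)) ^+ 2 = (a `^ (2 * alpha))^-1.
  by move=> a0; rewrite -powR_mulrn ?powR_ge0// -powRrM -powRN; congr powR; ring.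
have pos : 0 < 1 + `|xi| by rewrite ltr_pwDl.
rewrite /stable_weight sq ?(ltW pos)// ler_pdivlMr ?powR_gt0// mulrC /K.
set I := \int[P]_w _ in trivial *.
have I0 : 0 <= I by apply: Rintegral_ge0 => w _; rewrite addr_ge0 ?sqr_ge0.
have [x1|x1] := leP `|xi| 1.
  apply: ler_pM => //.
    apply: ge0_ler_powR; rewrite ?nnegrE ?(ltW pos)//; last by lra.
    by rewrite mulr_ge0// ltW// (lt_trans _ alpha1).
  by apply: (le_trans trivial); rewrite lerDl.
have xi0 : xi != 0 by rewrite -normr_gt0; lra.
have := inc_second_moment xi0; rewrite -/I exprMn invfM mulrA => h.
apply: (@le_trans _ _ ((1 + `|xi|) `^ (2 * alpha) *
   (12 * t ^+ 2 / c ^+ 2 / (`|xi| `^ alpha) ^+ 2))).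
  by rewrite ler_wpM2l ?powR_ge0.
rewrite -(powR_mulrn 2 (powR_ge0 _ _)) -powRrM [alpha * _]mulrC mulrA mulrAC.
apply: ler_pM => //.
- rewrite ler_pdivrMr; last by rewrite powR_gt0// normr_gt0.
  rewrite -powRM//; apply: ge0_ler_powR; rewrite ?nnegrE ?mulr_ge0 ?(ltW pos)//.
    by rewrite ltW// (lt_trans _ alpha1).
  by lra.
- by rewrite lerDr.
Qed.

End increments.

(** * Self-intersection local time *)

Section square_norm.
Context (R : realType) d (Omega : measurableType d) (P : probability Omega R).

Lemma Lnorm2_le (f : Omega -> R) (b : R) : 0 <= b ->
  (\int[P]_w (f w ^+ 2)%:E <= (b ^+ 2)%:E)%E ->
  (Lnorm P 2%:E (fun w => (f w)%:E) <= b%:E)%E.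
Proof.
move=> b0 fb; rewrite unlock /Lnorm.
rewrite (_ : b%:E = (b ^+ 2)%:E `^ 2^-1)%E; last first.
  by rewrite poweR_EFin powR12_sqrt ?sqr_ge0// sqrtr_sqr ger0_norm.
apply: gt0_ler_poweR; rewrite ?in_itv/= ?leey ?andbT ?lee_fin ?sqr_ge0 ?invr_ge0//.
  by apply: integral_ge0 => w _; rewrite lee_fin powR_ge0.
apply: le_trans fb; rewrite le_eqVlt; apply/orP; left; apply/eqP.
apply: eq_integral => w _ /=.
by rewrite powR_mulrn// -[in RHS](@real_normK _ (f w)) ?num_real.
Qed.

End square_norm.

Section local_time.
Context (R : realType) d (Omega : measurableType d) (P : probability Omega R).
Notation lambda := (@lebesgue_measure R).
Notation RL := (measurableTypeR R).
Variables (alpha c t : R) (Z : R -> Omega -> R).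
Hypotheses (alpha1 : 1 < alpha) (c0 : 0 < c) (t0 : 0 <= t)
  (eZ : exponent_process P (fun xi => c * `|xi| `^ alpha) Z).
Local Notation tri := (triangle_measure t).
Local Notation w := (stable_weight alpha).

Let K : R := 2 `^ (2 * alpha) * (2 * t ^+ 4 + 12 * t ^+ 2 / c ^+ 2).

Let K0 : 0 <= K.
Proof.
rewrite mulr_ge0 ?powR_ge0// addr_ge0//; first by rewrite mulr_ge0 ?exprn_ge0.
exact: (divr_ge0 (mulr_ge0 (ler0n R 12) (sqr_ge0 t)) (sqr_ge0 c)).
Qed.

Let mC := measurable_inc_cos t eZ.
Let mS := measurable_inc_sin t eZ.
Let bC := inc_cos_bound t0 eZ.
Let bS := inc_sin_bound t0 eZ.

Let isq (C : RL * Omega -> R) xi : measurable_fun setT C -> (forall z, `|C z| <= t ^+ 2) ->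
  Rintegrable P (fun om => C (xi, om) ^+ 2).
Proof.
move=> mC' bC'; apply: (@Rintegrable_bounded _ _ _ _ _ (t ^+ 2 ^+ 2)).
  by apply: mfunX; exact: measurable_pair1r mC'.
by move=> om; rewrite normrX; apply: lerXn2r => //; rewrite nnegrE ?sqr_ge0.
Qed.

Let CK (xi : R) : \int[P]_om (inc_cos t Z (xi, om) ^+ 2) <= K * w xi ^+ 2.
Proof.
apply: le_trans (inc_weight_bound alpha1 c0 t0 eZ xi).
have i1 := isq xi mC bC; have i2 := isq xi mS bS.
apply: le_RintegralT => //; first exact: RintegrableD.
by move=> om; rewrite lerDl sqr_ge0.
Qed.

Let SK (xi : R) : \int[P]_om (inc_sin t Z (xi, om) ^+ 2) <= K * w xi ^+ 2.
Proof.
apply: le_trans (inc_weight_bound alpha1 c0 t0 eZ xi).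
have i1 := isq xi mC bC; have i2 := isq xi mS bS.
apply: le_RintegralT => //; first exact: RintegrableD.
by move=> om; rewrite lerDr sqr_ge0.
Qed.

Let iw := Rintegrable_stable_weight alpha1.
Let w0 := stable_weight_gt0 alpha.

Lemma increment_ft_integrable : {ae P, forall om,
  Rintegrable lambda (ft_cos tri (increment Z om)) /\
  Rintegrable lambda (ft_sin tri (increment Z om))}.
Proof.
have h1 := weighted_ae_integrable mC bC w0 iw CK.
have h2 := weighted_ae_integrable mS bS w0 iw SK.
by apply: filterS2 h1 h2 => om; split.
Qed.

(** An explicit, measurable candidate for the L^2 limit. On the null event where the transforms are
    not integrable its value carries no information. *)
Definition local_time om := ft_density tri (increment Z om) 0.

Lemma measurable_local_time : measurable_fun setT local_time.
Proof.
apply: mfunM => //.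
apply: (@measurable_RintegralF _ _ _ _ _ lambda (fun z : Omega * RL =>
  inc_cos t Z (z.2, z.1) * cos (z.2 * 0) + inc_sin t Z (z.2, z.1) * sin (z.2 * 0))).
have msw : measurable_fun setT (fun z : Omega * RL => (z.2, z.1)).
  exact: measurable_fun_pair.
by mfun; [exact: (measurableT_comp mC msw)|exact: (measurableT_comp mS msw)].
Qed.

Lemma measurable_ft_smooth_increment e :
  measurable_fun setT (fun om => ft_smooth tri (increment Z om) e 0).
Proof.
apply: mfunM => //.
apply: (@measurable_RintegralF _ _ _ _ _ lambda (fun z : Omega * RL =>
  expR (- (e * z.2 ^+ 2 / 2)) *
  (inc_cos t Z (z.2, z.1) * cos (z.2 * 0) + inc_sin t Z (z.2, z.1) * sin (z.2 * 0)))).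
have msw : measurable_fun setT (fun z : Omega * RL => (z.2, z.1)).
  exact: measurable_fun_pair.
by mfun; [exact: (measurableT_comp mC msw)|exact: (measurableT_comp mS msw)].
Qed.

(** Common form of two estimates: [g = 1] gives square integrability of [local_time], and
    [g = 1 - expR (- (e * xi^2 / 2))] the error of the approximation. Only the cosine transform
    occurs, as the sines vanish at the point 0; squares on both sides make the sign of [f]
    immaterial. *)
Let L2 (g : R -> R) (A : R) (f : Omega -> R) : measurable_fun setT g ->
  (forall xi, 0 <= g xi <= 1) -> 0 < A -> \int[lambda]_xi (g xi * w xi) <= A ->
  measurable_fun setT f ->
  (forall om, Rintegrable lambda (ft_cos tri (increment Z om)) ->
    f om ^+ 2 = ((2 * pi)^-1 * \int[lambda]_xi (g xi * inc_cos t Z (xi, om))) ^+ 2) ->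
  (Lnorm P 2%:E (fun om => (f om)%:E) <= ((2 * pi)^-1 * Num.sqrt K * A)%:E)%E.
Proof.
move=> mg g01 A0 gA mf fE.
have p0 : 0 <= (2 * pi)^-1 :> R by rewrite invr_ge0 mulr_ge0 ?pi_ge0.
apply: Lnorm2_le; first by rewrite mulr_ge0 ?(ltW A0)// mulr_ge0// sqrtr_ge0.
rewrite !exprMn sqr_sqrtr// -mulrA EFinM.
have h := weighted_L2 mC bC w0 iw CK mg g01 A0 gA.
apply: (@le_trans _ _ (((2 * pi)^-1 ^+ 2)%:E *
   \int[P]_om ((\int[lambda]_xi (g xi * inc_cos t Z (xi, om))) ^+ 2)%:E)%E); last first.
  by apply: lee_wpmul2l; rewrite // lee_fin sqr_ge0.
have mI : measurable_fun setT (fun om => \int[lambda]_xi (g xi * inc_cos t Z (xi, om))).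
  apply: (@measurable_RintegralF _ _ _ _ _ lambda (fun z : Omega * RL =>
    g z.2 * inc_cos t Z (z.2, z.1))).
  apply: mfunM; first exact: (mfun_snd (mfun_ofRL mg)).
  apply: (measurableT_comp mC (_ : measurable_fun setT (fun z : Omega * RL => (z.2, z.1)))).
  exact: measurable_fun_pair.
rewrite -ge0_integralZl//; first last.
- by rewrite lee_fin sqr_ge0.
- by move=> om _; rewrite lee_fin sqr_ge0.
- by apply/measurable_EFinP; exact: mfunX.
apply: ae_ge0_le_integral => //.
- by move=> om _; rewrite lee_fin sqr_ge0.
- by apply/measurable_EFinP; exact: mfunX.
- by move=> om _; rewrite mule_ge0 ?lee_fin ?sqr_ge0.
- by apply/measurable_EFinP; apply: mfunM => //; exact: mfunX.
apply: filterS increment_ft_integrable => om [iC _] _.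
by rewrite fE// exprMn EFinM.
Qed.

Lemma local_time_Lfun : local_time \in Lfun P 2%:E.
Proof.
rewrite inE; apply/andP; split; first by rewrite inE; exact: measurable_local_time.
rewrite inE /finite_norm /=.
(* The added 1 supplies the strict positivity required of [A]. *)
have := @L2 (fun=> 1) (\int[lambda]_xi w xi + 1) local_time.
have W0 : 0 <= \int[lambda]_xi w xi by apply: Rintegral_ge0 => xi _; exact: ltW.
move=> H; apply: le_lt_trans (H _ _ _ _ _ _) _ => //.
- by move=> xi; rewrite ler01 lexx.
- by rewrite ltr_wpDl.
- by under eq_Rintegral do rewrite mul1r; rewrite lerDl.
- exact: measurable_local_time.
- move=> om _; congr (_ ^+ 2); rewrite /local_time /ft_density; congr (_ * _).
  by apply: eq_Rintegral => xi _; rewrite mulr0 cos0 sin0 mulr0 addr0 mul1r mulr1.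
- exact: ltry.
Qed.

Let g (e xi : R) := 1 - expR (- (e * xi ^+ 2 / 2)).

Let g01 e xi : 0 < e -> 0 <= g e xi <= 1.
Proof.
move=> e0; have : expR (- (e * xi ^+ 2 / 2)) <= 1.
  rewrite -[leRHS]expR0 ler_expR lerNl oppr0.
  exact: (divr_ge0 (mulr_ge0 (ltW e0) (sqr_ge0 xi)) (ler0n R 2)).
by have := expR_ge0 (- (e * xi ^+ 2 / 2)); rewrite /g; lra.
Qed.

(** The summand [e] makes the bound positive while still letting it tend to 0. *)
Let A (e : R) := \int[lambda]_xi (g e xi * w xi) + e.

Let A_cvg : A e @[e --> 0^'+] --> 0.
Proof.
rewrite -[X in _ --> X]addr0; apply: cvgD; last first.
  by apply: cvg_at_right_filter; exact: cvg_id.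
apply/cvg_at_rightP => u [u0 u_0].
have := Rintegrable_measurableR iw => mw.
rewrite -[X in _ --> X](_ : \int[lambda]_xi (0 : R) = 0); last first.
  by rewrite Rintegral_cst// mul0r.
have [|||||_ //] := @Rintegral_dominated _ _ _ lambda
  (fun n xi => g (u n) xi * w xi) (fun=> 0) w.
- by move=> n; apply: mfun_ofRL; apply: mfunM => //; rewrite /g; mfun.
- exact: measurable_cst.
- apply: aeW => xi; rewrite -[X in _ --> X](mul0r (w xi)); apply: cvgM; last exact: cvg_cst.
  rewrite -[X in _ --> X](_ : 1 - expR (- (0 * xi ^+ 2 / 2)) = 0); last first.
    by rewrite !mul0r oppr0 expR0 subrr.
  apply: cvgB; first exact: cvg_cst.
  apply: continuous_cvg; first exact: continuous_expR.
  apply: cvgN; apply: cvgM; last exact: cvg_cst.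
  by apply: cvgM => //; exact: cvg_cst.
- exact: iw.
- move=> n xi; have /andP[h1 h2] := g01 xi (u0 n).
  have w0' := ltW (w0 xi).
  by rewrite ger0_norm ?mulr_ge0// ler_piMl.
Qed.

Lemma ft_smooth_local_time :
  Lnorm P 2%:E (fun om => (ft_smooth tri (increment Z om) e 0 - local_time om)%:E)
    @[e --> 0^'+] --> 0%E.
Proof.
apply: (@squeeze_cvge _ _ _ _ (fun=> 0%E) _
   (fun e => ((2 * pi)^-1 * Num.sqrt K * A e)%:E)).
- near=> e; have e0 : 0 < e by near: e; exact: nbhs_right_gt.
  rewrite Lnorm_ge0 /=; apply: (@L2 (g e)) => //.
  + by rewrite /g; mfun.
  + by move=> xi; exact: g01.
  + rewrite ltr_wpDl//; apply: Rintegral_ge0 => xi _.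
    by rewrite mulr_ge0 ?(ltW (w0 _))//; case/andP: (g01 xi e0).
  + by rewrite /A lerDl ltW.
  + by apply: mfunD; [exact: measurable_ft_smooth_increment
      |apply: mfunN; exact: measurable_local_time].
  move=> om iC; have m := Rintegrable_measurableR iC.
  have ie : Rintegrable lambda (fun xi => expR (- (e * xi ^+ 2 / 2)) * inc_cos t Z (xi, om)).
    apply: (Rintegrable_boundedM (B := 1)) => //; first by mfun.
    move=> xi; have := g01 xi e0; rewrite /g => h.
    by rewrite ger0_norm ?expR_ge0//; lra.
  rewrite -sqrrN /local_time /ft_density /ft_smooth opprB -mulrBr; congr ((_ * _) ^+ 2).
  transitivity (\int[lambda]_xi inc_cos t Z (xi, om) -
     \int[lambda]_xi (expR (- (e * xi ^+ 2 / 2)) * inc_cos t Z (xi, om))).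
    congr (_ - _); apply: eq_Rintegral => xi _;
      by rewrite mulr0 cos0 sin0 mulr0 addr0 mulr1.
  rewrite -RintegralBT//; apply: eq_Rintegral => xi _.
  by rewrite /g mulrBl mul1r.
- exact: cvg_cst.
- apply: cvg_EFin; first exact: nearW.
  rewrite -[X in _ --> X](mulr0 ((2 * pi)^-1 * Num.sqrt K)).
  by apply: cvgM; [exact: cvg_cst|exact: A_cvg].
Unshelve. all: by end_near.
Qed.

End local_time.

Section silt_is_local_time.
Context (R : realType) d (Omega : measurableType d) (P : probability Omega R).
Notation lambda := (@lebesgue_measure R).
Notation RL := (measurableTypeR R).
Variables (alpha c t : R) (X Z : R -> Omega -> R).
Hypotheses (alpha1 : 1 < alpha) (c0 : 0 < c) (t0 : 0 <= t)
  (eZ : exponent_process P (fun xi => c * `|xi| `^ alpha) Z)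
  (ZX : forall u om, 0 <= u -> Z u om = X u om).
Local Notation tri := (triangle_measure t).

Lemma approx_silt_ft_smooth e om : 0 < e ->
  approx_silt X e t 0 om = ft_smooth tri (increment Z om) e 0.
Proof.
move=> e0; have mi := measurable_increment eZ om.
transitivity (\int[tri]_p heat_kernel e (0 - increment Z om p)); last first.
  exact: (heat_kernel_occupation _ mi).
have ih : Rintegrable tri (fun p => heat_kernel e (0 - increment Z om p)).
  apply: (@Rintegrable_bounded _ _ _ _ _ ((Num.sqrt (2 * pi * e))^-1)).
    by apply: (measurableT_comp (@measurable_heat_kernel R e)); mfun.
  by move=> p; rewrite ger0_norm ?heat_kernel_ge0// heat_kernel_le.
rewrite (Rintegral_mfrestr ih) /approx_silt.
apply: eq_Rintegral => p; rewrite inE => -[p1 [p12 _]].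
rewrite subr0 sub0r heat_kernelN /increment !ZX//; first exact: ltW.
by rewrite ltW// (lt_trans p1).
Qed.

Lemma local_time_is_silt : is_silt P X t 0 (local_time t Z).
Proof.
split; first exact: (local_time_Lfun alpha1 c0 t0 eZ).
have := ft_smooth_local_time alpha1 c0 t0 eZ.
apply: cvg_trans; apply: near_eq_cvg; near=> e.
by apply: eq_Lnorm => om; rewrite approx_silt_ft_smooth.
Unshelve. all: by end_near.
Qed.

(** [local_time] witnesses that the L^2 limit exists, so [xget] does not fall back on its default
    value. *)
Lemma silt_is_silt : is_silt P X t 0 (silt P X t 0).
Proof.
rewrite /silt; case: xgetP => [L _ //|/(_ (local_time t Z))].
by case; exact: local_time_is_silt.
Qed.

Lemma measurable_silt : measurable_fun setT (silt P X t 0).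
Proof.
have [+ _] := silt_is_silt; rewrite inE => /andP[+ _].
by rewrite inE.
Qed.

(** Uniqueness of L^2 limits: by Minkowski's inequality the norm of the difference is at most the
    sum of the two approximation errors, which tends to 0. *)
Lemma silt_ae_local_time : {ae P, forall om, silt P X t 0 om = local_time t Z om}.
Proof.
have mL := measurable_local_time t eZ.
have mS := measurable_silt.
have [_ cS] := silt_is_silt.
have [_ cL] := local_time_is_silt.
pose f om := silt P X t 0 om - local_time t Z om.
have mf : measurable_fun setT f by rewrite /f; mfun.
have N0 : Lnorm P 2%:E (EFin \o f) = 0%E.
  apply/eqP; rewrite eq_le Lnorm_ge0 andbT.
  have := cvgeD (_ : (0%E +? 0%E)%E) cS cL; rewrite adde0 => /(_ _ isT) H.
  apply: (cvge_to_ge H); near=> e.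
  have e0 : 0 < e by near: e; exact: nbhs_right_gt.
  have mA : measurable_fun setT (approx_silt X e t 0).
    rewrite (_ : approx_silt _ _ _ _ = fun om => ft_smooth tri (increment Z om) e 0).
      exact: (measurable_ft_smooth_increment t eZ).
    by apply/funext => om; exact: approx_silt_ft_smooth.
  pose f1 om := silt P X t 0 om - approx_silt X e t 0 om.
  pose f2 om := approx_silt X e t 0 om - local_time t Z om.
  have mf1 : measurable_fun setT f1 by rewrite /f1; mfun.
  have mf2 : measurable_fun setT f2 by rewrite /f2; mfun.
  have := @minkowski_EFin _ _ _ P f1 f2 2 mf1 mf2 (ler1n _ 2).
  rewrite (_ : f1 \+ f2 = f)%R; last by apply/funext => om; rewrite /f1 /f2 /f /=; ring.
  move=> /le_trans; apply; apply: leeD => //.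
  rewrite -oppe_Lnorm le_eqVlt; apply/orP; left; apply/eqP.
  by apply: eq_Lnorm => om; rewrite /= /f1 -[LHS]/((- _)%:E) opprB.
have := Lnorm_eq0_eq0 _ _ N0; move=> /(_ _ _)[].
- exact/measurable_EFinP.
- by [].
move=> N [mN PN sN]; exists N; split => // om /= h; apply: sN => /= h'; apply: h.
have := h' Logic.I; rewrite /f /= => -[] /eqP.
by rewrite subr_eq0 => /eqP.
Unshelve. all: by end_near.
Qed.

End silt_is_local_time.

(** * Equality in law by moments *)

Section trigonometric_moments.
Context (R : realType) d (Omega : measurableType d) (P : probability Omega R)
  d' (Q : measurableType d') (rho : {sigma_finite_measure set Q -> \bar R}).
Variables (Z : R -> Omega -> R) (B beta : Q -> R) (l : Q -> seq (R * R)).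
Hypotheses (iB : Rintegrable rho B) (mZ : forall u, measurable_fun setT (Z u))
  (mW : measurable_fun setT (fun z : Omega * Q => lincomb Z (l z.2) z.1 + beta z.2)).

Definition trig_integral om := \int[rho]_q (B q * cos (lincomb Z (l q) om + beta q)).

(** The extra cosine is what the induction on [k] needs: one factor of the power can be merged into
    it. *)
Definition trig_moment k l0 b :=
  \int[P]_om (trig_integral om ^+ k * cos (lincomb Z l0 om + b)).

Let c1 x : `|cos x| <= 1 :> R. Proof. by rewrite ler_norml cos_geN1 cos_le1. Qed.

Let mB : measurable_fun setT B. Proof. exact: Rintegrable_measurable iB. Qed.

Let mF : measurable_fun setT (fun z : Omega * Q =>
  B z.2 * cos (lincomb Z (l z.2) z.1 + beta z.2)).
Proof. by apply: mfunM; [exact: mfun_snd|exact: mfun_cos]. Qed.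

Let iF om : Rintegrable rho (fun q => B q * cos (lincomb Z (l q) om + beta q)).
Proof.
apply: Rintegrable_le (Rintegrable_norm iB) _; first exact: (measurable_pair1r om mF).
by move=> q; rewrite normrM ler_piMr.
Qed.

Let A := \int[rho]_q `|B q|.

Lemma measurable_trig_integral : measurable_fun setT trig_integral.
Proof. exact: (@measurable_RintegralF _ _ _ _ _ rho _ mF). Qed.

Lemma trig_integral_bound om : `|trig_integral om| <= A.
Proof.
apply: (le_trans (le_normr_Rintegral measurableT (iF om))).
apply: le_RintegralT; try exact: Rintegrable_norm.
by move=> q; rewrite normrM ler_piMr.
Qed.

Let A0 : 0 <= A. Proof. exact: Rintegral_ge0. Qed.

Lemma measurable_lincomb l0 : measurable_fun setT (lincomb Z l0).
Proof.
elim: l0 => [|p l0 IH].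
  by rewrite (_ : lincomb Z [::] = fun=> 0)//; apply/funext => om; rewrite lincomb_nil.
rewrite (_ : lincomb Z _ = fun om => p.1 * Z p.2 om + lincomb Z l0 om).
  by apply: mfunD => //; exact: mfunM.
by apply/funext => om; rewrite lincomb_cons.
Qed.

Let negl l0 : seq (R * R) := [seq (- p.1, p.2) | p <- l0].

Let integrand_bound k l0 b om : `|trig_integral om ^+ k * cos (lincomb Z l0 om + b)| <= A ^+ k.
Proof.
rewrite normrM -[leRHS]mulr1 ler_pM// normrX.
by apply: lerXn2r; rewrite ?nnegrE// trig_integral_bound.
Qed.

Let m_integrand k l0 b :
  measurable_fun setT (fun om => trig_integral om ^+ k * cos (lincomb Z l0 om + b)).
Proof.
have mY := measurable_trig_integral; have ml := measurable_lincomb l0; mfun.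
Qed.

Let i_integrand k l0 b :
  Rintegrable P (fun om => trig_integral om ^+ k * cos (lincomb Z l0 om + b)).
Proof. exact: (@Rintegrable_bounded _ _ _ _ _ (A ^+ k)). Qed.

(** Fubini and the product formula for two cosines: the sum of the two arguments concatenates the
    lists of terms, the difference concatenates after negating the coefficients. *)
Lemma trig_momentS k l0 b : trig_moment k.+1 l0 b =
  \int[rho]_q (B q * (2^-1 * (trig_moment k (l q ++ l0) (beta q + b) +
    trig_moment k (l q ++ negl l0) (beta q - b)))).
Proof.
pose G (z : Omega * Q) := (trig_integral z.1 ^+ k * cos (lincomb Z l0 z.1 + b)) *
  (B z.2 * cos (lincomb Z (l z.2) z.1 + beta z.2)).
have mG : measurable_fun setT G by apply: mfunM => //; exact: (mfun_fst (m_integrand k l0 b)).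
have bG om q : `|G (om, q)| <= A ^+ k * `|B q|.
  rewrite normrM ler_pM//.
  by rewrite normrM ler_piMr.
have i2 om : Rintegrable rho (fun q => G (om, q)) 
  by exact: (RintegrableM (trig_integral om ^+ k * cos (lincomb Z l0 om + b)) (iF om)).
have i1 q : Rintegrable P (fun om => G (om, q)).
  apply: (@Rintegrable_bounded _ _ _ _ _ (A ^+ k * `|B q|)) => //.
  exact: (measurable_pair2r q mG).
have iG : Rintegrable (P \x rho)%E G.
  apply: (@Rintegrable_prodP _ _ _ _ _ P rho G (fun=> A ^+ k * A)) => //.
    move=> om; rewrite -RintegralM; last exact: Rintegrable_norm.
    apply: le_RintegralT => //; first exact: Rintegrable_norm.
    by apply: RintegrableM; exact: Rintegrable_norm.
  exact: Rintegrable_cst.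
transitivity (\int[P]_om \int[rho]_q G (om, q)).
  apply: eq_Rintegral => om _; rewrite /G /= RintegralM; last exact: iF.
  by rewrite exprSr -/(trig_integral om); ring.
rewrite (Rintegral_Fubini iG i2 i1); apply: eq_Rintegral => q _.
have catE s om : lincomb Z (l q ++ s) om = lincomb Z (l q) om + lincomb Z s om.
  by rewrite /lincomb big_cat.
have negE om : lincomb Z (negl l0) om = - lincomb Z l0 om.
  rewrite /lincomb big_map -sumrN; apply: eq_bigr => p _ /=.
  by rewrite mulNr.
rewrite /trig_moment -RintegralDT// -!RintegralM//; last first.
- exact: RintegrableD.
- exact: (RintegrableM 2^-1 (RintegrableD (i_integrand _ _ _) (i_integrand _ _ _))).
apply: eq_Rintegral => om _; rewrite /G /= !catE negE.
set W := lincomb Z (l q) om; set V := lincomb Z l0 om.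
rewrite (_ : W + V + (beta q + b) = (W + beta q) + (V + b)); last by ring.
rewrite (_ : W - V + (beta q - b) = (W + beta q) - (V + b)); last by ring.
by rewrite (cosD (W + beta q)) (cosB (W + beta q)); field.
Qed.

End trigonometric_moments.

Section equal_moments.
Context (R : realType) d (Omega : measurableType d) (P : probability Omega R)
  d' (Q : measurableType d') (rho : {sigma_finite_measure set Q -> \bar R}).
Variables (psi : R -> R) (Z Z' : R -> Omega -> R) (B beta : Q -> R)
  (l : Q -> seq (R * R)).
Hypotheses (iB : Rintegrable rho B) (eZ : exponent_process P psi Z)
  (eZ' : exponent_process P psi Z') (l0 : forall q, all (fun p => 0 <= p.2) (l q))
  (mW : measurable_fun setT (fun z : Omega * Q => lincomb Z (l z.2) z.1 + beta z.2))
  (mW' : measurable_fun setT (fun z : Omega * Q => lincomb Z' (l z.2) z.1 + beta z.2)).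

Lemma eq_trig_moment k s b : all (fun p => 0 <= p.2) s ->
  trig_moment P rho Z B beta l k s b = trig_moment P rho Z' B beta l k s b.
Proof.
have mZ u := exponent_process_measurable u eZ.
have mZ' u := exponent_process_measurable u eZ'.
elim: k s b => [|k IH] s b s0.
  rewrite /trig_moment; under eq_Rintegral do rewrite expr0 mul1r.
  under [RHS]eq_Rintegral do rewrite expr0 mul1r.
  exact: exponent_process_fdd eZ eZ' s0.
rewrite (trig_momentS P iB mZ mW) (trig_momentS P iB mZ' mW'); apply: eq_Rintegral => q _; congr (_ * (_ * (_ + _))).
  by apply: IH; rewrite all_cat l0.
by apply: IH; rewrite all_cat l0 /= all_map.
Qed.

Lemma eq_trig_integral_moment k :
  \int[P]_om trig_integral rho Z B beta l om ^+ k =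
  \int[P]_om trig_integral rho Z' B beta l om ^+ k.
Proof.
have := @eq_trig_moment k [::] 0 isT; rewrite /trig_moment.
have E (f : Omega -> R) Y : \int[P]_om (f om * cos (lincomb Y [::] om + 0)) = \int[P]_om f om.
  by apply: eq_Rintegral => om _; rewrite lincomb_nil addr0 cos0 mulr1.
by rewrite !E.
Qed.

End equal_moments.

(** * Moments determine the law of a bounded random variable *)

Section bounded_moment_problem.
Context (R : realType) d (Omega : measurableType d) (P : probability Omega R).
Notation lambda := (@lebesgue_measure R).
Notation RL := (measurableTypeR R).
Variables (Y Y' : Omega -> R) (A : R).
Hypotheses (mY : measurable_fun setT Y) (mY' : measurable_fun setT Y')
  (bY : forall w, `|Y w| <= A) (bY' : forall w, `|Y' w| <= A)
  (moments : forall k, \int[P]_w (Y w ^+ k) = \int[P]_w (Y' w ^+ k)).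

Let ibP (f : Omega -> R) (M : R) : measurable_fun setT f -> (forall x, `|f x| <= M) ->
  Rintegrable P f.
Proof. by move=> mf fM; exact: (@Rintegrable_bounded _ _ _ _ _ M). Qed.

Let Rintegral_poly (T : Omega -> R) : measurable_fun setT T -> (forall w, `|T w| <= A) ->
  forall p : {poly R}, \int[P]_w p.[T w] = \sum_(i < size p) p`_i * \int[P]_w (T w ^+ i).
Proof.
move=> mT bT p.
have iX i : Rintegrable P (fun w => T w ^+ i).
  apply: (ibP (M := A ^+ i)); first by mfun.
  by move=> w; rewrite normrX; apply: lerXn2r => //; rewrite nnegrE// (le_trans _ (bT w)).
under eq_Rintegral do rewrite horner_coef.
elim: (size p) => [|n IH].
  by rewrite big_ord0; under eq_Rintegral do rewrite big_ord0; rewrite Rintegral_cst// mul0r.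
rewrite big_ord_recr/= -IH -RintegralM// -RintegralDT//; last first.
- exact: RintegrableM.
- elim: n {IH} => [|n IH].
    under eq_fun do rewrite big_ord0; exact: Rintegrable_cst.
  under eq_fun do rewrite big_ord_recr/=; apply: RintegrableD => //.
  exact: RintegrableM.
by under eq_Rintegral do rewrite big_ord_recr/=.
Qed.

Let eq_poly (p : {poly R}) : \int[P]_w p.[Y w] = \int[P]_w p.[Y' w].
Proof.
by rewrite !Rintegral_poly//; apply: eq_bigr => i _; rewrite moments.
Qed.

(* Taylor polynomials of the Gaussian density [heat_kernel e (x - a)]. *)
Let gauss_poly (e a : R) (n : nat) : {poly R} :=
  (Num.sqrt (2 * pi * e))^-1 *:
  \sum_(0 <= k < n) (k`!%:R^-1 *: ((- (2 * e)^-1) *: ('X - a%:P) ^+ 2) ^+ k).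

Let gauss_polyE e a n x : (gauss_poly e a n).[x] = (Num.sqrt (2 * pi * e))^-1 *
  series (exp_coeff (- ((x - a) ^+ 2 / (2 * e)))) n.
Proof.
rewrite /gauss_poly hornerZ; congr (_ * _); rewrite horner_sum /series /=.
apply: eq_bigr => k _; rewrite hornerZ horner_exp hornerZ horner_exp hornerXsubC.
by rewrite /exp_coeff mulrC; congr (_ ^+ _ / _); ring.
Qed.

Let gauss_poly_cvg e a x : (gauss_poly e a n).[x] @[n --> \oo] --> heat_kernel e (x - a).
Proof.
apply: (eq_cvg_seq (fun n => gauss_polyE e a n x)); rewrite heat_kernelE.
by apply: cvgM; [exact: cvg_cst|exact: is_cvg_series_exp_coeff].
Qed.

(** Absolute values taken term by term leave partial sums of the exponential series at the largest
    possible argument. The bound is uniform in [n], as dominated convergence requires. *)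
Let gauss_poly_bound e a n x : 0 < e -> `|x| <= A ->
  `|(gauss_poly e a n).[x]| <=
  (Num.sqrt (2 * pi * e))^-1 * expR ((A + `|a|) ^+ 2 / (2 * e)).
Proof.
move=> e0 xA; rewrite gauss_polyE normrM ger0_norm ?invr_ge0 ?sqrtr_ge0//.
rewrite ler_wpM2l ?invr_ge0 ?sqrtr_ge0//.
rewrite /series /= (le_trans (ler_norm_sum _ _ _))//.
set u := (A + `|a|) ^+ 2 / (2 * e).
have u0 : 0 <= u by rewrite divr_ge0 ?sqr_ge0// mulr_ge0// ltW.
apply: (@le_trans _ _ (series (exp_coeff u) n)).
  rewrite /series /=; apply: ler_sum => k _; rewrite /exp_coeff normrM.
  rewrite [`|_^-1|]ger0_norm// ler_wpM2r// normrX; apply: lerXn2r; rewrite ?nnegrE//.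
  rewrite normrN ger0_norm; last by rewrite divr_ge0 ?sqr_ge0// mulr_ge0// ltW.
  rewrite ler_wpM2r ?invr_ge0 ?mulr_ge0 ?(ltW e0)//.
  rewrite -[leLHS]real_normK ?num_real//; apply: lerXn2r; rewrite ?nnegrE//.
    by rewrite addr_ge0// (le_trans _ xA).
  by rewrite (le_trans (ler_normB _ _))// lerD2r.
apply: (nondecreasing_cvgn_le _ _ n); last exact: is_cvg_series_exp_coeff.
by apply: nondecreasing_series => k _ _; rewrite /exp_coeff divr_ge0 ?exprn_ge0.
Qed.

(** The Taylor polynomials of the kernel have equal expectations because the moments agree, and they
    converge boundedly on the range [[-A, A]]. *)
Let eq_heat_kernel e a : 0 < e ->
  \int[P]_w heat_kernel e (Y w - a) = \int[P]_w heat_kernel e (Y' w - a).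
Proof.
move=> e0.
have lim (T : Omega -> R) : measurable_fun setT T -> (forall w, `|T w| <= A) ->
    \int[P]_w (gauss_poly e a n).[T w] @[n --> \oo] --> \int[P]_w heat_kernel e (T w - a).
  move=> mT bT.
  have [|||||_ //] := @Rintegral_dominated _ _ _ P (fun n w => (gauss_poly e a n).[T w])
    (fun w => heat_kernel e (T w - a))
    (fun=> (Num.sqrt (2 * pi * e))^-1 * expR ((A + `|a|) ^+ 2 / (2 * e))).
  - move=> n; under eq_fun do rewrite horner_coef.
    by apply: measurable_sum => i; mfun.
  - by apply: (measurableT_comp (@measurable_heat_kernel R e)); mfun.
  - by apply: aeW => w; exact: gauss_poly_cvg.
  - exact: Rintegrable_cst.
  - by move=> n w; exact: gauss_poly_bound.
have h := lim _ mY bY; have h' := lim _ mY' bY'.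
have h2 := eq_cvg_seq (fun n => eq_poly (gauss_poly e a n)) h'.
exact: (cvg_unique _ h h2).
Qed.

(** A bounded continuous [h] is the pointwise limit of its mollifications, which are superpositions
    of heat kernels; on those the two expectations already agree. *)
Lemma bounded_moments_law (h : R -> R) (M : R) : continuous h -> (forall x, `|h x| <= M) ->
  \int[P]_w h (Y w) = \int[P]_w h (Y' w).
Proof.
move=> ch hM; have mh : measurable_fun setT h by exact: continuous_measurable_fun.
have del0 n : 0 < n.+1%:R^-1 :> R by rewrite invr_gt0.
have M0 : 0 <= M := le_trans (normr_ge0 _) (hM 0).
have mF e (T : Omega -> R) : measurable_fun setT T ->
    measurable_fun setT (fun z : Omega * RL => h z.2 * heat_kernel e (T z.1 - z.2)).
  move=> mT; apply: mfunM; first exact: (mfun_snd (mfun_ofRL mh)).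
  apply: (measurableT_comp (@measurable_heat_kernel R e)).
  by mfun; exact: mfun_fst.
have mol e (T : Omega -> R) : 0 < e -> measurable_fun setT T ->
    \int[P]_w \int[lambda]_a (h a * heat_kernel e (T w - a)) =
    \int[lambda]_a (h a * \int[P]_w heat_kernel e (T w - a)).
  move=> e0 mT.
  have i2 w : Rintegrable lambda (fun a => h a * heat_kernel e (T w - a)).
    by apply: (Rintegrable_boundedM (B := M)) => //; exact: Rintegrable_heat_kernelB.
  have ihP a : Rintegrable P (fun w => heat_kernel e (T w - a)).
    apply: (ibP (M := (Num.sqrt (2 * pi * e))^-1)).
      by apply: (measurableT_comp (@measurable_heat_kernel R e)); mfun.
    by move=> w; rewrite ger0_norm ?heat_kernel_ge0// heat_kernel_le.
  rewrite (@Rintegral_Fubini _ _ _ _ _ P lambda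
    (fun z : Omega * RL => h z.2 * heat_kernel e (T z.1 - z.2)))//=.
  - by apply: eq_Rintegral => a _; rewrite RintegralM.
  - apply: (@Rintegrable_prodP _ _ _ _ _ P lambda _ (fun=> M)) => //.
    + exact: mF.
    + move=> w /=; under eq_Rintegral do rewrite normrM (ger0_norm (heat_kernel_ge0 _ _)).
      have h1M x : `| `|h x| | <= M by rewrite normr_id.
      apply: (le_trans (ler_norm _)).
      apply: (@mollify_bound _ (fun x => `|h x|) M) => //.
      exact: measurableT_comp.
    + exact: Rintegrable_cst.
  - by move=> a; exact: RintegrableM.
have lim (T : Omega -> R) : measurable_fun setT T ->
    \int[P]_w \int[lambda]_a (h a * heat_kernel n.+1%:R^-1 (T w - a)) @[n --> \oo] -->
    \int[P]_w h (T w).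
  move=> mT.
  have [|||||_ //] := @Rintegral_dominated _ _ _ P
    (fun n w => \int[lambda]_a (h a * heat_kernel n.+1%:R^-1 (T w - a)))
    (fun w => h (T w)) (fun=> M).
  - by move=> n; exact: (@measurable_RintegralF _ _ _ _ _ lambda _ (mF _ _ mT)).
  - exact: measurableT_comp.
  - by apply: aeW => w; exact: mollify_cvg hM (ch _) del0 cvg_harmonic.
  - exact: Rintegrable_cst.
  - by move=> n w; exact: mollify_bound.
have E n : \int[P]_w \int[lambda]_a (h a * heat_kernel n.+1%:R^-1 (Y w - a)) =
    \int[P]_w \int[lambda]_a (h a * heat_kernel n.+1%:R^-1 (Y' w - a)).
  rewrite (mol _ _ (del0 n) mY) (mol _ _ (del0 n) mY').
  by apply: eq_Rintegral => a _; congr (_ * _); exact: (eq_heat_kernel a (del0 n)).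
exact: (cvg_unique _ (lim _ mY) (eq_cvg_seq E (lim _ mY'))).
Qed.

End bounded_moment_problem.

(** * Iterated products of sigma-finite measures *)

Section product_sigma_finite.
Context d1 d2 (T1 : measurableType d1) (T2 : measurableType d2) (R : realType).
Variables (m1 : {sigma_finite_measure set T1 -> \bar R})
  (m2 : {sigma_finite_measure set T2 -> \bar R}).
Implicit Types f : T1 * T2 -> R.

Let sigma_finiteX : sigma_finite setT (m1 \x m2)%E.
Proof.
have /sigma_finiteP[F [TF ndF Foo]] := sigma_finiteT m1.
have /sigma_finiteP[G [TG ndG Goo]] := sigma_finiteT m2.
exists (fun n => F n `*` G n) => [|k].
  rewrite -setXTT TF TG; apply/seteqP; split => -[x y] [].
    move=> [n _ Fx] [k _ Gy]; exists (maxn n k) => //; split.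
      by move: {Gy} x Fx; exact/subsetPset/ndF/leq_maxl.
    by move: {Fx} y Gy; exact/subsetPset/ndG/leq_maxr.
  by move=> n _ [? ?]; split; exists n.
have [mF Fk] := Foo k; have [mG Gk] := Goo k.
split; first exact: measurableX.
by rewrite product_measure1E// lte_mul_pinfty// ge0_fin_numE.
Qed.

Let m12 : {measure set (T1 * T2)%type -> \bar R} := (m1 \x m2)%E.

(** Packaged as a sigma-finite measure so that it can itself be a factor of another product and
    serve as the parameter measure of [trig_integral]. *)
Definition product_measure : {sigma_finite_measure set (T1 * T2)%type -> \bar R} :=
  HB.pack (Measure.sort m12) (Measure_isSigmaFinite.Build _ _ _ m12 sigma_finiteX).

Lemma Rintegrable_productP f (b : T1 -> R) : measurable_fun setT f ->
  (forall x, Rintegrable m2 (fun y => f (x, y))) ->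
  (forall x, \int[m2]_y `|f (x, y)| <= b x) -> Rintegrable m1 b ->
  Rintegrable product_measure f.
Proof. exact: Rintegrable_prodP. Qed.

Lemma Rintegral_product f : Rintegrable product_measure f ->
  (forall x, Rintegrable m2 (fun y => f (x, y))) ->
  \int[product_measure]_z f z = \int[m1]_x \int[m2]_y f (x, y).
Proof. exact: Rintegral_prod. Qed.

End product_sigma_finite.

Section mollified_occupation.
Context d (T : measurableType d) (R : realType).
Notation lambda := (@lebesgue_measure R).
Notation RL := (measurableTypeR R).
Local Notation plane := (product_measure lambda lambda).
Variables (mu : {finite_measure set T -> \bar R}) (f : R -> R) (e : R).
Hypotheses (fi : Rintegrable lambda f) (e0 : 0 < e).

(** A parameter [q = (p, (y, xi))] consists of a point of [T], a position and a frequency; this is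
    the coefficient of [cos (xi * (v p - y))] in the mollified occupation integral. *)
Definition occ_amplitude (q : T * (RL * RL)) : R :=
  (2 * pi)^-1 * f q.2.1 * expR (- (e * q.2.2 ^+ 2 / 2)).

Let ig := Rintegrable_expR_sqr e0.

Let mamp : measurable_fun setT (fun z : RL * RL =>
  (2 * pi)^-1 * f z.1 * expR (- (e * z.2 ^+ 2 / 2))).
Proof.
have mf := Rintegrable_measurableR fi.
by apply: mfunM; [apply: mfunM => //; exact: (mfun_fst (mfun_ofRL mf))|mfun].
Qed.

Let iamp : Rintegrable plane (fun z : RL * RL =>
  (2 * pi)^-1 * f z.1 * expR (- (e * z.2 ^+ 2 / 2))).
Proof.
apply: (@Rintegrable_productP _ _ _ _ _ lambda lambda _
  (fun y => (\int[lambda]_xi expR (- (e * xi ^+ 2 / 2))) * `|(2 * pi)^-1 * f y|)) => //.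
- by move=> y; exact: (RintegrableM ((2 * pi)^-1 * f y) ig).
- move=> y /=; under eq_Rintegral do rewrite normrM (ger0_norm (expR_ge0 _)).
  by rewrite RintegralM// mulrC.
- by apply: RintegrableM; apply: Rintegrable_norm; exact: RintegrableM.
Qed.

Lemma Rintegrable_occ_amplitude : Rintegrable (product_measure mu plane) occ_amplitude.
Proof.
apply: (@Rintegrable_productP _ _ _ _ _ mu plane _
  (fun=> \int[plane]_z `|(2 * pi)^-1 * f z.1 * expR (- (e * z.2 ^+ 2 / 2))|)) => //.
- exact: mfun_snd mamp.
- exact: Rintegrable_cst.
Qed.

Lemma mollify_occupation_trig (v : T -> R) : measurable_fun setT v ->
  \int[mu]_p \int[lambda]_y (f y * heat_kernel e (v p - y)) =
  \int[(product_measure mu plane)]_q (occ_amplitude q * cos (q.2.2 * (v q.1 - q.2.1))).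
Proof.
move=> mv; have mf := Rintegrable_measurableR fi.
have c1 x : `|cos x| <= 1 :> R by rewrite ler_norml cos_geN1 cos_le1.
have mamp' : measurable_fun setT occ_amplitude by exact: mfun_snd mamp.
have m2 : measurable_fun setT (fun q : T * (RL * RL) => q.2.2 * (v q.1 - q.2.1)).
  apply: mfunM; first exact: (mfun_snd (mfunRL measurable_snd)).
  apply: mfunD; first exact: mfun_fst.
  by apply: mfunN; exact: (mfun_snd (mfunRL measurable_fst)).
have mG : measurable_fun setT (fun q : T * (RL * RL) =>
    occ_amplitude q * cos (q.2.2 * (v q.1 - q.2.1))).
  by apply: mfunM => //; exact: mfun_cos.
have i2 p : Rintegrable plane (fun z : RL * RL =>
    occ_amplitude (p, z) * cos (z.2 * (v p - z.1))).
  apply: Rintegrable_le (Rintegrable_norm iamp) _; first exact: (measurable_pair1r p mG).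
  by move=> z; rewrite normrM ler_piMr.
rewrite (@Rintegral_product _ _ _ _ _ mu plane); first last.
- exact: i2.
- apply: Rintegrable_le (Rintegrable_norm Rintegrable_occ_amplitude) _ => // q.
  by rewrite normrM ler_piMr.
apply: eq_Rintegral => p _.
have i3 y : Rintegrable lambda (fun xi => expR (- (e * xi ^+ 2 / 2)) * cos (xi * (v p - y))).
  apply: Rintegrable_leR ig _; first by mfun.
  by move=> xi; rewrite normrM ger0_norm ?expR_ge0// ler_piMr ?expR_ge0.
rewrite (@Rintegral_product _ _ _ _ _ lambda lambda); first last.
- move=> y /=.
  have := RintegrableM ((2 * pi)^-1 * f y) (i3 y).
  by apply: eq_integrable => // xi _; rewrite /= /occ_amplitude /= mulrA.
- exact: i2.
apply: eq_Rintegral => y _; rewrite /occ_amplitude /=.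
transitivity (\int[lambda]_xi ((2 * pi)^-1 * f y *
    (expR (- (e * xi ^+ 2 / 2)) * cos (xi * (v p - y))))); last first.
  by apply: eq_Rintegral => xi _; rewrite mulrA.
rewrite RintegralM// heat_kernel_fourier//.
by rewrite mulrACA mulVf ?mul1r// gt_eqF// mulr_gt0// pi_gt0.
Qed.

End mollified_occupation.

Section occupation_law.
Context (R : realType) d (Omega : measurableType d) (P : probability Omega R).
Notation lambda := (@lebesgue_measure R).
Notation RL := (measurableTypeR R).
Variables (alpha c t : R) (f : R -> R) (B : R).
Hypotheses (alpha1 : 1 < alpha) (c0 : 0 < c) (t0 : 0 <= t)
  (fi : Rintegrable lambda f) (fB : forall x, `|f x| <= B).
Local Notation tri := (triangle_measure t).
Local Notation stable Z := (exponent_process P (fun xi => c * `|xi| `^ alpha) Z).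
Local Notation Q := ((RL * RL) * (RL * RL))%type.

(* The triangle carries [tri], so truncating the times at 0 changes nothing; it
   makes all the times in [occ_terms] admissible. *)
Let clip (p : RL * RL) : RL * RL := (Num.max 0 p.1 : R, Num.max 0 p.2 : R).

Let occ_terms (q : Q) : seq (R * R) :=
  [:: (q.2.2, (clip q.1).2); (- q.2.2, (clip q.1).1)].

Let mclip : measurable_fun setT clip.
Proof.
apply: measurable_fun_pair => //; apply: measurable_maxr => //.
Qed.

Let lincomb_occ (Z : R -> Omega -> R) (q : Q) om : lincomb Z (occ_terms q) om + - (q.2.2 * q.2.1) =
  q.2.2 * (increment Z om (clip q.1) - q.2.1).
Proof. by rewrite !lincomb_cons lincomb_nil /= /increment /=; ring. Qed.

Let mW (Z : R -> Omega -> R) : stable Z -> measurable_fun setT (fun z : Omega * Q =>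
  lincomb Z (occ_terms z.2) z.1 + - (z.2.2.2 * z.2.2.1)).
Proof.
move=> eZ; under eq_fun do rewrite lincomb_occ.
have m1 : @measurable_fun _ _ Q R setT (fun q => q.2.1).
  exact: (mfun_snd (mfunRL measurable_fst)).
have m2 : @measurable_fun _ _ Q R setT (fun q => q.2.2).
  exact: (mfun_snd (mfunRL measurable_snd)).
apply: mfunM; first exact: mfun_snd m2.
apply: mfunD; last by apply: mfunN; exact: mfun_snd m1.
apply: (measurable_increment2 eZ) => //.
exact: (mfun_snd (mfun_fst mclip)).
Qed.

Let mollified (Z : R -> Omega -> R) e om := \int[tri]_p \int[lambda]_y (f y * heat_kernel e (increment Z om p - y)).

Let rho : {sigma_finite_measure set Q -> \bar R} := product_measure tri (product_measure lambda lambda).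

Let mollified_trig (Z : R -> Omega -> R) e om : stable Z -> 0 < e -> mollified Z e om =
  trig_integral rho Z (occ_amplitude f e) (fun q => - (q.2.2 * q.2.1)) occ_terms om.
Proof.
move=> eZ e0; have mi := measurable_increment eZ om.
have mic : measurable_fun setT (fun p => increment Z om (clip p)).
  exact: (measurableT_comp mi mclip).
transitivity (\int[tri]_p \int[lambda]_y (f y * heat_kernel e (increment Z om (clip p) - y))).
  have mol (v : RL * RL -> R) : measurable_fun setT v ->
      Rintegrable tri (fun p => \int[lambda]_y (f y * heat_kernel e (v p - y))).
    move=> mv; apply: (@Rintegrable_bounded _ _ _ _ _ B).
      apply: (@measurable_RintegralF _ _ _ _ _ lambda (fun z : (RL * RL) * RL =>
        f z.2 * heat_kernel e (v z.1 - z.2))).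
      apply: mfunM; first exact: (mfun_snd (mfun_ofRL (Rintegrable_measurableR fi))).
      apply: (measurableT_comp (@measurable_heat_kernel R e)).
      by mfun; exact: mfun_fst.
    by move=> p; apply: mollify_bound => //; exact: Rintegrable_measurableR fi.
  apply: triangle_eq_Rintegral; [exact: mol|exact: mol|].
  move=> [p1 p2] [/= p10 [p12 p2t]]; apply: eq_Rintegral => y _.
  have p20 := lt_trans p10 p12.
  have -> // : clip (p1, p2) = (p1, p2) by rewrite /clip /= !max_r// ltW.
rewrite (mollify_occupation_trig tri fi e0 mic) /trig_integral.
by apply: eq_Rintegral => q _; rewrite lincomb_occ.
Qed.

Lemma occupation_law Z Z' (h : R -> R) (M : R) : stable Z -> stable Z' -> continuous h ->
  (forall x, `|h x| <= M) ->
  \int[P]_om h (\int[tri]_p f (increment Z om p)) =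
  \int[P]_om h (\int[tri]_p f (increment Z' om p)).
Proof.
move=> eZ eZ' ch hM; have mh : measurable_fun setT h by exact: continuous_measurable_fun.
have mf := Rintegrable_measurableR fi.
have del0 n : 0 < n.+1%:R^-1 :> R by rewrite invr_gt0.
have mY Y : stable Y -> measurable_fun setT (fun om => \int[tri]_p f (increment Y om p)).
  move=> eY; apply: (@measurable_RintegralF _ _ _ _ _ tri (fun z : Omega * (RL * RL) =>
    f (increment Y z.1 z.2))).
  by apply: (measurableT_comp mf); exact: (measurable_increment2 eY).
have mm Y e : stable Y -> 0 < e -> measurable_fun setT (mollified Y e).
  move=> eY e0; rewrite (_ : mollified Y e = trig_integral rho Y (occ_amplitude f e)
      (fun q => - (q.2.2 * q.2.1)) occ_terms); last first.
    by apply/funext => om; exact: mollified_trig.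
  apply: measurable_trig_integral; last exact: mW.
  exact: Rintegrable_occ_amplitude.
have lim Y : stable Y -> \int[P]_om h (mollified Y n.+1%:R^-1 om) @[n --> \oo] -->
    \int[P]_om h (\int[tri]_p f (increment Y om p)).
  move=> eY.
  have [|||||_ //] := @Rintegral_dominated _ _ _ P
    (fun n om => h (mollified Y n.+1%:R^-1 om))
    (fun om => h (\int[tri]_p f (increment Y om p))) (fun=> M).
  - by move=> n; apply: (measurableT_comp mh); exact: mm.
  - by apply: (measurableT_comp mh); exact: mY.
  (* As [f] need not be continuous, its mollifications may fail to converge pointwise. Convergence
     of the functional comes from the almost sure existence of an occupation density. *)
  - apply: filterS (increment_ft_integrable alpha1 c0 t0 eY) => om [iC iS].
    apply: continuous_cvg; first exact: ch.
    have mi := measurable_increment eY om.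
    rewrite (occupation_density mi iC iS fi fB).
    exact: (mollify_occupation_cvg mi iC iS fi del0 cvg_harmonic).
  - exact: Rintegrable_cst.
  - by move=> n om.
have E n : \int[P]_om h (mollified Z n.+1%:R^-1 om) = \int[P]_om h (mollified Z' n.+1%:R^-1 om).
  have iA := Rintegrable_occ_amplitude tri fi (del0 n).
  have bd Y om : stable Y -> `|mollified Y n.+1%:R^-1 om| <=
      \int[rho]_q `|occ_amplitude f n.+1%:R^-1 q|.
    move=> eY; rewrite mollified_trig//; apply: trig_integral_bound => //; exact: mW.
  apply: (bounded_moments_law (mm _ _ eZ (del0 n)) (mm _ _ eZ' (del0 n))
    (fun om => bd _ om eZ) (fun om => bd _ om eZ') _ ch hM) => k.
  have l0 q : all (fun p : R * R => 0 <= p.2) (occ_terms q) by rewrite /= !le_max lexx.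
  have H := eq_trig_integral_moment (beta := fun q : Q => - (q.2.2 * q.2.1)) iA eZ eZ' l0 (mW eZ) (mW eZ') k.
  have T Y : stable Y -> \int[P]_om (mollified Y n.+1%:R^-1 om ^+ k) =
      \int[P]_om (trig_integral rho Y (occ_amplitude f n.+1%:R^-1)
        (fun q => - (q.2.2 * q.2.1)) occ_terms om ^+ k).
    by move=> eY; apply: eq_Rintegral => om _; rewrite (mollified_trig om eY (del0 n)).
  exact: (etrans (T _ eZ) (etrans H (esym (T _ eZ')))).
exact: (cvg_unique _ (lim _ eZ) (eq_cvg_seq E (lim _ eZ'))).
Qed.

End occupation_law.

(** * Scaling *)

Section time_change.
Context (R : realType).
Notation lambda := (@lebesgue_measure R).
Notation RL := (measurableTypeR R).
Variables (F : RL * RL -> R) (B : R).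
Hypotheses (mF : measurable_fun setT F) (FB : forall p, `|F p| <= B).

Let B0 : 0 <= B. Proof. exact: le_trans (normr_ge0 _) (FB (0, 0)). Qed.

Let K (a : R) (p : RL * RL) : R := \1_(triangle a) p * F p.

Let mK a : measurable_fun setT (K a).
Proof. by apply: mfunM => //; apply: measurable_indic; exact: measurable_triangle. Qed.

Let I (a x : R) : R := \1_(`[0, a]%classic) x.

Let iI a : Rintegrable lambda (I a). Proof. exact: integrable_indic_itv. Qed.

Let I0 a x : 0 <= I a x. Proof. by rewrite /I indicE. Qed.

Let K_le a x y : `|K a (x, y)| <= B * (I a x * I a y).
Proof.
rewrite /K indicE; case: (boolP ((x, y) \in triangle a)) => [|_].
  rewrite inE => -[/= x0 [xy ya]]; rewrite mul1r (le_trans (FB _))//.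
  rewrite /I !indicE !mem_set ?mulr1//= in_itv/=.
    by rewrite (ltW (lt_trans x0 xy)) ltW.
  by rewrite (ltW x0) ltW// (lt_trans xy).
by rewrite mul0r normr0 !mulr_ge0.
Qed.

Let iK2 a x : Rintegrable lambda (fun y => K a (x, y)).
Proof.
have iB := RintegrableM (B * I a x) (iI a).
apply: Rintegrable_le iB _; first exact: (measurable_pair1r x (mK a)).
by move=> y; rewrite -mulrA; exact: K_le.
Qed.

Lemma Rintegrable_triangle_section a y :
  Rintegrable lambda (fun x => \1_(triangle a) (x, y) * F (x, y)).
Proof.
have iB := RintegrableM (B * I a y) (iI a).
apply: Rintegrable_le iB _; first exact: (measurable_pair2r y (mK a)).
by move=> x; rewrite -mulrA [I a y * _]mulrC; exact: K_le.
Qed.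

Let iK a : Rintegrable (lambda \x lambda)%E (K a).
Proof.
have iB := RintegrableM (B * \int[lambda]_y I a y) (iI a).
apply: (@Rintegrable_prodP _ _ _ _ _ lambda lambda (K a) _ (mK a) (iK2 a) _ iB) => x.
rewrite mulrAC -RintegralM//; apply: le_RintegralT.
- by apply: Rintegrable_norm; exact: iK2.
- exact: RintegrableM.
- by move=> y; rewrite -mulrA; exact: K_le.
Qed.

Lemma triangle_Rintegral a :
  \int[triangle_measure a]_p F p = \int[lambda]_x \int[lambda]_y (\1_(triangle a) (x, y) * F (x, y)).
Proof.
have iF : Rintegrable (triangle_measure a) F by exact: (@Rintegrable_bounded _ _ _ _ _ B).
rewrite (Rintegral_mfrestr iF) Rintegral_mkcond.
transitivity (\int[(lambda \x lambda)%E]_p K a p).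
  apply: eq_Rintegral => p _; rewrite patchE /K indicE.
  by case: ifPn => _; rewrite ?mul1r ?mul0r.
exact: (Rintegral_prod (iK a) (iK2 a)).
Qed.

Lemma triangle_Rintegral_swap a :
  \int[triangle_measure a]_p F p = \int[lambda]_y \int[lambda]_x (\1_(triangle a) (x, y) * F (x, y)).
Proof.
by rewrite triangle_Rintegral; exact: (Rintegral_Fubini (iK a) (iK2 a) (Rintegrable_triangle_section a)).
Qed.

Lemma triangle_scale n a : 0 < n ->
  \int[triangle_measure (n * a)]_p F p =
  n ^+ 2 * \int[lambda]_x \int[lambda]_y (\1_(triangle a) (x, y) * F (n * x : R, n * y : R)).
Proof.
move=> n0; rewrite triangle_Rintegral.
have scale (g : R -> R) : Rintegrable lambda g ->
    Rintegrable lambda (fun x => g (n * x)) /\ \int[lambda]_x g x = n * \int[lambda]_x g (n * x).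
  move=> ig; have [i1 E] := Rintegral_affine 0 n0 ig.
  have e x : g (n * x + 0) = g (n * x) by rewrite addr0.
  split; first by move: i1; apply: eq_integrable => // x _; rewrite /= e.
  rewrite -[LHS](mulVKf (lt0r_neq0 n0)) -E; congr (_ * _).
  by apply: eq_Rintegral => x _; rewrite e.
have iH := Rintegrable_fubiniF (iK (n * a)) (iK2 (n * a)).
rewrite (scale _ iH).2 expr2 -mulrA; congr (_ * _).
have E x : \int[lambda]_y K (n * a) (n * x : R, y) =
    n * \int[lambda]_y (\1_(triangle a) (x, y) * F (n * x : R, n * y : R)).
  rewrite (scale _ (iK2 (n * a) (n * x))).2; congr (_ * _); apply: eq_Rintegral => y _.
  rewrite /K !indicE; congr (_%:R * _); congr nat_of_bool.
  apply/idP/idP; rewrite !inE => -[/= x0 [xy ya]].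
    by move: x0 xy ya; rewrite pmulr_rgt0// !ltr_pM2l.
  by split => /=; rewrite ?pmulr_rgt0// !ltr_pM2l.
under eq_Rintegral do rewrite E.
have [i1 _] := scale _ iH; rewrite RintegralM//.
have := RintegrableM n^-1 i1; apply: eq_integrable => // x _.
by rewrite /= E mulKf// gt_eqF.
Qed.

End time_change.

(** * Iterated time integrals as integrals over the triangle *)

Section iterated_time_integral.
Context (R : realType).
Notation lambda := (@lebesgue_measure R).
Notation RL := (measurableTypeR R).
Implicit Types (a : R) (g : R -> R).

Lemma Rintegral_itv_indic a g : measurable_fun setT g ->
  \int[lambda]_(x in `[0, a]) g x = \int[lambda]_x ((0 < x < a)%R%:R * g x).
Proof.
move=> mg; transitivity (\int[lambda]_(x in `]0, a[) g x).
  rewrite /Rintegral; congr fine; apply/esym.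
  rewrite integral_itv_obnd_cbnd; last first.
    by apply/measurable_EFinP; exact: measurable_funTS.
  by rewrite integral_itv_bndo_bndc//; apply/measurable_EFinP; exact: measurable_funTS.
rewrite Rintegral_mkcond; apply: eq_Rintegral => x _.
rewrite patchE mem_setE in_itv/=; by case: ifPn => _; rewrite ?mul1r ?mul0r.
Qed.

Lemma iterated_triangle (F : RL * RL -> R) B a : measurable_fun setT F ->
  (forall p, `|F p| <= B) ->
  \int[lambda]_(u in `[0, a]) \int[lambda]_(v in `[0, u]) F (v, u) =
  \int[triangle_measure a]_p F p.
Proof.
move=> mF FB; rewrite (triangle_Rintegral_swap mF FB).
(* The endpoint [u = a] belongs to the interval but to no pair of [triangle a]; the larger triangle
   gives the right section for every [u] in [[0, a]]. The endpoints are discarded afterwards as a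
   null set. *)
pose g (u : R) := \int[lambda]_v (\1_(triangle (a + 1)) (v, u) * F (v, u)).
have mg : measurable_fun setT g.
  apply: (@measurable_RintegralF _ _ _ _ _ lambda (fun z : RL * RL =>
    \1_(triangle (a + 1)) (z.2, z.1) * F (z.2, z.1))).
  have msw : measurable_fun setT (fun z : RL * RL => (z.2, z.1)).
    exact: measurable_fun_pair.
  apply: mfunM; last exact: (measurableT_comp mF msw).
  apply: (measurableT_comp _ msw); apply: measurable_indic; exact: measurable_triangle.
transitivity (\int[lambda]_(u in `[0, a]) g u).
  apply: eq_Rintegral => u; rewrite inE/= in_itv/= => /andP[u0 ua].
  rewrite Rintegral_itv_indic; last exact: (measurable_pair2r u mF).
  apply: eq_Rintegral => v _; rewrite indicE; congr (_%:R * _); congr nat_of_bool.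
  apply/idP/idP; rewrite inE; last by move=> -[/= v0 [vu _]]; rewrite v0.
  move=> /andP[v0 vu]; split => //=; split => //.
  by rewrite (le_lt_trans ua)// ltrDl.
rewrite Rintegral_itv_indic//; apply: eq_Rintegral => u _.
have ig : Rintegrable lambda (fun v => \1_(triangle (a + 1)) (v, u) * F (v, u)).
  exact: (Rintegrable_triangle_section mF FB).
rewrite /g -RintegralM//; apply: eq_Rintegral => v _.
rewrite mulrA !indicE -natrM mulnb; congr (_%:R * _); congr nat_of_bool.
apply/idP/idP; rewrite !inE.
  by move=> /andP[/andP[u0 ua]]; rewrite inE => -[/= v0 [vu _]].
move=> [/= v0 [vu ua]]; rewrite ua (lt_trans v0 vu)/= inE; split => //=; split => //.
by rewrite (lt_trans ua)// ltrDl.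
Qed.

End iterated_time_integral.

(** * Self-similarity and convergence in law *)

Section assembly.
Context (R : realType) d (Omega : measurableType d) (P : probability Omega R).
Notation lambda := (@lebesgue_measure R).
Notation RL := (measurableTypeR R).
Variables (F : R -> set (set Omega)) (alpha : R) (X : R -> Omega -> R) (f : R -> R)
  (t B : R).
Hypotheses (alpha1 : 1 < alpha) (F_complete : is_complete_filtration P F)
  (X_stable : is_symmetric_stable_process P F alpha X)
  (mf : measurable_fun setT f) (fB : forall x, `|f x| <= B)
  (f_moment : (\int[lambda]_x (`|x * f x|)%:E < +oo)%E) (t0 : 0 < t).

(** On [[-1, 1]] the bound [B] dominates [|f|]; outside, [|f x| <= |x * f x|]. *)
Lemma Rintegrable_of_moment : Rintegrable lambda f.
Proof.
have iX : Rintegrable lambda (fun x => `|x * f x|).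
  apply/integrableP; split; first by apply/measurable_EFinP; apply: mfun_ofRL; mfun.
  by under eq_integral do rewrite /= normr_id.
have iI : Rintegrable lambda (\1_(`[-1, 1]%classic) : R -> R) by exact: integrable_indic_itv.
apply: Rintegrable_leR (RintegrableD (RintegrableM B iI) iX) _ => // x.
have B0 : 0 <= B := le_trans (normr_ge0 _) (fB 0).
rewrite indicE mem_setE in_itv/= -ler_norml.
have [x1|x1] := leP `|x| 1; first by rewrite mulr1 (le_trans (fB x))// lerDl.
by rewrite mulr0 add0r normrM ler_peMl// ltW.
Qed.

Let fi := Rintegrable_of_moment.

Let Z u w := X (Num.max 0 u) w.

Let eZ : exponent_process P (fun xi => `|xi| `^ alpha) Z.
Proof. exact: (stable_exponent_process F_complete X_stable). Qed.

Let eZ1 : exponent_process P (fun xi => 1 * `|xi| `^ alpha) Z.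
Proof. by move: eZ; congr exponent_process; apply/funext => xi; rewrite mul1r. Qed.

Let ZX u om : 0 <= u -> Z u om = X u om.
Proof. by move=> u0; rewrite /Z max_r. Qed.

(** The spatial scale of an [alpha]-stable process over time [n], and also what remains of the
    factor [n^2] of the time change after dividing by [n^(2 - 1/alpha)]. *)
Let lam (n : nat) : R := n%:R `^ alpha^-1.

Let lam_gt0 n : (0 < n)%N -> 0 < lam n.
Proof. by move=> n0; rewrite powR_gt0// ltr0n. Qed.

Let alpha0 : 0 < alpha. Proof. exact: lt_trans alpha1. Qed.

Let Zt n u := Z (n%:R * u).
Let Zs n u om := lam n * Z u om.

Let eZt n : (0 < n)%N -> exponent_process P (fun xi => n%:R * `|xi| `^ alpha) (Zt n).
Proof. by move=> n0; apply: exponent_process_timescale eZ; rewrite ltr0n. Qed.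

(* Self-similarity: the two rescaled processes have the same exponent. *)
Let eZs n : (0 < n)%N -> exponent_process P (fun xi => n%:R * `|xi| `^ alpha) (Zs n).
Proof.
move=> n0; have := exponent_process_scale (lam n) eZ; congr exponent_process.
apply/funext => xi; rewrite normrM powRM// ger0_norm ?powR_ge0//.
by rewrite /lam -powRrM mulVf ?gt_eqF// powRr1.
Qed.

Let Y (n : nat) w := (n%:R `^ (2 - alpha^-1))^-1 *
  \int[lambda]_(u in `[0, n%:R * t]) \int[lambda]_(v in `[0, u]) f (X u w - X v w).

Let mfi (W : R -> Omega -> R) psi w : exponent_process P psi W ->
  measurable_fun setT (fun p => f (increment W w p)).
Proof.
move=> [mW _ _]; apply: (measurableT_comp mf); apply: mfunD; last apply: mfunN.
  apply: (measurableT_comp mW (_ : measurable_fun setT (fun p : RL * RL => (w, p.2 : R)))).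
  by apply: measurable_fun_pair => //; exact: (mfunRL measurable_snd).
apply: (measurableT_comp mW (_ : measurable_fun setT (fun p : RL * RL => (w, p.1 : R)))).
by apply: measurable_fun_pair => //; exact: (mfunRL measurable_fst).
Qed.

Let YE n w : (0 < n)%N ->
  Y n w = lam n * \int[triangle_measure t]_p f (increment (Zt n) w p).
Proof.
move=> n0; have n0' : 0 < n%:R :> R by rewrite ltr0n.
pose G (p : RL * RL) := f (increment Z w p).
have mG : measurable_fun setT G := mfi w eZ.
have mGt := mfi w (eZt n0).
have E : \int[lambda]_(u in `[0, n%:R * t]) \int[lambda]_(v in `[0, u]) f (X u w - X v w) =
    n%:R ^+ 2 * \int[triangle_measure t]_p f (increment (Zt n) w p).
  transitivity (\int[triangle_measure (n%:R * t)]_p G p).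
    rewrite -(iterated_triangle (B := B) _ mG); last by move=> p; exact: fB.
    apply: eq_Rintegral => u; rewrite inE/= in_itv/= => /andP[u0 _].
    apply: eq_Rintegral => v; rewrite inE/= in_itv/= => /andP[v0 _].
    by rewrite /G /increment /= !ZX.
  rewrite (triangle_scale (B := B) mG) ?(triangle_Rintegral (B := B) mGt)//.
  by move=> p; exact: fB.
rewrite /Y E mulrA; congr (_ * _).
rewrite powRB; last by apply/implyP => _; rewrite gt_eqF.
by rewrite invf_div powR_mulrn// divfK// expf_neq0// gt_eqF.
Qed.

Let mT W c : exponent_process P (fun xi => c * `|xi| `^ alpha) W ->
  measurable_fun setT (fun w => \int[triangle_measure t]_p f (increment W w p)).
Proof.
move=> eW; apply: (@measurable_RintegralF _ _ _ _ _ (triangle_measure t)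
  (fun z : Omega * (RL * RL) => f (increment W z.1 z.2))).
by apply: (measurableT_comp mf); exact: (measurable_increment2 eW).
Qed.

Let mY n : measurable_fun setT (Y n).
Proof.
case: n => [|n].
  (* For [n = 0] the outer integral is over the single point 0. *)
  rewrite (_ : Y 0%N = fun=> 0); first exact: measurable_cst.
  by apply/funext => w; rewrite /Y mul0r set_itv1 Rintegral_set1 mulr0.
rewrite (_ : Y n.+1 = fun w => lam n.+1 *
    \int[triangle_measure t]_p f (increment (Zt n.+1) w p)); last first.
  by apply/funext => w; exact: YE.
by apply: mfunM => //; exact: mT (eZt _).
Qed.

Let lamV_cvg : (lam n.+1)^-1 @[n --> \oo] --> 0.
Proof.
have h := powR_pinfty_cvg0 (_ : 0 < alpha^-1); rewrite invr_gt0 in h.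
have c : n.+1%:R @[n --> \oo] --> (+oo : set_system R).
  by rewrite (cvg_shiftS (fun n => n%:R : R)); exact: cvgr_idn.
have := cvg_comp _ _ c (h alpha0).
by apply: eq_cvg_seq => n; rewrite /lam -powRN.
Qed.

Let J := \int[lambda]_x f x.

Lemma law_limit (h : R -> R) (M : R) : continuous h -> (forall x, `|h x| <= M) ->
  \int[P]_w h (Y n w) @[n --> \oo] --> \int[P]_w h (J * local_time t Z w).
Proof.
move=> ch hM; have mh : measurable_fun setT h by exact: continuous_measurable_fun.
(* Skips the index 0, at which [lam] vanishes. *)
rewrite -(cvg_shiftS (fun n => \int[P]_w h (Y n w))).
have mL := measurable_local_time t eZ1.
(* The paths of [Zt n] change with [n] in an uncontrolled way; after the exchange all functionals
   depend on the same path of [Z], so an almost sure limit makes sense. *)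
have E n : \int[P]_w h (Y n.+1 w) = \int[P]_w h (lam n.+1 *
    \int[triangle_measure t]_p f (lam n.+1 * increment Z w p)).
  have chl : continuous (fun x => h (lam n.+1 * x)).
    move=> x; apply: (@cvg_comp _ _ _ (fun x => lam n.+1 * x) h); last exact: ch.
    by apply: cvgM; [exact: cvg_cst|exact: cvg_id].
  have n0 : 0 < n.+1%:R :> R by rewrite ltr0n.
  have := occupation_law alpha1 n0 (ltW t0) fi fB (eZt (ltn0Sn n)) (eZs (ltn0Sn n)) chl
    (fun x => hM (lam n.+1 * x)).
  move=> H; transitivity (\int[P]_w h (lam n.+1 *
     \int[triangle_measure t]_p f (increment (Zt n.+1) w p))).
    by apply: eq_Rintegral => w _; rewrite YE.
  rewrite H; apply: eq_Rintegral => w _; congr (h (_ * _)).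
  by apply: eq_Rintegral => p _; rewrite /increment /Zs mulrBr.
apply: (eq_cvg_seq E).
have [|||||_ //] := @Rintegral_dominated _ _ _ P
  (fun n w => h (lam n.+1 * \int[triangle_measure t]_p f (lam n.+1 * increment Z w p)))
  (fun w => h (J * local_time t Z w)) (fun=> M).
- move=> n; apply: (measurableT_comp mh); apply: mfunM => //.
  have := mT (eZs (ltn0Sn n)); congr measurable_fun; apply/funext => w.
  by apply: eq_Rintegral => p _; rewrite /increment /Zs mulrBr.
- by apply: (measurableT_comp mh); mfun.
- apply: filterS (increment_ft_integrable alpha1 ltr01 (ltW t0) eZ1) => w [iC iS].
  apply: continuous_cvg; first exact: ch.
  have mi := measurable_increment eZ1 w.
  exact: (occupation_rescaled_cvg mi iC iS fi fB (fun n => lam_gt0 (ltn0Sn n)) lamV_cvg).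
- exact: Rintegrable_cst.
- by move=> n w.
Qed.

Lemma silt_cvg_in_law : cvg_in_law P Y (fun w => J * silt P X t 0 w).
Proof.
have mS := measurable_silt alpha1 ltr01 (ltW t0) eZ1 ZX.
have mL := measurable_local_time t eZ1.
split => [//||h ch [M0 [_ HM]]]; first by mfun.
have hM x : `|h x| <= M0 + 1 by apply: HM => //; rewrite ltrDl.
have mh : measurable_fun setT h by exact: continuous_measurable_fun.
have ihV (V : Omega -> R) : measurable_fun setT V -> Rintegrable P (fun w => h (V w)).
  move=> mV; apply: (@Rintegrable_bounded _ _ _ _ _ (M0 + 1)) => //.
  exact: measurableT_comp.
have EE (V : Omega -> R) : measurable_fun setT V ->
    'E_P[h \o V]%E = (\int[P]_w h (V w))%:E.
  by move=> mV; rewrite unlock EFin_Rintegral//; exact: ihV.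
have mJS : measurable_fun setT (fun w => J * silt P X t 0 w) by mfun.
have mJL : measurable_fun setT (fun w => J * local_time t Z w) by mfun.
rewrite EE//.
(* The expectation does not depend on which representative of the L^2 limit was picked. *)
have -> : \int[P]_w h (J * silt P X t 0 w) = \int[P]_w h (J * local_time t Z w).
  rewrite /Rintegral; congr fine; apply: ae_eq_integral => //.
  - by apply/measurable_EFinP; exact: measurableT_comp.
  - by apply/measurable_EFinP; exact: measurableT_comp.
  by apply: filterS (silt_ae_local_time alpha1 ltr01 (ltW t0) eZ1 ZX) => w -> _.
rewrite (_ : (fun n => _) = fun n => (\int[P]_w h (Y n w))%:E); last first.
  by apply/funext => n; exact: EE.
apply: cvg_EFin; first exact: nearW.
exact: law_limit hM.
Qed.

End assembly.

Theorem theorem1p1 (R : realType) (d : measure_display)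
    (Omega : measurableType d) (P : probability Omega R)
    (F : R -> set (set Omega)) (alpha : R) (X : R -> Omega -> R) (f : R -> R)
    (alpha_gt1 : 1 < alpha) (alpha_lt2 : alpha < 2)
    (F_complete : is_complete_filtration P F)
    (X_stable : is_symmetric_stable_process P F alpha X)
    (f_measurable : measurable_fun setT f) (f_bounded : bounded_fun f)
    (f_moment : (\int[lebesgue_measure]_x (`|x * f x|)%:E < +oo)%E)
    (t : R) (t_gt0 : 0 < t) :
  cvg_in_law P
    (fun n w => (n%:R `^ (2 - alpha^-1))^-1 *
       \int[lebesgue_measure]_(u in `[0, n%:R * t])
         \int[lebesgue_measure]_(v in `[0, u]) f (X u w - X v w))
    (fun w => (\int[lebesgue_measure]_x f x) * silt P X t 0 w).
Proof.
have [M [_ HM]] := f_bounded.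
(* [bounded_fun] guarantees the bound only for constants strictly above [M]. *)
have fB x : `|f x| <= M + 1 by apply: HM => //; rewrite ltrDl.
exact: (silt_cvg_in_law alpha_gt1 F_complete X_stable f_measurable fB f_moment t_gt0).
Qed.
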